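(* Let $d\geq 1$ be an integer and $n\ge 0$ real. Put $S^{+}_{2,n,d}:=1$ and, for $n>d/2$, $S^{+}_{\infty,n,d}:=\frac{1}{(4\pi)^{d/4}}\left(\frac{\Gamma(n-d/2)}{\Gamma(n)}\right)^{1/2}$. Then $S^{+}_{r,n,d}$ is the sharp imbedding constant, i.e. $S_{r,n,d}=S^{+}_{r,n,d}$, if $n\geq 0$, $r=2$ or if $n>d/2$, $r=\infty$. In fact: (i) for any $n\geq 0$ and any nonzero $f\in H^n(\mathbf R^d,\mathbf C)$, $$\lim_{\lambda\to0^+}\frac{\|f^{(\lambda)}\|_{L^2}}{\|f^{(\lambda)}\|_{H^n}}=1=S^{+}_{2,n,d},\qquad\text{where } f^{(\lambda)}(x):=f(\lambda x)\ \text{ for } x\in\mathbf R^d,\ \lambda\in(0,+\infty);$$ (ii) for $n>d/2$, $$\|f\|_{L^\infty}=S^{+}_{\infty,n,d}\,\|f\|_{H^n}\qquad\text{for } f:=\mathcal F^{-1}\left(\frac{1}{(1+|k|^2)^n}\right)=G_{2n,d}.$$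
   Context: The Fourier transform $\mathcal F$ on $\mathcal S'(\mathbf R^d,\mathbf C)$ is normalized so that $\mathcal F f(k)=(2\pi)^{-d/2}\int_{\mathbf R^d}e^{-ik\cdot x}f(x)\,dx$ for $f\in L^1(\mathbf R^d,\mathbf C)$; $\mathcal F^{-1}$ is its inverse. For real $n\geq 0$, the Sobolev (Bessel potential) space is $H^n(\mathbf R^d,\mathbf C):=\{f\in\mathcal S'(\mathbf R^d,\mathbf C) : (1+|k|^2)^{n/2}\mathcal F f\in L^2(\mathbf R^d,\mathbf C)\}$, with norm $\|f\|_{H^n}:=\|(1+|k|^2)^{n/2}\mathcal F f\|_{L^2}$, where $k$ is the Fourier variable and $|k|$ its Euclidean norm. The sharp imbedding constant is $$S_{r,n,d}:=\inf\{S\geq 0 : \|f\|_{L^r}\leq S\,\|f\|_{H^n}\ \text{for all } f\in H^n(\mathbf R^d,\mathbf C)\}.$$ For $\nu>0$, $$G_{\nu,d}:=\mathcal F^{-1}\left(\frac{1}{(1+|k|^2)^{\nu/2}}\right)=\frac{|x|^{\nu/2-d/2}}{2^{\nu/2-1}\Gamma(\nu/2)}K_{\nu/2-d/2}(|x|),$$ where $\Gamma$ is the Gamma function and $K_{\mu}$ denotes the modified Bessel function of the third kind (Macdonald function) of order $\mu$. *)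

(* Defs.v *)
From HB Require Import structures.
From mathcomp Require Import all_boot all_order all_algebra.
From mathcomp Require Import complex.
From mathcomp Require Import all_classical all_reals all_analysis.

Set Implicit Arguments.
Unset Strict Implicit.
Unset Printing Implicit Defensive.

Import Order.TTheory GRing.Theory Num.Theory.
Import numFieldNormedType.Exports.

Local Open Scope classical_set_scope.
Local Open Scope ring_scope.
Local Open Scope complex_scope.

Section row_vector_measurable.
Context {R : realType} (d : nat).

Definition coord (i : 'I_d) (x : 'rV[R]_d) : R := x ord0 i.

Let rV0 : g_sigma_preimage coord set0.
Proof. exact: sigma_algebra0. Qed.

Let rVC A : g_sigma_preimage coord A -> g_sigma_preimage coord (~` A).
Proof. exact: sigma_algebraC. Qed.

Let rV_bigcup (F : _^nat) : (forall i, g_sigma_preimage coord (F i)) ->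
  g_sigma_preimage coord (\bigcup_i (F i)).
Proof. exact: sigma_algebra_bigcup. Qed.

(* Generated by the coordinates, this is the Borel sigma-algebra. *)
HB.instance Definition _ := @isMeasurable.Build default_measure_display
  'rV[R]_d (g_sigma_preimage coord) rV0 rVC rV_bigcup.

End row_vector_measurable.

Section lebesgue_rV.
Context {R : realType}.

Definition consrV d (p : measurableTypeR R * 'rV[R]_d) : 'rV[R]_d.+1 :=
  row_mx (p.1)%:M p.2 : 'rV[R]_(1 + d).

Fixpoint lebesgue_rV d : set 'rV[R]_d -> \bar R :=
  match d with
  | 0 => dirac (0 : 'rV[R]_0)
  | d'.+1 => pushforward (lebesgue_measure \x @lebesgue_rV d')%E (@consrV d')
  end.

Lemma measurable_coord d (i : 'I_d) :
  measurable_fun [set: 'rV[R]_d] (coord i).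
Proof.
move=> _ A mA; rewrite setTI; apply: sub_sigma_algebra.
case: d i => [[]//|d] i.
rewrite -bigcup_mkord_ord; exists i => //=.
by exists A => //; rewrite setTI inord_val.
Qed.

Lemma measurable_rV dis (T : measurableType dis) d (f : T -> 'rV[R]_d) :
  (forall i, measurable_fun [set: T] (coord i \o f)) ->
  measurable_fun [set: T] f.
Proof.
move=> mf _ A mA; rewrite setTI.
have : preimage_set_system setT f (g_sigma_preimage (@coord R d)) (f @^-1` A).
  by exists A => //; rewrite setTI.
rewrite -g_sigma_preimage_comp; apply: smallest_sub => //.
  exact: sigma_algebra_measurable.
case: d f mf A mA => [|d] f mf A mA; first by rewrite big_ord0.
rewrite -bigcup_mkord_ord => B [i _ [C mC <-]]; exact: mf.
Qed.

Lemma consrV0 d (p : measurableTypeR R * 'rV[R]_d) : coord ord0 (consrV p) = p.1.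
Proof.
transitivity (row_mx (p.1)%:M p.2 ord0 (lshift d (ord0 : 'I_1))).
  by congr (row_mx _ _ _ _); exact/val_inj.
by rewrite row_mxEl mxE eqxx mulr1n.
Qed.

Lemma consrVS d (p : measurableTypeR R * 'rV[R]_d) i :
  coord (lift ord0 i) (consrV p) = coord i p.2.
Proof.
transitivity (row_mx (p.1)%:M p.2 ord0 (rshift 1 i)).
  by congr (row_mx _ _ _ _); exact/val_inj.
by rewrite row_mxEr.
Qed.

Lemma measurable_consrV d : measurable_fun setT (@consrV d).
Proof.
apply: measurable_rV => i; case: (unliftP ord0 i) => [j|] ->.
  rewrite (_ : _ \o _ = coord j \o snd); last first.
    by apply/funext => p /=; rewrite consrVS.
  exact: measurableT_comp (measurable_coord j) measurable_snd.
rewrite (_ : _ \o _ = fst); first exact: measurable_fst.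
by apply/funext => p /=; rewrite consrV0.
Qed.

Lemma consrV_inj d : injective (@consrV d).
Proof.
move=> p q pq; rewrite [p]surjective_pairing [q]surjective_pairing.
rewrite -!consrV0 pq; congr pair; apply/rowP => i.
by have := consrVS p i; rewrite pq consrVS => e; exact/esym.
Qed.

Definition unconsrV d (x : 'rV[R]_d.+1) : measurableTypeR R * 'rV[R]_d :=
  (coord ord0 x, \row_i coord (lift ord0 i) x).

Lemma unconsrVK d : cancel (@unconsrV d) (@consrV d).
Proof.
move=> x; apply/rowP => i; case: (unliftP ord0 i) => [j|] ->.
  by have /= := consrVS (unconsrV x) j; rewrite /coord/= mxE.
exact: consrV0 (unconsrV x).
Qed.

Lemma consrVK d : cancel (@consrV d) (@unconsrV d).
Proof. by move=> p; apply: consrV_inj; rewrite unconsrVK. Qed.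

Lemma measurable_unconsrV d : measurable_fun setT (@unconsrV d).
Proof.
apply/measurable_fun_pairP; split; first exact: measurable_coord.
apply: measurable_rV => i.
rewrite (_ : _ \o _ = coord (lift ord0 i)); first exact: measurable_coord.
by apply/funext => x; rewrite /coord/= mxE.
Qed.

(* The library's own sigma-finite instance for products is shadowed by the one
   for finite measures. *)
Lemma product_measure_sigma_finite d1 d2 (T1 : measurableType d1)
    (T2 : measurableType d2) (m1 : {sigma_finite_measure set T1 -> \bar R})
    (m2 : {sigma_finite_measure set T2 -> \bar R}) :
  sigma_finite setT (m1 \x m2)%E.
Proof.
have /sigma_finiteP[F [TF ndF Foo]] := sigma_finiteT m1.
have /sigma_finiteP[G [TG ndG Goo]] := sigma_finiteT m2.
exists (fun n => F n `*` G n).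
  rewrite -setXTT TF TG predeqE => -[x y]; split.
    move=> [/= [n _ Fnx] [k _ Gky]]; exists (maxn n k) => //; split.
    - by move: x Fnx; exact/subsetPset/ndF/leq_maxl.
    - by move: y Gky; exact/subsetPset/ndG/leq_maxr.
  by move=> [n _ []/= ? ?]; split; exists n.
move=> k; have [? ?] := Foo k; have [? ?] := Goo k.
split; first exact: measurableX.
by rewrite product_measure1E// lte_mul_pinfty// ge0_fin_numE.
Qed.

Lemma pushforward_sigma_finite d1 d2 (T1 : measurableType d1)
    (T2 : measurableType d2) (m : {measure set T1 -> \bar R})
    (f : T1 -> T2) (g : T2 -> T1) :
  sigma_finite setT m ->
  measurable_fun setT f -> measurable_fun setT g -> cancel f g ->
  exists mu : {sigma_finite_measure set T2 -> \bar R}, pushforward m f = mu.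
Proof.
move=> [F FT Foo] mf mg fK.
have p_sf : sigma_finite setT (pushforward m f).
  exists (fun n => g @^-1` F n).
    by rewrite -preimage_bigcup -FT preimage_setT.
  move=> n; have [mF Fn] := Foo n; split.
    by rewrite -[X in measurable X]setTI; exact: mg.
  rewrite /pushforward -comp_preimage (_ : g \o f = id)//.
  by apply/funext => x /=; rewrite fK.
have [M ME] : exists M : {measure set T2 -> \bar R}, pushforward m f = M.
  by unshelve eexists (pushforward m f).
rewrite ME in p_sf *.
pose H1 := isSFinite.Build _ _ _ (Measure.sort M)
  (sfinite_measure_sigma_finite p_sf).
pose H2 := isSigmaFinite.Build _ _ _ (Measure.sort M) p_sf.
by exists (HB.pack_for (SigmaFiniteMeasure.type T2 R) (Measure.sort M) H1 H2).
Qed.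

Lemma lebesgue_rV_sigma_finite_measure d :
  exists mu : {sigma_finite_measure set 'rV[R]_d -> \bar R},
    lebesgue_rV (d := d) = mu.
Proof.
elim: d => [|d [mu muE]]; first by exists (dirac (0 : 'rV[R]_0)).
rewrite /= muE.
apply: (pushforward_sigma_finite (m := (lebesgue_measure \x mu)%E)
  _ (measurable_consrV (d := d)) (measurable_unconsrV (d := d))
  (consrVK (d := d))).
exact: product_measure_sigma_finite.
Qed.

Let lebesgue_rV0 d : lebesgue_rV (d := d) set0 = 0%E.
Proof.
by have [mu ->] := lebesgue_rV_sigma_finite_measure d; exact: measure0.
Qed.

Let lebesgue_rV_ge0 d A : (0 <= lebesgue_rV (d := d) A)%E.
Proof.
by have [mu ->] := lebesgue_rV_sigma_finite_measure d; exact: measure_ge0.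
Qed.

Let lebesgue_rV_semi_sigma_additive d :
  semi_sigma_additive (lebesgue_rV (d := d)).
Proof.
have [mu ->] := lebesgue_rV_sigma_finite_measure d.
exact: measure_semi_sigma_additive.
Qed.

HB.instance Definition _ d := isMeasure.Build _ _ _ (@lebesgue_rV d)
  (lebesgue_rV0 d) (@lebesgue_rV_ge0 d) (@lebesgue_rV_semi_sigma_additive d).

Let lebesgue_rV_sigma_finite d : sigma_finite setT (lebesgue_rV (d := d)).
Proof.
by have [mu ->] := lebesgue_rV_sigma_finite_measure d; exact: sigma_finiteT.
Qed.

HB.instance Definition _ d := @Measure_isSigmaFinite.Build _ _ _
  (@lebesgue_rV d) (lebesgue_rV_sigma_finite d).

End lebesgue_rV.
Arguments lebesgue_rV {R} d.

Section functions_rV.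
Context {R : realType} {d : nat}.
Implicit Types (u phi : 'rV[R]_d -> R[i]) (x k : 'rV[R]_d).

Definition dotrV x k : R := \sum_(i < d) x ord0 i * k ord0 i.

(* The norm the library puts on ['rV[R]_d] is the sup norm. *)
Definition enorm x : R := Num.sqrt (dotrV x x).

Definition Refun u x : R := complex.Re (u x).
Definition Imfun u x : R := complex.Im (u x).
Definition absfun u x : R := ComplexField.Normc.normc (u x).

Definition cmeasurable u :=
  measurable_fun [set: 'rV[R]_d] (Refun u) /\
  measurable_fun [set: 'rV[R]_d] (Imfun u).

(* Only meaningful when both parts are integrable. *)
Definition cintegral u : R[i] :=
  Rintegral (lebesgue_rV d) setT (Refun u) +i*
  Rintegral (lebesgue_rV d) setT (Imfun u).

Definition cLnorm (p : \bar R) u : \bar R :=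
  'N[lebesgue_rV d]_p[EFin \o absfun u]%E.

Definition in_Lp (p : \bar R) u := cmeasurable u /\ (cLnorm p u < +oo)%E.

Definition unit_rV (i : 'I_d) : 'rV[R]_d := delta_mx ord0 i.

Definition partial (i : 'I_d) phi : 'rV[R]_d -> R[i] := fun x =>
  'D_(unit_rV i) (Refun phi) x +i* 'D_(unit_rV i) (Imfun phi) x.

Definition partials (s : seq 'I_d) phi := foldr partial phi s.

Definition smooth phi := forall (s : seq 'I_d) x,
  differentiable (Refun (partials s phi)) x /\
  differentiable (Imfun (partials s phi)) x.

Definition schwartz_seminorm (N : nat) phi : \bar R :=
  ereal_sup [set ((1 + enorm x ^+ 2) ^+ N * absfun (partials s phi) x)%:E
            | x in [set: 'rV[R]_d] & s in [set s | (size s <= N)%N]].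

Definition schwartz phi :=
  smooth phi /\ forall N, (schwartz_seminorm N phi < +oo)%E.

(* A distribution is a functional on all functions; only its values on Schwartz
   functions are meaningful. *)
Definition functional := ('rV[R]_d -> R[i]) -> R[i].
Implicit Types T U : functional.

Definition eqD T U := forall phi, schwartz phi -> T phi = U phi.

(* The seminorms increase with [N], so a linear functional is continuous if and
   only if it is bounded by a multiple of one of them. *)
Definition tempered T :=
  (forall (a : R[i]) phi psi, schwartz phi -> schwartz psi ->
    T (fun x => a * phi x + psi x) = a * T phi + T psi) /\
  exists (N : nat) (C : R), forall phi, schwartz phi ->
    ((ComplexField.Normc.normc (T phi))%:E <= C%:E * schwartz_seminorm N phi)%E.

(* Bilinear pairing, without conjugation. *)
Definition distr_of u : functional := fun phi => cintegral (fun x => u x * phi x).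

Definition mulD (m : 'rV[R]_d -> R) T : functional :=
  fun phi => T (fun x => (m x)%:C * phi x).

(* For [0 < l], [dilateD l (distr_of f)] is [distr_of (fun x => f (l *: x))]. *)
Definition dilateD (l : R) T : functional :=
  fun phi => ((l ^+ d)^-1)%:C * T (fun x => phi (l^-1 *: x)).

Definition in_LpD (p : \bar R) T := exists u, in_Lp p u /\ eqD T (distr_of u).

(* All L^p functions representing [T] are equal almost everywhere, hence have the
   same norm; the value is [+oo] if there are none. *)
Definition LnormD (p : \bar R) T : \bar R :=
  ereal_inf [set cLnorm p u | u in [set u | in_Lp p u /\ eqD T (distr_of u)]].

Definition fourier phi : 'rV[R]_d -> R[i] := fun k =>
  ((2 * pi) `^ (- (d%:R / 2)))%:C *
  cintegral (fun x => (cos (dotrV k x) -i* sin (dotrV k x)) * phi x).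

(* The transpose of [fourier] for the pairing of [distr_of]; by Fubini it extends
   the Fourier transform of L^1 functions. *)
Definition fourierD T : functional := fun phi => T (fourier phi).

(* The inverse of [fourierD] on tempered distributions, which determines the
   result up to [eqD]. *)
Definition inv_fourierD T : functional :=
  xget T [set U | tempered U /\ eqD (fourierD U) T].

Definition jweight (s : R) (k : 'rV[R]_d) : R := (1 + enorm k ^+ 2) `^ (s / 2).

Definition in_sobolev (n : R) T :=
  tempered T /\ in_LpD 2%:E (mulD (jweight n) (fourierD T)).

Definition sobolev_norm (n : R) T : \bar R :=
  LnormD 2%:E (mulD (jweight n) (fourierD T)).

Definition besselG (nu : R) : functional :=
  inv_fourierD (distr_of (fun k => (1 / jweight nu k)%:C)).

End functions_rV.

Arguments functional : clear implicits.

Definition imbedding_constant {R : realType} (r : \bar R) (n : R) (d : nat)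
    : \bar R :=
  ereal_inf [set S%:E | S in [set S : R | 0 <= S /\
    forall f : functional R d, in_sobolev n f ->
      (LnormD r f <= S%:E * sobolev_norm n f)%E]].

Definition Gamma {R : realType} (s : R) : R :=
  Rintegral lebesgue_measure `]0, +oo[ (fun t : R => t `^ (s - 1) * expR (- t)).

Definition Splus2 {R : realType} (n : R) (d : nat) : R := 1.

Definition Splusoo {R : realType} (n : R) (d : nat) : R :=
  1 / (4 * pi) `^ (d%:R / 4) * (Gamma (n - d%:R / 2) / Gamma n) `^ (1 / 2).

(* Main.v *)
(* A complex function is split into its real and imaginary parts a, b, and the
   Fourier transform is expressed by the even and odd parts of the real Hartley
   transforms H a, H b, where
     H h(k) = (2 pi)^(-d/2) int (cos + sin)(k . x) h(x) dx.
   Regularizing by Gaussians shows that H is an involution on Schwartz functions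
   and a contraction for the L^2 norm.  Its extension to L^2 is then an involutive
   contraction, hence an isometry.

   Let v be the Fourier transform of f and <k> = (1 + |k|^2)^(1/2).  By
   Plancherel, ||f||_2 = ||v||_2 <= ||<k>^n v||_2 = ||f||_{H^n}.  The dilate of f
   by l has squared L^2 and H^n norms l^(-d) int |v|^2 and
   l^(-d) int <l k>^(2n) |v|^2, so that their quotient tends to 1 by dominated
   convergence.  For n > d/2, Cauchy-Schwarz gives
     |f| <= (2 pi)^(-d/2) int |v| <= (2 pi)^(-d/2) J^(1/2) ||f||_{H^n},
   where J = int <k>^(-2n) = pi^(d/2) Gamma(n - d/2) / Gamma(n); at the origin
   equality holds for v = <k>^(-2n). *)
Require Import Defs.
From HB Require Import structures.
From mathcomp Require Import all_boot all_order all_algebra.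
From mathcomp Require Import complex.
From mathcomp Require Import all_classical all_reals all_analysis.
From mathcomp Require Import measurable_realfun ess_sup_inf ring lra.
Import Order.TTheory GRing.Theory Num.Theory.
Import numFieldNormedType.Exports.
Local Open Scope classical_set_scope.
Local Open Scope ring_scope.
Set Implicit Arguments.
Unset Strict Implicit.
Unset Printing Implicit Defensive.

(** * Integration *)

(** All analysis is done on real functions: the Hartley kernel is real, bounded and symmetric, so H
    is self-adjoint and its own inverse, with no conjugation or reflection to track. The obstacle is
    that f is a tempered distribution, known only through a function v paired with inverse Fourier
    transforms of Schwartz functions, and for n <= d/2 this v need not be integrable. Its transform
    must therefore be built in L^2. Moreover the norms of f, being infima over representatives, are
    computable only once representatives are unique almost everywhere. Both points rest on one
    separation result: a function orthogonal to all Schwartz functions vanishes almost everywhere.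
    It needs no bump functions: Gaussians times products of logistic functions are Schwartz, and
    approximate Gaussian-weighted indicators of orthants. The value of J comes from writing
    <k>^(-2n) as a Gamma integral of Gaussians. In (ii) the value at the origin is invisible to an
    essential supremum; it is recovered by testing against Gaussians that concentrate there. *)

Notation intg mu f := (integrable mu setT (EFin \o f)).

(** * Integrals of real-valued functions *)

Section real_integrals.
Context {dd : measure_display} {T : measurableType dd} {R : realType}.
Variable mu : {measure set T -> \bar R}.
Implicit Types f g h : T -> R.

Lemma intg_measurable f : intg mu f -> measurable_fun setT f.
Proof. by move=> /(measurable_int mu)/measurable_EFinP. Qed.

Lemma le_intg f g : measurable_fun setT f -> (forall x, `|f x| <= g x) ->
  intg mu g -> intg mu f.
Proof.
move=> mf fg; apply: le_integrable => //; first exact/measurable_EFinP.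
by move=> x _ /=; rewrite lee_fin (le_trans (fg x))// ler_norm.
Qed.

Lemma intgD f g : intg mu f -> intg mu g -> intg mu (fun x => f x + g x).
Proof. by move=> fi gi; exact: (integrableD measurableT fi gi). Qed.

Lemma intgB f g : intg mu f -> intg mu g -> intg mu (fun x => f x - g x).
Proof. by move=> fi gi; exact: (integrableB measurableT fi gi). Qed.

Lemma intgZ c f : intg mu f -> intg mu (fun x => c * f x).
Proof. by move=> fi; apply: (integrableZl measurableT c fi). Qed.

Lemma intg_norm f : intg mu f -> intg mu (fun x => `|f x|).
Proof. exact: integrable_norm. Qed.

Lemma intgMb f h C : measurable_fun setT h -> (forall x, `|h x| <= C) ->
  intg mu f -> intg mu (fun x => h x * f x).
Proof.
move=> mh hC fi; apply: (@le_intg _ (fun x => C * `|f x|)).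
- by apply: measurable_funM => //; exact: intg_measurable.
- by move=> x; rewrite normrM ler_wpM2r.
- exact/intgZ/intg_norm.
Qed.

Lemma EFin_Rintegral f : intg mu f ->
  (\int[mu]_x f x)%:E = (\int[mu]_x (f x)%:E)%E.
Proof. by move=> fi; rewrite /Rintegral fineK//; exact: integrable_fin_num. Qed.

Lemma ge0_intg f : measurable_fun setT f -> (forall x, 0 <= f x) ->
  (\int[mu]_x (f x)%:E < +oo)%E -> intg mu f.
Proof.
move=> mf f0 fi; apply/integrableP; split; first exact/measurable_EFinP.
by under eq_integral do rewrite /= ger0_norm//.
Qed.

Lemma ge0_intg_lty f : (forall x, 0 <= f x) -> intg mu f ->
  (\int[mu]_x (f x)%:E < +oo)%E.
Proof.
move=> f0 /integrableP[_]; by under eq_integral do rewrite /= ger0_norm//.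
Qed.

Lemma ge0_integral_scale f (c : R) : measurable_fun setT f ->
  (forall x, 0 <= f x) -> 0 <= c ->
  (\int[mu]_x (c * f x)%:E = c%:E * \int[mu]_x (f x)%:E)%E.
Proof.
move=> mf f0 c0; under eq_integral do rewrite EFinM.
rewrite ge0_integralZl//; first exact/measurable_EFinP.
by move=> x _; rewrite lee_fin.
Qed.

Lemma dominated_cvg_Rintegral (f_ : nat -> T -> R) f g :
  (forall n, measurable_fun setT (f_ n)) -> measurable_fun setT f ->
  (forall x, f_ ^~ x @ \oo --> f x) ->
  (forall n x, `|f_ n x| <= g x) -> intg mu g ->
  intg mu f /\ (fun n => \int[mu]_x f_ n x) @ \oo --> \int[mu]_x f x.
Proof.
move=> mf_ mf cf fg gi.
have [] := @dominated_convergence _ _ _ mu setT measurableT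
  (fun n x => (f_ n x)%:E) (EFin \o f) (EFin \o g).
- by move=> n; exact/measurable_EFinP.
- exact/measurable_EFinP.
- apply: aeW => x _; apply: cvg_EFin; last exact: cf.
  exact: nearW.
- exact: gi.
- by apply: aeW => x n _; rewrite lee_fin.
move=> fi _ cint; split => //.
have fin n : intg mu (f_ n) by apply: le_intg gi.
apply/fine_cvg; rewrite EFin_Rintegral//.
Qed.

Lemma Rintegral_eq0_ae f : intg mu f -> (forall x, 0 <= f x) ->
  \int[mu]_x f x = 0 -> {ae mu, forall x, f x = 0}.
Proof.
move=> fi f0 i0.
have mf := measurable_int mu fi.
have /(ae_eq_integral_abs mu measurableT mf) : (\int[mu]_x `|(EFin \o f) x| = 0)%E.
  under eq_integral do rewrite /= ger0_norm//.
  by rewrite -EFin_Rintegral// i0.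
by apply: filterS => x /(_ I) [].
Qed.

Lemma ae_eq_Rintegral f g : measurable_fun setT f -> measurable_fun setT g ->
  {ae mu, forall x, f x = g x} -> \int[mu]_x f x = \int[mu]_x g x.
Proof.
move=> mf mg fg; congr fine; apply: ae_eq_integral => //; try exact/measurable_EFinP.
by apply: filterS fg => x -> _.
Qed.

Lemma intgM_sq f g : measurable_fun setT f -> measurable_fun setT g ->
  intg mu (fun x => f x ^+ 2) -> intg mu (fun x => g x ^+ 2) ->
  intg mu (fun x => f x * g x).
Proof.
move=> mf mg fi gi.
apply: (@le_intg _ (fun x => f x ^+ 2 + g x ^+ 2)); last exact: intgD.
  exact: measurable_funM.
by move=> x; rewrite ler_norml; apply/andP; split; nra.
Qed.

Lemma intgD_sq f g : measurable_fun setT f -> measurable_fun setT g ->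
  intg mu (fun x => f x ^+ 2) -> intg mu (fun x => g x ^+ 2) ->
  intg mu (fun x => (f x + g x) ^+ 2).
Proof.
move=> mf mg fi gi.
have := intgD (intgD fi gi) (intgZ 2 (intgM_sq mf mg fi gi)).
by congr (intg mu _); apply/funext => x; ring.
Qed.

End real_integrals.

(** * Borel measurability of continuous functions *)

Section rV_topology.
Context {R : realType} {d : nat}.
Implicit Types x y : 'rV[R]_d.

Lemma rV_norm_le x (e : R) : 0 <= e -> (forall i, `|x ord0 i| <= e) -> `|x| <= e.
Proof.
move=> e0 xe; rewrite /Num.norm/= mx_normrE.
by apply/bigmax_leP; split => //= -[i j] _ /=; rewrite (ord1 i).
Qed.

Lemma rV_coord_le x i : `|x ord0 i| <= `|x|.
Proof.
rewrite [leRHS]/Num.norm/= mx_normrE.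
exact: (le_bigmax _ (fun ij : 'I_1 * 'I_d => `|x ij.1 ij.2|) (ord0, i)).
Qed.

(** The sigma-algebra is generated by the coordinates, not by the topology. A continuous f is the
    pointwise limit of its values at the grid points of mesh 1/(n+1), and each of these
    approximations is constant on countably many measurable boxes. *)
Lemma measurable_continuous_rV (f : 'rV[R]_d -> R) :
  continuous f -> measurable_fun setT f.
Proof.
move=> cf.
pose z n x : 'rV[int]_d := \row_i Num.floor (n.+1%:R * x ord0 i).
pose q n (w : 'rV[int]_d) : 'rV[R]_d := \row_i ((w ord0 i)%:~R / n.+1%:R).
apply: (@measurable_fun_cvg _ _ _ _ (fun n x => f (q n (z n x)))); last first.
  move=> x _; apply: continuous_cvg; first exact: cf.
  apply/cvgrPdist_le => e e0; near=> n.
  apply: rV_norm_le; first exact: ltW.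
  move=> i; rewrite !mxE.
  have n0 : (0 : R) < n.+1%:R by [].
  have -> : x ord0 i - (Num.floor (n.+1%:R * x ord0 i))%:~R / n.+1%:R =
    (n.+1%:R * x ord0 i - (Num.floor (n.+1%:R * x ord0 i))%:~R) / n.+1%:R.
    by rewrite mulrBl [_ * x _ _]mulrC mulfK ?gt_eqF.
  have /andP[h1 h2] := floor_itv (n.+1%:R * x ord0 i).
  rewrite intrD in h2.
  rewrite ger0_norm; last by rewrite divr_ge0// subr_ge0.
  apply: (@le_trans _ _ (n.+1%:R^-1)).
    by rewrite ler_pdivrMr// mulVf ?gt_eqF//; lra.
  rewrite ltW//; near: n; exact: (near_infty_natSinv_lt (PosNum e0)).
move=> n _ A mA; rewrite setTI.
rewrite (_ : _ @^-1` _ = \bigcup_(w in [set w | A (f (q n w))])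
    \bigcap_(i in [set: 'I_d]) Defs.coord i @^-1`
       [set t | (w ord0 i)%:~R <= n.+1%:R * t < (w ord0 i + 1)%:~R]); last first.
  apply/seteqP; split => x /=.
    move=> Ax; exists (z n x) => //= i _ /=.
    by rewrite /z !mxE; exact: floor_itv.
  move=> [w Aw] /= H; suff -> : z n x = w by [].
  by apply/rowP => i; rewrite mxE; apply/eqP; rewrite floor_eq; exact: H.
rewrite bigcup_mkcond; apply: countable_bigcupT_measurable => // w.
case: ifP => // _; apply: fin_bigcap_measurable => [|i _]; first exact: finite_finset.
rewrite -[X in measurable X]setTI; apply: measurable_coord => //.
rewrite (_ : [set t | _] = (fun t => n.+1%:R * t) @^-1`
  `[(w ord0 i)%:~R, (w ord0 i + 1)%:~R[); last first.
  by apply/seteqP; split => t /=; rewrite in_itv.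
rewrite -[X in measurable X]setTI.
have mM : measurable_fun setT (fun t : R => n.+1%:R * t) by exact: measurable_funM.
exact: (mM _ _ (measurable_itv _)).
Unshelve. all: by end_near. Qed.

End rV_topology.

(** * Affine changes of variables *)

Section lebesgue_affine.
Context {R : realType}.
Local Open Scope ereal_scope.

Lemma pushforward_measureE d1 d2 (T1 : measurableType d1) (T2 : measurableType d2)
    (m : {measure set T1 -> \bar R}) (f : T1 -> T2) : measurable_fun setT f ->
  exists P : {measure set T2 -> \bar R}, pushforward m f = P.
Proof. by move=> mf; unshelve eexists (pushforward m f). Qed.

(** By uniqueness of Lebesgue measure: the image measure, rescaled by l, gives half-open intervals
    their length. *)
Lemma lebesgue_affine_gt0 (l b : R) (A : set (measurableTypeR R)) :
  (0 < l)%R -> measurable A ->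
  lebesgue_measure ((fun t => l * t + b)%R @^-1` A) =
  (l^-1)%:E * lebesgue_measure A.
Proof.
move=> l0 mA.
have mf : measurable_fun [set: measurableTypeR R]
    ((fun t => l * t + b)%R : _ -> measurableTypeR R).
  by apply: measurable_funD => //; exact: measurable_funM.
have [P PE] := pushforward_measureE lebesgue_measure mf.
pose k : {nonneg R} := NngNum (ltW l0).
have -> : lebesgue_measure A = mscale k P A.
  apply: lebesgue_measure_unique => //= _ [[u v]] _ <-.
  rewrite /mscale/= -PE /pushforward.
  rewrite (_ : _ @^-1` _ = `]((u - b) / l)%R, ((v - b) / l)%R]%classic); last first.
    apply/seteqP; split => t /=; rewrite !in_itv/= ltr_pdivrMr// ler_pdivlMr//.
      by move=> /andP[? ?]; apply/andP; split; lra.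
    by move=> /andP[? ?]; apply/andP; split; lra.
  rewrite lebesgue_measure_itv/=.
  have := lebesgue_measure_itv `]((u - b) / l)%R, ((v - b) / l)%R].
  rewrite /= => ->; rewrite !lte_fin ltr_pM2r ?invr_gt0// ltrBlDr subrK.
  case: ifPn => uv; last by rewrite mule0.
  rewrite -!EFinD -EFinM; congr EFin.
  by field; rewrite gt_eqF.
by rewrite /mscale/= -PE muleA -EFinM mulVf ?gt_eqF// mul1e.
Qed.

(** A negative slope is reduced to a positive one by the reflection t |-> -t, which preserves
    Lebesgue measure. *)
Lemma ge0_integral_affine1 (l b : R) (f : R -> \bar R) :
  l != 0%R -> measurable_fun setT f -> (forall x, 0 <= f x) ->
  \int[lebesgue_measure]_x f (l * x + b)%R =
  (`|l|^-1)%:E * \int[lebesgue_measure]_x f x.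
Proof.
have H (l' : R) (g : R -> \bar R) : (0 < l')%R -> measurable_fun setT g ->
    (forall x, 0 <= g x) ->
    \int[lebesgue_measure]_x g (l' * x + b)%R =
    (l'^-1)%:E * \int[lebesgue_measure]_x g x.
  move=> l0 mg g0.
  have mf : measurable_fun [set: measurableTypeR R]
      ((fun t => l' * t + b)%R : _ -> measurableTypeR R).
    by apply: measurable_funD => //; exact: measurable_funM.
  have := ge0_integral_pushforward mf lebesgue_measure measurableT mg
    (fun y _ => g0 y).
  rewrite preimage_setT => <-.
  have k0 : (0 <= l'^-1)%R by rewrite invr_ge0 ltW.
  rewrite -(ge0_integral_mscale _ _ (NngNum k0))//.
  by apply: eq_measure_integral => A mA _; exact: lebesgue_affine_gt0.
rewrite neq_lt => /orP[l0|l0] mf f0; last by rewrite H// gtr0_norm.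
have mN : measurable_fun [set: measurableTypeR R]
      ((fun t => - t)%R : _ -> measurableTypeR R).
  exact: oppr_measurable.
pose g x := f ((- l) * x + b)%R.
have mg : measurable_fun [set: R] g.
  apply: (measurableT_comp mf).
  by apply: measurable_funD => //; exact: measurable_funM.
have := ge0_integral_pushforward mN lebesgue_measure measurableT mg
    (fun y _ => f0 _).
rewrite preimage_setT/= /g => E.
under eq_integral => x _ do rewrite -[(l * x)%R]mulrNN.
rewrite -E ltr0_norm// -H// ?oppr_gt0//.
by apply: eq_measure_integral => A mA _; exact: lebesgue_measureN.
Qed.

Lemma ge0_integral_consrV d (f : 'rV[R]_d.+1 -> \bar R) :
  measurable_fun setT f -> (forall x, 0 <= f x) ->
  \int[lebesgue_rV d.+1]_x f x =
  \int[lebesgue_measure]_t \int[lebesgue_rV d]_x f (consrV (t, x)).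
Proof.
move=> mf f0.
transitivity (\int[lebesgue_measure \x lebesgue_rV d]_z (f \o @consrV R d) z).
  have := ge0_integral_pushforward (@measurable_consrV R d)
    (lebesgue_measure \x lebesgue_rV d) measurableT mf (fun y _ => f0 y).
  rewrite preimage_setT => <-.
  by apply: eq_measure_integral => //; exact: measurable_consrV.
rewrite fubini_tonelli1//; last by move=> x; exact: f0.
exact: measurableT_comp mf (@measurable_consrV R d).
Qed.

Lemma measurable_affine_rV d (l : R) (b : 'rV[R]_d) :
  measurable_fun setT (fun x : 'rV[R]_d => l *: x + b)%R.
Proof.
apply: measurable_rV => i.
rewrite (_ : _ \o _ = fun x => l * Defs.coord i x + b ord0 i)%R; last first.
  by apply/funext => x; rewrite /Defs.coord/= !mxE.
by apply: measurable_funD => //; apply: measurable_funM => //; exact: measurable_coord.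
Qed.

(** Tonelli peels off one coordinate at a time, each contributing a factor 1/|l|. *)
Lemma ge0_integral_affine d (l : R) (b : 'rV[R]_d) (f : 'rV[R]_d -> \bar R) :
  l != 0%R -> measurable_fun setT f -> (forall x, 0 <= f x) ->
  \int[lebesgue_rV d]_x f (l *: x + b)%R =
  (`|l| ^- d)%:E * \int[lebesgue_rV d]_x f x.
Proof.
move=> l0; elim: d b f => [|d IH] b f mf f0.
  rewrite expr0 invr1 mul1e; apply: eq_integral => x _.
  by congr f; apply/rowP => -[].
have ma := @measurable_affine_rV d.+1 l b.
rewrite ge0_integral_consrV//; last exact: measurableT_comp mf ma.
pose b' := (\row_i b ord0 (lift ord0 i))%R.
have E t x : (l *: consrV (t, x) + b = consrV (l * t + b ord0 ord0, l *: x + b'))%R.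
  rewrite -[LHS]unconsrVK; congr consrV; congr pair.
    by have /= := consrV0 (t, x); rewrite /Defs.coord !mxE => ->.
  by apply/rowP => i; have /= := consrVS (t, x) i; rewrite /Defs.coord !mxE => ->.
have mc : measurable_fun [set: measurableTypeR R * 'rV[R]_d] (f \o @consrV R d).
  exact: measurableT_comp mf (@measurable_consrV R d).
pose F := fubini_F (lebesgue_rV d) (f \o @consrV R d).
have mF : measurable_fun [set: measurableTypeR R] F.
  by apply: measurable_fun_fubini_tonelli_F => // x; exact: f0.
transitivity (\int[lebesgue_measure]_t ((`|l| ^- d)%:E * F (l * t + b ord0 ord0)%R)).
  apply: eq_integral => t _; under eq_integral do rewrite E.
  rewrite (IH b' (fun x => f (consrV (l * t + b ord0 ord0, x)))%R)//.
  exact: (measurable_fun_pair2 _ mc).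
have F0 t : 0 <= F t by apply: integral_ge0 => x _; exact: f0.
rewrite ge0_integralZl//; last first.
  have mf1 : measurable_fun [set: measurableTypeR R]
      ((fun t => l * t + b ord0 ord0)%R : _ -> measurableTypeR R).
    by apply: measurable_funD => //; exact: measurable_funM.
  exact: (measurableT_comp mF mf1).
rewrite ge0_integral_affine1// muleA -EFinM -invfM -exprSr; congr (_ * _).
by rewrite ge0_integral_consrV.
Qed.

End lebesgue_affine.

(** * Gaussian integrals *)

Section gaussian.
Context {R : realType}.
Local Open Scope ereal_scope.

Lemma dotrV_consrV d (t : R) (x : 'rV[R]_d) :
  dotrV (consrV (t, x)) (consrV (t, x)) = (t ^+ 2 + dotrV x x)%R.
Proof.
rewrite /dotrV big_ord_recl; congr (_ + _)%R.
  by have /= := consrV0 (t, x); rewrite /Defs.coord => ->.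
by apply: eq_bigr => i _; have /= := consrVS (t, x) i; rewrite /Defs.coord => ->.
Qed.

Lemma measurable_dotrV d (y : 'rV[R]_d) :
  measurable_fun setT (fun x : 'rV[R]_d => dotrV x y).
Proof.
apply: measurable_sum => i; apply: measurable_funM => //; exact: measurable_coord.
Qed.

Lemma measurable_dotrVxx d : measurable_fun setT (fun x : 'rV[R]_d => dotrV x x).
Proof.
apply: measurable_sum => i; apply: measurable_funM; exact: measurable_coord.
Qed.

Lemma dotrVxx_ge0 d (x : 'rV[R]_d) : (0 <= dotrV x x)%R.
Proof. by apply: sumr_ge0 => i _; rewrite -expr2 sqr_ge0. Qed.

Lemma enorm_sqr d (x : 'rV[R]_d) : (enorm x ^+ 2 = dotrV x x)%R.
Proof. by rewrite sqr_sqrtr// dotrVxx_ge0. Qed.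

Lemma measurable_gauss_rV d (s : R) :
  measurable_fun setT (fun x : 'rV[R]_d => expR (- (s * dotrV x x)))%R.
Proof.
apply: measurableT_comp => //; apply: measurableT_comp => //.
by apply: measurable_funM => //; exact: measurable_dotrVxx.
Qed.

Lemma integral_gauss1 (s : R) : (0 < s)%R ->
  \int[lebesgue_measure]_t (expR (- (s * t ^+ 2)))%:E = (Num.sqrt (pi / s))%:E.
Proof.
move=> s0; have r0 : (0 < Num.sqrt s)%R by rewrite sqrtr_gt0.
have := @ge0_integral_affine1 R (Num.sqrt s) 0 (fun x => (gauss_fun x)%:E).
rewrite integralT_gauss => H.
transitivity (\int[lebesgue_measure]_x (gauss_fun (Num.sqrt s * x + 0))%:E).
  apply: eq_integral => t _; rewrite /gauss_fun addr0 exprMn sqr_sqrtr ?ltW//.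
rewrite H ?gt_eqF//; last 2 first.
- by apply/measurable_EFinP; exact: measurable_gauss_fun.
- by move=> x; rewrite lee_fin gauss_fun_ge0.
rewrite -EFinM gtr0_norm// sqrtrM ?pi_ge0// sqrtrV ?ltW// mulrC//.
Qed.

Lemma integral_gauss_rV d (s : R) : (0 < s)%R ->
  \int[lebesgue_rV d]_x (expR (- (s * dotrV x x)))%:E =
  ((pi / s) `^ (d%:R / 2))%:E.
Proof.
move=> s0; have ps : (0 <= pi / s)%R by rewrite divr_ge0 ?pi_ge0// ltW.
have -> : ((pi / s) `^ (d%:R / 2) = Num.sqrt (pi / s) ^+ d)%R.
  by rewrite [(d%:R / 2)%R]mulrC powRrM powR12_sqrt// powR_mulrn ?Num.Theory.sqrtr_ge0.
elim: d => [|d IH].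
  rewrite expr0 /= integral_dirac//; first by rewrite diracT mul1e /dotrV big_ord0 mulr0 oppr0 expR0.
  by apply/measurable_EFinP; exact: measurable_gauss_rV.
rewrite ge0_integral_consrV; last 2 first.
- by apply/measurable_EFinP; exact: measurable_gauss_rV.
- by move=> x; rewrite lee_fin expR_ge0.
transitivity (\int[lebesgue_measure]_t
   ((expR (- (s * t ^+ 2)))%:E * (Num.sqrt (pi / s) ^+ d)%:E)).
  apply: eq_integral => t _; rewrite -IH -ge0_integralZl//; last first.
    by apply/measurable_EFinP; exact: measurable_gauss_rV.
  by apply: eq_integral => x _; rewrite dotrV_consrV mulrDr opprD expRD EFinM.
rewrite ge0_integralZr//; last first.
  apply/measurable_EFinP; apply: measurableT_comp => //; apply: measurableT_comp => //.
  by apply: measurable_funM => //; exact: exprn_measurable.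
by rewrite integral_gauss1// -EFinM exprS.
Qed.

End gaussian.

(** * Convergence and positivity of the Gamma integral *)

Section gamma.
Context {R : realType}.
Notation leb := (@lebesgue_measure R).

(** The integrand is extended by zero so that affine substitutions on the whole line apply to it. *)
Definition gamma_fun (s t : R) : R := if 0 < t then t `^ (s - 1) * expR (- t) else 0.

Lemma gamma_fun_ge0 s t : 0 <= gamma_fun s t.
Proof. by rewrite /gamma_fun; case: ifP => // _; rewrite mulr_ge0 ?powR_ge0 ?expR_ge0. Qed.

Lemma measurable_gamma_fun s : measurable_fun setT (gamma_fun s).
Proof.
apply: measurable_fun_if => //; first exact: measurable_fun_ltr.
by apply: measurable_funTS; apply: measurable_funM => //; apply: measurableT_comp.
Qed.

Lemma GammaE s : Gamma s = \int[leb]_t gamma_fun s t.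
Proof.
rewrite /Gamma [LHS]Rintegral_mkcond; congr fine; apply: eq_integral => t _.
rewrite patchE mem_setE in_itv/= andbT /gamma_fun.
by case: ifP.
Qed.

(** The integrand may be unbounded at 0, so the interval is exhausted by compact ones on which t^s /
    s is a primitive; monotone convergence concludes. *)
Lemma integral_powR01 (s : R) : 0 < s ->
  (\int[leb]_(t in `]0%R, 1%R]) (t `^ (s - 1))%:E <= (s^-1)%:E)%E.
Proof.
move=> s0.
(* The offset 2 keeps the left end point strictly below 1, as the fundamental theorem requires. *)
pose F n : set R := `[n.+2%:R^-1, 1]%classic.
have FE : \bigcup_n F n = `]0, 1]%classic.
  apply/seteqP; split => [t [n _]|t]; rewrite /F /= !in_itv/=.
    by move=> /andP[h ->]; rewrite (lt_le_trans _ h).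
  move=> /andP[t0 t1].
  have [n _ /(_ n (leqnn n))/= H] := near_infty_natSinv_lt (PosNum t0).
  exists n => //; rewrite /= in_itv/= t1 andbT.
  by apply: ltW; apply: le_lt_trans H; rewrite lef_pV2 ?posrE// ler_nat.
have ndF : nondecreasing_seq F.
  apply/nondecreasing_seqP => n; apply/subsetPset => t; rewrite /F/= !in_itv/=.
  move=> /andP[h ->]; rewrite andbT; apply: le_trans h.
  by rewrite lef_pV2 ?posrE// ler_nat.
rewrite -FE.
have H := @ge0_nondecreasing_set_cvg_integral _ (measurableTypeR R) _ F
  (fun t : R => (t `^ (s - 1))%:E) leb ndF.
have {H}H := H (fun=> measurable_itv _) _ _.
apply: (cvge_le _ (H _ _)); last 2 first.
- by move=> i; apply/measurable_EFinP; apply: measurable_funTS.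
- by move=> i x _; rewrite lee_fin powR_ge0.
apply: nearW => n.
have dF (t : R) : 0 < t ->
    is_derive t 1 (fun t => s^-1 * t `^ s) (t `^ (s - 1)).
  move=> t0; have := is_deriveZ s^-1 (@is_derive1_powR R s t t0).
  by rewrite /GRing.scale/= mulrA mulVf ?gt_eqF// mul1r.
rewrite (@continuous_FTC2 _ _ (fun t => s^-1 * t `^ s)).
- rewrite powR1 mulr1 -EFinB lee_fin lerBlDr lerDl.
  by rewrite mulr_ge0 ?invr_ge0 ?powR_ge0// ltW.
- by rewrite invf_lt1// ltr1n.
- apply: continuous_in_subspaceT => t; rewrite inE/= in_itv/= => /andP[t0 _].
  apply/differentiable_continuous/derivable1_diffP.
  apply: derivable_powR; rewrite in_itv/= andbT; exact: lt_le_trans t0.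
- have cF (t : R) : 0 < t -> {for t, continuous (fun t => s^-1 * t `^ s)}.
    move=> t0; apply/differentiable_continuous/derivable1_diffP.
    by have [] := dF t t0.
  split.
  + move=> t; rewrite in_itv/= => /andP[t0 t1].
    by have [] := dF t (lt_trans _ t0).
  + by apply: cvg_at_right_filter; apply: cF.
  + by apply: cvg_at_left_filter; apply: cF.
- move=> t; rewrite in_itv/= => /andP[t0 t1].
  have t0' : 0 < t by apply: lt_trans t0.
  by have [_] := dF t t0'; rewrite derive1E.
Qed.

(** Take 1 + u <= exp u at u = t/(2k) and raise it to an integer power k > |s|; this produces the
    constant (2k)^k. *)
Lemma powR_le_expR (s : R) : exists C : R, forall t, 1 <= t ->
  t `^ (s - 1) <= C * expR (t / 2).
Proof.
pose k := (Num.truncn `|s|).+1.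
exists ((2 * k%:R) ^+ k) => t t1.
have t0 : 0 <= t by apply: le_trans t1.
apply: (@le_trans _ _ (t ^+ k)).
  rewrite -powR_mulrn//; apply: ler_powR => //.
  have := ltW (truncnS_gt `|s|); rewrite -/k; have := ler_norm s; lra.
have k0 : (0 : R) < 2 * k%:R by rewrite mulr_gt0.
have -> : expR (t / 2) = expR (t / (2 * k%:R)) ^+ k.
  rewrite -expRM_natl; congr expR; rewrite invfM; field.
  by rewrite gt_eqF.
rewrite -exprMn lerXn2r// ?nnegrE//.
have h := expR_ge1Dx (t / (2 * k%:R)); rewrite -(ler_pM2l k0) in h.
apply: le_trans h; rewrite mulrDr mulr1 mulrCA mulfV ?gt_eqF// mulr1.
by rewrite lerDr ltW.
Qed.

Lemma intg_gamma_fun s : 0 < s -> intg leb (gamma_fun s).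
Proof.
move=> s0; have [C HC] := powR_le_expR s.
have C0 : 0 <= C.
  have := HC 1 (lexx 1); rewrite powR1 => h.
  by rewrite -(@pmulr_lge0 _ (expR (1 / 2))) ?expR_gt0// (le_trans _ h).
(* On ]0, 1] the power alone dominates. Beyond 1 the bound is C exp(-t/2), which is 2C times the
   exponential density of rate 1/2. *)
apply: (@le_intg _ (measurableTypeR R) _ _ _ (fun t => ((fun t : R => t `^ (s - 1)) \_ `]0, 1]) t
   + (2 * C) * exponential_pdf 2^-1 t)).
- exact: measurable_gamma_fun.
- move=> t; rewrite ger0_norm ?gamma_fun_ge0// /gamma_fun.
  have e0 : 0 <= 2 * C * exponential_pdf 2^-1 t.
    by rewrite mulr_ge0 ?exponential_pdf_ge0 ?mulr_ge0.
  rewrite patchE mem_setE in_itv/=.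
  case: ifPn => [t0|_]; last first.
    by rewrite addr_ge0//; case: ifP => // _; rewrite powR_ge0.
  have [t1|t1] := leP t 1 => /=.
    apply: (@le_trans _ _ (t `^ (s - 1))); last by rewrite lerDl.
    by rewrite ler_piMr ?powR_ge0// -expR0 ler_expR oppr_le0 ltW.
  rewrite /exponential_pdf patchE mem_setE in_itv/= andbT (ltW t0).
  rewrite add0r mulrA [2 * C]mulrC -(mulrA C) mulfV// mulr1.
  apply: (@le_trans _ _ (C * expR (t / 2) * expR (- t))).
    by rewrite ler_wpM2r ?expR_ge0// HC// ltW.
  rewrite -mulrA -expRD ler_wpM2l// ler_expR; lra.
- apply: intgD; last by apply: intgZ; apply: integrable_exponential_pdf; rewrite invr_gt0.
  apply: ge0_intg.
  + apply/(measurable_restrictT _ (measurable_itv _)).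
    have mp : measurable_fun [set: measurableTypeR R] (fun t : R => t `^ (s - 1)).
      exact: measurable_powR.
    exact: (measurable_funS measurableT (@subsetT _ _) mp).
  + by move=> t; rewrite patchE; case: ifP => // _; rewrite powR_ge0.
  + under eq_integral do rewrite -[(_%:E)]/((EFin \o _) _).
    rewrite -restrict_EFin -integral_mkcond.
    exact: le_lt_trans (integral_powR01 s0) (ltry _).
Qed.

(** If the integral were zero, the nonnegative integrand would vanish almost everywhere, but it is
    positive on ]0, 1], which has measure 1. *)
Lemma Gamma_gt0 (s : R) : 0 < s -> 0 < Gamma s.
Proof.
move=> s0; rewrite lt_neqAle GammaE Rintegral_ge0 ?andbT; last first.
  by move=> t _; exact: gamma_fun_ge0.
apply/eqP => /esym H.
have [N [mN N0 subN]] := Rintegral_eq0_ae (intg_gamma_fun s0) (gamma_fun_ge0 s) H.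
have : (leb `]0%R, 1%R] <= leb N)%E.
  apply: le_measure; rewrite ?inE// => t /=; rewrite in_itv/= => /andP[t0 _].
  apply: subN => /= /eqP; rewrite /gamma_fun t0 mulf_eq0.
  by rewrite !gt_eqF ?powR_gt0 ?expR_gt0.
have -> : leb N = 0%E := N0.
by rewrite lebesgue_measure_itv/= lte_fin ltr01 oppr0 adde0 lee_fin ler10.
Qed.

End gamma.

(** * The integral of a negative power of 1 + |k|^2 *)

Section bessel_integral.
Context {R : realType} {d : nat}.
Notation leb := (@lebesgue_measure R).
Notation mu := (@lebesgue_rV R d).

Lemma measurable_jap (s : R) :
  measurable_fun setT (fun k : 'rV[R]_d => (1 + enorm k ^+ 2) `^ s).
Proof.
apply: (measurableT_comp (measurable_powR s)).
apply: measurable_funD => //; under eq_fun do rewrite enorm_sqr.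
exact: measurable_dotrVxx.
Qed.

Lemma jap_gt0 (k : 'rV[R]_d) : 0 < 1 + enorm k ^+ 2.
Proof. by rewrite ltr_pwDl// sqr_ge0. Qed.

(** This is the substitution t |-> c t in the Gamma integral. The exponential is split as e^(-t)
    e^(-t(c-1)), since for c = 1 + |k|^2 the second factor is a Gaussian in k. *)
Lemma gamma_fun_scale (n c : R) : 0 < n -> 0 < c ->
  (\int[leb]_t (gamma_fun n t * expR (- (t * (c - 1))))%:E =
   (c `^ (- n) * Gamma n)%:E)%E.
Proof.
move=> n0 c0.
have E t : gamma_fun n t * expR (- (t * (c - 1))) =
    c `^ (1 - n) * gamma_fun n (c * t + 0).
  rewrite addr0 /gamma_fun pmulr_rgt0//; case: ifPn => t0; last by rewrite mul0r mulr0.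
  rewrite powRM ?(ltW t0) ?(ltW c0)// !mulrA -powRD; last first.
    by rewrite (gt_eqF c0) implybT.
  rewrite (_ : 1 - n + (n - 1) = 0) ?powRr0 ?mul1r; last by ring.
  by rewrite -mulrA -expRD; congr (_ * expR _); ring.
under eq_integral do rewrite E EFinM.
have mg : measurable_fun [set: measurableTypeR R] (EFin \o gamma_fun n).
  by apply/measurable_EFinP; exact: measurable_gamma_fun.
rewrite ge0_integralZl//; last 3 first.
- have mf1 : measurable_fun [set: measurableTypeR R]
      ((fun t => c * t + 0)%R : _ -> measurableTypeR R).
    by apply: measurable_funD => //; exact: measurable_funM.
  exact: (measurableT_comp mg mf1).
- by move=> t _; rewrite lee_fin gamma_fun_ge0.
- by rewrite lee_fin powR_ge0.
rewrite (@ge0_integral_affine1 _ c 0 (EFin \o gamma_fun n)) ?gt_eqF//; last first.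
  by move=> x; rewrite lee_fin gamma_fun_ge0.
rewrite -EFin_Rintegral; last exact: intg_gamma_fun.
rewrite -GammaE -!EFinM mulrA gtr0_norm//; congr (_ * _)%:E.
rewrite -powR_inv1 ?(ltW c0)// -powRD; last by rewrite (gt_eqF c0) implybT.
by congr (_ `^ _); ring.
Qed.

(** Gamma(n) (1 + |k|^2)^(-n) is the integral over t of t^(n-1) e^(-t) e^(-t|k|^2). Integrating over
    k first gives (pi/t)^(d/2), which lowers the exponent of t and leaves pi^(d/2) Gamma(n -
    d/2). *)
Lemma integral_jap (n : R) : d%:R / 2 < n ->
  (\int[mu]_k ((1 + enorm k ^+ 2) `^ (- n))%:E =
   (pi `^ (d%:R / 2) * (Gamma (n - d%:R / 2) / Gamma n))%:E)%E.
Proof.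
move=> dn.
have n0 : 0 < n by rewrite (le_lt_trans _ dn)// divr_ge0.
have G0 := Gamma_gt0 n0.
have ndG0 : 0 < n - d%:R / 2 by rewrite subr_gt0.
pose f (z : measurableTypeR R * 'rV[R]_d) : \bar R :=
  (gamma_fun n z.1 * expR (- (z.1 * dotrV z.2 z.2)))%:E.
have f0 z : (0 <= f z)%E by rewrite lee_fin mulr_ge0 ?expR_ge0 ?gamma_fun_ge0.
have mf : measurable_fun setT f.
  apply/measurable_EFinP; apply: measurable_funM.
    exact: (measurableT_comp (measurable_gamma_fun n) measurable_fst).
  apply: measurableT_comp => //; apply: measurableT_comp => //.
  apply: measurable_funM; first exact: measurable_fst.
  have m2 := @measurable_snd _ _ (measurableTypeR R) 'rV[R]_d.
  exact: (measurableT_comp (@measurable_dotrVxx R d) m2).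
have := @fubini_tonelli _ _ _ _ _ leb mu f mf f0.
have -> : (\int[mu]_y fubini_G leb f y =
   \int[mu]_k ((1 + enorm k ^+ 2) `^ (- n) * Gamma n)%:E)%E.
  apply: eq_integral => k _; rewrite /fubini_G.
  rewrite -(gamma_fun_scale n0 (jap_gt0 k)).
  by apply: eq_integral => t _; rewrite /f/= enorm_sqr addrAC subrr add0r.
have -> : (\int[leb]_y fubini_F mu f y =
   \int[leb]_t ((pi `^ (d%:R / 2))%:E * (gamma_fun (n - d%:R / 2) t)%:E))%E.
  apply: eq_integral => t _; rewrite /fubini_F /f/=.
  rewrite ge0_integral_scale ?gamma_fun_ge0//; first last.
  - exact: measurable_gauss_rV.
  rewrite /gamma_fun; case: ifPn => t0; last by rewrite mul0e mule0.
  rewrite integral_gauss_rV// -!EFinM; congr EFin.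
  rewrite powRM ?pi_ge0 ?invr_ge0 ?(ltW t0)// mulrC -!mulrA; congr (_ * _).
  rewrite -powR_inv1 ?(ltW t0)// -powRrM mulN1r.
  rewrite mulrA -powRD; last by rewrite (gt_eqF t0) implybT.
  congr (_ `^ _ * _); ring.
under eq_integral do rewrite -EFinM.
rewrite ge0_integral_scale ?powR_ge0//; first last.
- by move=> t; exact: gamma_fun_ge0.
- exact: measurable_gamma_fun.
rewrite -EFin_Rintegral; last exact: intg_gamma_fun.
rewrite -GammaE => H.
move: H; under eq_integral do rewrite mulrC.
rewrite ge0_integral_scale ?(ltW G0)//; first last.
- by move=> k; exact: powR_ge0.
- exact: measurable_jap.
move=> H; rewrite mulrA mulrC EFinM EFinM H muleA -EFinM mulVf ?gt_eqF//.
by rewrite mul1e.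
Qed.

Lemma intg_jap (n : R) : d%:R / 2 < n ->
  intg mu (fun k => (1 + enorm k ^+ 2) `^ (- n)).
Proof.
move=> dn; apply: ge0_intg; first exact: measurable_jap.
  by move=> k; exact: powR_ge0.
by rewrite integral_jap// ltry.
Qed.

Lemma intg_japV (N : nat) : (d <= N)%N -> (0 < N)%N ->
  intg mu (fun k => ((1 + enorm k ^+ 2) ^+ N)^-1).
Proof.
move=> dN N0; have : d%:R / 2 < N%:R :> R.
  have : d%:R <= N%:R :> R by rewrite ler_nat.
  have : 0 < N%:R :> R by rewrite ltr0n.
  lra.
move=> /intg_jap; congr (intg mu _); apply/funext => k.
by rewrite powR_invn// ltW// jap_gt0.
Qed.

End bessel_integral.

(** * Schwartz functions *)

Section gradients.
Context {R : realType} {d : nat}.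
Implicit Types (h f g : 'rV[R]_d -> R) (x : 'rV[R]_d).

(** Differentiability is bundled with the values of the partial derivatives so that the product and
    chain rules compose without side conditions. *)
Definition has_grad h x (g : 'I_d -> R) :=
  differentiable h x /\ forall i, 'D_(unit_rV i) h x = g i.

Lemma has_grad_eq h x (u u' : 'I_d -> R) :
  has_grad h x u -> u =1 u' -> has_grad h x u'.
Proof. by move=> [hd hg] E; split => // i; rewrite hg. Qed.

Lemma has_grad_self h x : differentiable h x ->
  has_grad h x (fun i => 'D_(unit_rV i) h x).
Proof. by []. Qed.

Lemma has_grad_cst c x : has_grad (fun=> c) x (fun=> 0).
Proof.
split; first exact: (differentiable_cst c x).
by move=> i; exact: derive_cst.
Qed.

Lemma has_gradD f g x df dg : has_grad f x df -> has_grad g x dg ->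
  has_grad (fun y => f y + g y) x (fun i => df i + dg i).
Proof.
move=> [fd fE] [gd gE]; split; first exact: differentiableD.
by move=> i; rewrite -fE -gE; apply: deriveD; exact: diff_derivable.
Qed.

Lemma has_gradM f g x df dg : has_grad f x df -> has_grad g x dg ->
  has_grad (fun y => f y * g y) x (fun i => f x * dg i + df i * g x).
Proof.
move=> [fd fE] [gd gE]; split; first exact: differentiableM.
move=> i; rewrite -fE -gE [X in _ + X]mulrC.
by apply: deriveM; exact: diff_derivable.
Qed.

Lemma has_gradZ c f x df : has_grad f x df ->
  has_grad (fun y => c * f y) x (fun i => c * df i).
Proof.
move=> H; apply: has_grad_eq (has_gradM (has_grad_cst c x) H) _ => i.
by rewrite mul0r addr0.
Qed.

Lemma has_grad_coord j x :
  has_grad (fun y : 'rV[R]_d => y ord0 j) x (fun i => (i == j)%:R).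
Proof.
have hd : differentiable (fun y : 'rV[R]_d => y ord0 j : R) x.
  exact: differentiable_coord.
split => // i; rewrite deriveE//.
have @L : {linear 'rV[R]_d -> R}.
  by exists (fun N : 'rV[R]_d => N ord0 j); do 2![eexists]; do ?[constructor];
     rewrite ?mxE// => ? *; rewrite ?mxE//; move=> ?; rewrite !mxE.
rewrite (_ : (fun _ => _) = L)// diff_lin; last exact: coord_continuous.
by rewrite /= /unit_rV mxE eqxx eq_sym.
Qed.

Lemma has_grad_comp (phi : R -> R) (dphi : R) f x df :
  is_derive (f x) 1 phi dphi -> has_grad f x df ->
  has_grad (fun y => phi (f y)) x (fun i => dphi * df i).
Proof.
move=> [pd pE] [fd fE].
have pdiff : differentiable phi (f x) by apply/derivable1_diffP.
split; first exact: differentiable_comp.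
move=> i; rewrite deriveE; last exact: differentiable_comp.
rewrite (_ : (fun _ => _) = phi \o f)// (diff_comp fd pdiff) /= -(deriveE _ fd) fE.
by rewrite deriv1E// derive1E pE /GRing.scale/= mulrC.
Qed.

Lemma has_grad_affine (l : R) (b : 'rV[R]_d) f x df :
  has_grad f (l *: x + b) df ->
  has_grad (fun y => f (l *: y + b)) x (fun i => l * df i).
Proof.
move=> [fd fE].
pose a (y : 'rV[R]_d) := l *: y + b.
have ad : is_diff x a ( *:%R l).
  have := is_diffD (is_diff_scaler l x) (is_diff_cst b x).
  by rewrite addr0.
have da : differentiable a x by exact: ex_diff.
have dfa : differentiable (f \o a) x by apply: differentiable_comp => //; exact: ex_diff.
split; first exact: dfa.
move=> i; rewrite deriveE; last exact: dfa.
rewrite (_ : (fun _ => _) = f \o a)// (diff_comp da fd) /= diff_val linearZ/= -(deriveE _ fd).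
by rewrite fE.
Qed.

Lemma has_grad_sqnorm x :
  has_grad (fun y : 'rV[R]_d => enorm y ^+ 2) x (fun i => 2 * x ord0 i).
Proof.
have E : (fun y : 'rV[R]_d => enorm y ^+ 2) =
    (\sum_(j < d) (fun y : 'rV[R]_d => y ord0 j * y ord0 j)).
  by apply/funext => y; rewrite enorm_sqr /dotrV fct_sumE.
have H j := has_gradM (has_grad_coord j x) (has_grad_coord j x).
rewrite E; split.
  by apply: differentiable_sum => j; have [] := H j.
move=> i; rewrite derive_sum; last first.
  by move=> j; apply: diff_derivable; have [] := H j.
rewrite (bigD1 i)//= big1 ?addr0; last first.
  by move=> j ji; rewrite (H j).2 eq_sym (negbTE ji) mulr0 mul0r addr0.
by rewrite (H i).2 eqxx mulr1 mul1r mulr2n mulrDl mul1r.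
Qed.

Lemma has_grad_dotrV a x : has_grad (dotrV a) x (fun i => a ord0 i).
Proof.
have E : dotrV a = \sum_(j < d) (fun y : 'rV[R]_d => a ord0 j * y ord0 j).
  by apply/funext => y; rewrite fct_sumE.
have H j := has_gradZ (a ord0 j) (has_grad_coord j x).
rewrite E; split.
  by apply: differentiable_sum => j; have [] := H j.
move=> i; rewrite derive_sum; last first.
  by move=> j; apply: diff_derivable; have [] := H j.
rewrite (bigD1 i)//= big1 ?addr0; last first.
  by move=> j ji; rewrite (H j).2 eq_sym (negbTE ji) mulr0.
by rewrite (H i).2 eqxx mulr1.
Qed.

Lemma dotrVNl a x : dotrV (- a) x = - dotrV a x.
Proof. by rewrite /dotrV -sumrN; apply: eq_bigr => i _; rewrite mxE mulNr. Qed.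

Lemma dotrVC a x : dotrV a x = dotrV x a.
Proof. by apply: eq_bigr => i _; rewrite mulrC. Qed.

Lemma dotrVDl a b x : dotrV (a + b) x = dotrV a x + dotrV b x.
Proof. by rewrite /dotrV -big_split; apply: eq_bigr => i _; rewrite mxE mulrDl. Qed.

Lemma dotrVZl (l : R) a x : dotrV (l *: a) x = l * dotrV a x.
Proof. by rewrite /dotrV mulr_sumr; apply: eq_bigr => i _; rewrite mxE mulrA. Qed.

Lemma has_grad_dir f x (g : 'I_d -> R) (v : 'rV[R]_d) : has_grad f x g ->
  'D_v f x = \sum_i v ord0 i * g i.
Proof.
move=> [fd fE]; rewrite deriveE//.
rewrite [X in 'd f x X](row_sum_delta v) linear_sum; apply: eq_bigr => i _.
by rewrite linearZ -fE deriveE.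
Qed.

Lemma is_derive_line f (g : 'I_d -> R) (x v : 'rV[R]_d) (t : R) :
  has_grad f (x + t *: v) g ->
  is_derive t 1 (fun s => f (x + s *: v)) (\sum_i v ord0 i * g i).
Proof.
move=> fg; have [fd _] := fg.
have da : is_diff t (fun s : R => x + s *: v) (fun s => s *: v).
  have := is_diffD (is_diff_cst x t) (is_diff_scalel t v).
  by rewrite add0r.
have dt : differentiable (fun s : R => x + s *: v) t by exact: ex_diff.
have dc : differentiable (f \o (fun s : R => x + s *: v)) t.
  exact: differentiable_comp.
have := @diff_derivable _ _ _ _ t 1 dc.
move=> /derivableP; rewrite -(has_grad_dir v fg) (deriveE _ dc) (diff_comp dt fd).
by rewrite /= diff_val scale1r (deriveE _ fd).
Qed.

End gradients.

(** * The Hartley kernel *)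

Section cas.
Context {R : realType}.
Implicit Types a b t : R.

Definition cas t : R := cos t + sin t.

Lemma casD a b : cas (a + b) = cas a * cos b + cas (- a) * sin b.
Proof. by rewrite /cas cosD sinD cosN sinN; ring. Qed.

Lemma cas_le2 t : `|cas t| <= 2.
Proof.
have := cos_max t; have := sin_max t; rewrite !ler_norml => /andP[? ?] /andP[? ?].
by apply/andP; split; rewrite /cas; lra.
Qed.

Lemma is_derive_cas t : is_derive t 1 cas (cas (- t)).
Proof.
have := is_deriveD (is_derive_cos t) (is_derive_sin t).
by rewrite [cas (- t)]/cas cosN sinN [- _ + _]addrC.
Qed.

Lemma measurable_cas : measurable_fun setT cas.
Proof.
by apply: measurable_funD; apply: continuous_measurable_fun;
  [exact: continuous_cos|exact: continuous_sin].
Qed.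

Lemma le_MVT (f df : R -> R) (M b : R) : (forall t, is_derive t 1 f (df t)) ->
  (forall t, `|t| <= `|b| -> `|df t| <= M) -> `|f b - f 0| <= M * `|b|.
Proof.
move=> fd dfM.
have cf : forall u v, {within `[u, v], continuous f}.
  move=> u v; apply: continuous_subspaceT => t.
  by apply/differentiable_continuous/derivable1_diffP; have [] := fd t.
have [b0|b0|<-] := ltgtP 0 b; last by rewrite subrr !normr0 mulr0.
- have [c cb ->] := MVT b0 (fun t _ => fd t) (cf 0 b).
  move: cb; rewrite in_itv/= => /andP[c0 cb].
  rewrite subr0 normrM ler_wpM2r// dfM// !ger0_norm ?ltW//.
- have [c cb E] := MVT b0 (fun t _ => fd t) (cf b 0).
  move: cb; rewrite in_itv/= => /andP[c0 cb].
  rewrite distrC E sub0r normrM normrN ler_wpM2r// dfM//.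
  by rewrite !ltr0_norm// lerN2 ltW.
Qed.

Lemma sin_sub_id b : `|sin b - b| <= b ^+ 2.
Proof.
have h (t : R) : is_derive t 1 (fun t => sin t - t) (cos t - 1).
  exact: is_deriveB.
have := le_MVT h (M := `|b|); rewrite sin0 => /(_ b); rewrite !subr0 => H.
rewrite -real_normK ?num_real// expr2; apply: H => t tb.
have hc (s : R) : is_derive s 1 (@cos R) (- sin s) by exact: is_derive_cos.
have := le_MVT hc (M := 1) (b := t); rewrite cos0 mul1r => H.
by apply: le_trans (H _) tb => s _; rewrite normrN ler_norml sin_geN1 sin_le1.
Qed.

Lemma cos_sub1 b : `|cos b - 1| <= b ^+ 2.
Proof.
have hc (s : R) : is_derive s 1 (@cos R) (- sin s) by exact: is_derive_cos.
have := le_MVT hc (M := `|b|) (b := b); rewrite cos0 => H.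
rewrite -real_normK ?num_real// expr2; apply: H => t tb; rewrite normrN.
have hs (s : R) : is_derive s 1 (@sin R) (cos s) by exact: is_derive_sin.
have := le_MVT hs (M := 1) (b := t); rewrite sin0 subr0 mul1r => H.
by apply: le_trans (H _) tb => s _; rewrite ler_norml cos_geN1 cos_le1.
Qed.

(** The derivative of [cas] at a is cas(-a). The remainder consists of two terms, each at most |cas|
    <= 2 times b^2, whence the constant 4. *)
Lemma cas_taylor a b : `|cas (a + b) - cas a - b * cas (- a)| <= 4 * b ^+ 2.
Proof.
rewrite casD.
rewrite (_ : _ - _ = cas a * (cos b - 1) + cas (- a) * (sin b - b)); last by ring.
apply: le_trans (ler_normD _ _) _; rewrite !normrM.
have := cos_sub1 b; have := sin_sub_id b.
have := cas_le2 a; have := cas_le2 (- a).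
have := normr_ge0 (cas a); have := normr_ge0 (cas (- a)).
have := normr_ge0 (cos b - 1); have := normr_ge0 (sin b - b).
set u := `|_|; set v := `|_|; set w := `|_|; set z := `|_| => *.
nra.
Qed.

End cas.

(** * Smooth functions of polynomial growth *)

Section moderate.
Context {R : realType} {d : nat}.
Implicit Types (h f g m : 'rV[R]_d -> R) (x : 'rV[R]_d).

(** The square of the bracket <x>. *)
Definition jap x : R := 1 + enorm x ^+ 2.

Lemma jap_ge1 x : 1 <= jap x.
Proof. by rewrite lerDl sqr_ge0. Qed.

Lemma jap0 x : 0 < jap x.
Proof. exact: jap_gt0. Qed.

Lemma coord_le_jap x i : `|x ord0 i| <= jap x.
Proof.
have : x ord0 i ^+ 2 <= enorm x ^+ 2.
  rewrite enorm_sqr /dotrV (bigD1 i)//= -expr2 lerDl.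
  by apply: sumr_ge0 => j _; rewrite -expr2 sqr_ge0.
rewrite /jap -real_normK ?num_real// => h.
have := normr_ge0 (x ord0 i); nra.
Qed.

(** The logistic function: a smooth substitute for the Heaviside step whose derivative is a
    polynomial in itself, so that a class stable under products can contain it together with all its
    derivatives. *)
Definition sigmoid (t : R) := (1 + expR (- t))^-1.

Lemma sigmoid_gt0 t : 0 < sigmoid t.
Proof. by rewrite invr_gt0 addr_gt0// expR_gt0. Qed.

Lemma sigmoid_le1 t : sigmoid t <= 1.
Proof. by rewrite invf_le1 ?lerDl ?expR_ge0// addr_gt0// expR_gt0. Qed.

Lemma is_derive_sigmoid (t : R) :
  is_derive (t : R) 1 sigmoid (sigmoid t * (1 - sigmoid t)).
Proof.
have h0 : 1 + expR (- t) != 0 by rewrite gt_eqF// addr_gt0// expR_gt0.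
have hd : is_derive (t : R) 1 (fun t => 1 + expR (- t)) (- expR (- t)).
  apply: is_derive_eq.
  by rewrite /GRing.scale/= add0r mul1r mulrN1.
split; first by apply: derivableV => //; exact: ex_derive.
rewrite deriveV// derive_val /sigmoid /GRing.scale/=.
by field.
Qed.

(* Generators are chosen so that this class is stable under differentiation
   and consists of polynomially bounded functions. *)
Inductive moderate : ('rV[R]_d -> R) -> Prop :=
| moderate_cst c : moderate (fun=> c)
| moderate_coord i : moderate (fun x => x ord0 i)
| moderate_jap s : moderate (fun x => jap x `^ s)
| moderate_sigmoid a b i : moderate (fun x => sigmoid (a * x ord0 i + b))
| moderate_cas a : moderate (fun x => cas (dotrV a x))
| moderateD f g : moderate f -> moderate g -> moderate (fun x => f x + g x)
| moderateM f g : moderate f -> moderate g -> moderate (fun x => f x * g x).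

Lemma moderate_has_grad m : moderate m ->
  exists dm : 'I_d -> 'rV[R]_d -> R, (forall i, moderate (dm i)) /\
    forall x, has_grad m x (dm ^~ x).
Proof.
elim=> {m} [c|j|s|a b j|a|f g _ [df [mdf fE]] _ [dg [mdg gE]]|
    f g mf [df [mdf fE]] mg [dg [mdg gE]]].
- exists (fun _ _ => 0); split; first by move=> i; exact: moderate_cst.
  by move=> x; exact: has_grad_cst.
- exists (fun i _ => (i == j)%:R); split; first by move=> i; exact: moderate_cst.
  by move=> x; exact: has_grad_coord.
- exists (fun i x => s * jap x `^ (s - 1) * (2 * x ord0 i)); split.
    move=> i; apply: moderateM; apply: moderateM; try exact: moderate_cst.
    - exact: moderate_jap.
    - exact: moderate_coord.
  move=> x; have hj := has_gradD (has_grad_cst 1 x) (has_grad_sqnorm x).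
  have := has_grad_comp (@is_derive1_powR R s (jap x) (jap0 x)) hj.
  by move=> /has_grad_eq; apply => i; rewrite add0r.
- exists (fun i x => sigmoid (a * x ord0 j + b) *
    (1 + (-1) * sigmoid (a * x ord0 j + b)) * (a * (i == j)%:R)); split.
    move=> i; apply: moderateM; last exact: moderate_cst.
    apply: moderateM; first exact: moderate_sigmoid.
    apply: moderateD; first exact: moderate_cst.
    apply: moderateM; first exact: moderate_cst.
    exact: moderate_sigmoid.
  move=> x; have hj := has_gradD (has_gradZ a (has_grad_coord j x)) (has_grad_cst b x).
  have := has_grad_comp (is_derive_sigmoid _) hj.
  by move=> /has_grad_eq; apply => i; rewrite addr0 mulN1r.
- exists (fun i x => a ord0 i * cas (dotrV (- a) x)); split.
    by move=> i; apply: moderateM; [exact: moderate_cst|exact: moderate_cas].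
  move=> x; have := has_grad_comp (is_derive_cas _) (has_grad_dotrV a x).
  by move=> /has_grad_eq; apply => i; rewrite dotrVNl mulrC.
- exists (fun i x => df i x + dg i x); split; first by move=> i; exact: moderateD.
  by move=> x; exact: has_gradD.
- exists (fun i x => f x * dg i x + df i x * g x); split.
    by move=> i; apply: moderateD; exact: moderateM.
  by move=> x; exact: has_gradM.
Qed.

Lemma moderate_bound m : moderate m ->
  exists N C, forall x, `|m x| <= C * jap x ^+ N.
Proof.
elim=> {m} [c|j|s|a b j|a|f g _ [N [C fE]] _ [N' [C' gE]]|
    f g mf [N [C fE]] mg [N' [C' gE]]].
- by exists 0%N, `|c| => x; rewrite expr0 mulr1.
- by exists 1%N, 1 => x; rewrite expr1 mul1r coord_le_jap.
- exists (Num.truncn `|s|).+1, 1 => x; rewrite mul1r ger0_norm ?powR_ge0//.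
  rewrite -powR_mulrn ?(ltW (jap0 x))//; apply: ler_powR; first exact: jap_ge1.
  exact: le_trans (ler_norm s) (ltW (truncnS_gt `|s|)).
- exists 0%N, 1 => x; rewrite expr0 mulr1 ger0_norm ?sigmoid_le1//.
  exact: ltW (sigmoid_gt0 _).
- by exists 0%N, 2 => x; rewrite expr0 mulr1 cas_le2.
- have C0 : 0 <= C by have := fE 0; rewrite /jap; have := normr_ge0 (f 0); have := exprn_gt0 N (jap0 0); rewrite /jap; nra.
  have C0' : 0 <= C' by have := gE 0; rewrite /jap; have := normr_ge0 (g 0); have := exprn_gt0 N' (jap0 0); rewrite /jap; nra.
  exists (N + N')%N, (C + C') => x.
  rewrite (le_trans (ler_normD _ _))// mulrDl lerD//.
    rewrite (le_trans (fE x))// ler_wpM2l// ler_weXn2l ?jap_ge1// leq_addr//.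
  rewrite (le_trans (gE x))// ler_wpM2l// ler_weXn2l ?jap_ge1// leq_addl//.
- exists (N + N')%N, (C * C') => x.
  by rewrite normrM exprD mulrACA ler_pM.
Qed.

Lemma moderate_diff m x : moderate m -> differentiable m x.
Proof. by move=> /moderate_has_grad[dm [_ /(_ x)[]]]. Qed.

End moderate.

(** * Real Schwartz functions *)

Section schwartz.
Context {R : realType} {d : nat}.
Implicit Types (h f g m : 'rV[R]_d -> R) (x : 'rV[R]_d).

Definition pder (i : 'I_d) h : 'rV[R]_d -> R := fun x => 'D_(unit_rV i) h x.
Definition pders (s : seq 'I_d) h := foldr pder h s.

Definition rapid h := forall N, exists C, forall x, jap x ^+ N * `|h x| <= C.

(** Decay is asked of each iterated derivative separately. As there are finitely many of each order,
    this matches the seminorm condition; see [schwartzP]. *)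
Definition rschwartz h := forall s,
  (forall x, differentiable (pders s h) x) /\ rapid (pders s h).

(** A coinduction principle: it replaces inductions on iterated derivatives by the choice of a class
    P that describes their shape and is stable under a single derivative. *)
Lemma rschwartz_coind (P : ('rV[R]_d -> R) -> Prop) :
  (forall h, P h -> (forall x, differentiable h x) /\ rapid h /\
    forall i, P (pder i h)) -> forall h, P h -> rschwartz h.
Proof.
move=> H h Ph s.
have Ps : P (pders s h) by elim: s => [|i s IH]//=; have [_ []] := H _ IH.
by have [? []] := H _ Ps.
Qed.

Lemma rschwartz_diff h x : rschwartz h -> differentiable h x.
Proof. by move=> /(_ [::])[]. Qed.

Lemma rschwartz_rapid h : rschwartz h -> rapid h.
Proof. by move=> /(_ [::])[]. Qed.

Lemma rschwartz_pder h i : rschwartz h -> rschwartz (pder i h).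
Proof. by move=> H s; have := H (rcons s i); rewrite /pders foldr_rcons. Qed.

Lemma rschwartz_grad h x : rschwartz h -> has_grad h x (fun i => pder i h x).
Proof. by move=> H; apply/has_grad_self/rschwartz_diff. Qed.

Lemma rschwartz_continuous h : rschwartz h -> continuous h.
Proof. by move=> H x; apply/differentiable_continuous/rschwartz_diff. Qed.

Lemma rschwartz_measurable h : rschwartz h -> measurable_fun setT h.
Proof. by move=> H; apply: measurable_continuous_rV; exact: rschwartz_continuous. Qed.

Lemma rapidD f g : rapid f -> rapid g -> rapid (fun x => f x + g x).
Proof.
move=> rf rg N; have [C HC] := rf N; have [C' HC'] := rg N.
exists (C + C') => x; rewrite (le_trans _ (lerD (HC x) (HC' x)))//.
by rewrite -mulrDr ler_wpM2l ?ler_normD// exprn_ge0// ltW// jap0.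
Qed.

Lemma rapid_moderateM m f : moderate m -> rapid f -> rapid (fun x => m x * f x).
Proof.
move=> /moderate_bound[M [C HC]] rf N; have [C' HC'] := rf (N + M)%N.
have C0 : 0 <= C.
  have := le_trans (normr_ge0 _) (HC 0).
  by rewrite pmulr_lge0// exprn_gt0// jap0.
exists (C * C') => x; rewrite normrM.
apply: le_trans (ler_wpM2l C0 (HC' x)); rewrite exprD.
rewrite mulrCA [leRHS]mulrCA [in leRHS]mulrA -[in leRHS]mulrA [leRHS](_ : _ =
  jap x ^+ N * ((C * jap x ^+ M) * `|f x|)); last by ring.
rewrite mulrCA ler_wpM2l ?exprn_ge0 ?(ltW (jap0 x))// ler_wpM2r//.
Qed.

(** Sums are included because the product rule leaves the class of single products. *)
Inductive moderate_rschwartz : ('rV[R]_d -> R) -> Prop :=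
| moderate_rschwartzM m f : moderate m -> rschwartz f ->
    moderate_rschwartz (fun x => m x * f x)
| moderate_rschwartzD f g : moderate_rschwartz f -> moderate_rschwartz g ->
    moderate_rschwartz (fun x => f x + g x).

Lemma moderate_rschwartz_sub h : moderate_rschwartz h -> rschwartz h.
Proof.
apply: rschwartz_coind => {}h.
suff : moderate_rschwartz h -> rapid h /\
    exists2 dh : 'I_d -> 'rV[R]_d -> R, (forall i, moderate_rschwartz (dh i)) &
    forall x, has_grad h x (dh ^~ x).
  move=> H /H[rh [dh mdh hd]]; split; first by move=> x; have [] := hd x.
  split=> // i; rewrite (_ : pder i h = dh i)//.
  by apply/funext => x; exact: (hd x).2.
elim=> {h} [m f mm sf|f g _ [rf [df mdf fE]] _ [rg [dg mdg gE]]].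
  split; first exact/rapid_moderateM/rschwartz_rapid.
  have [dm [mdm mE]] := moderate_has_grad mm.
  exists (fun i x => m x * pder i f x + dm i x * f x).
    move=> i; apply: moderate_rschwartzD; apply: moderate_rschwartzM => //.
    exact: rschwartz_pder.
  by move=> x; apply: has_gradM => //; exact: rschwartz_grad.
split; first exact: rapidD.
exists (fun i x => df i x + dg i x).
  by move=> i; exact: moderate_rschwartzD.
by move=> x; exact: has_gradD.
Qed.

Lemma rschwartz_moderateM m f : moderate m -> rschwartz f ->
  rschwartz (fun x => m x * f x).
Proof. by move=> ? ?; apply: moderate_rschwartz_sub; exact: moderate_rschwartzM. Qed.

Lemma rschwartzZ c f : rschwartz f -> rschwartz (fun x => c * f x).
Proof. exact/rschwartz_moderateM/moderate_cst. Qed.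

Lemma rschwartzD f g : rschwartz f -> rschwartz g -> rschwartz (fun x => f x + g x).
Proof.
move=> sf sg.
rewrite (_ : (fun _ => _) = fun x => 1 * f x + 1 * g x).
  apply: moderate_rschwartz_sub; apply: moderate_rschwartzD;
  by apply: moderate_rschwartzM => //; exact: moderate_cst.
by apply/funext => x; rewrite !mul1r.
Qed.

Lemma rschwartzB f g : rschwartz f -> rschwartz g -> rschwartz (fun x => f x - g x).
Proof.
move=> sf sg; have := rschwartzD sf (rschwartzZ (-1) sg).
by congr rschwartz; apply/funext => x; rewrite mulN1r.
Qed.

Lemma rschwartz0 : rschwartz (fun=> 0).
Proof.
apply: (@rschwartz_coind (fun h => h = fun=> 0)) => // h ->.
split; first by move=> x; exact: differentiable_cst.
split; first by move=> N; exists 0 => x; rewrite normr0 mulr0.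
by move=> i; apply/funext => x; exact: derive_cst.
Qed.

Lemma rschwartz_coordM i f : rschwartz f -> rschwartz (fun x => x ord0 i * f x).
Proof. exact/rschwartz_moderateM/moderate_coord. Qed.

Lemma dotrV_affine_le (l : R) (b x : 'rV[R]_d) : l != 0 ->
  dotrV x x <= 2 / l ^+ 2 * (dotrV (l *: x + b) (l *: x + b) + dotrV b b).
Proof.
move=> l0; rewrite /dotrV -big_split/= mulr_sumr; apply: ler_sum => i _.
rewrite !mxE; have l2 : 0 < l ^+ 2 by rewrite exprn_even_gt0.
rewrite mulrAC ler_pdivlMr//; set u := x ord0 i; set v := b ord0 i.
(* Once [l ^+ 2] is cleared, the two sides of each summand differ by exactly this square. *)
have := sqr_ge0 (l * u + 2 * v); nra.
Qed.

Lemma jap_affine_le (l : R) (b : 'rV[R]_d) : l != 0 ->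
  exists2 K, 0 < K & forall x, jap x <= K * jap (l *: x + b).
Proof.
move=> l0; exists (1 + 2 / l ^+ 2 * (1 + dotrV b b)).
  by rewrite ltr_pwDl// mulr_ge0 ?divr_ge0 ?sqr_ge0// addr_ge0// dotrVxx_ge0.
move=> x; rewrite /jap !enorm_sqr.
have := dotrV_affine_le b x l0; set q := 2 / l ^+ 2.
have q0 : 0 <= q by rewrite divr_ge0// sqr_ge0.
have := dotrVxx_ge0 (l *: x + b); have := dotrVxx_ge0 b.
set u := dotrV _ _; set v := dotrV _ _; set w := dotrV _ _ => u0 v0 H.
have : 0 <= q * u * v by apply: mulr_ge0 => //; apply: mulr_ge0.
nra.
Qed.

Lemma rschwartz_affine (l : R) (b : 'rV[R]_d) h : l != 0 -> rschwartz h ->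
  rschwartz (fun x => h (l *: x + b)).
Proof.
move=> l0 sh.
pose P f := exists c g, rschwartz g /\ f = fun x => c * g (l *: x + b).
apply: (@rschwartz_coind P); last by exists 1, h; split => //; apply/funext => x; rewrite mul1r.
move=> _ [c [g [sg ->]]].
have H x := has_gradZ c (has_grad_affine (rschwartz_grad (l *: x + b) sg)).
split; first by move=> x; have [] := H x.
split; last first.
  move=> i; exists (c * l), (pder i g); split; first exact: rschwartz_pder.
  by apply/funext => x; rewrite -mulrA; exact: (H x).2.
move=> N; have [C HC] := rschwartz_rapid sg N; have [K K0 HK] := jap_affine_le b l0.
exists (`|c| * (K ^+ N * C)) => x; rewrite normrM mulrCA ler_wpM2l//.
apply: le_trans (ler_wpM2l (exprn_ge0 N (ltW K0)) (HC (l *: x + b))).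
rewrite mulrA -exprMn ler_wpM2r// lerXn2r ?nnegrE ?mulr_ge0// ?(ltW (jap0 _))//.
exact: ltW.
Qed.

Definition gauss_rV (c : R) x := expR (- (c * dotrV x x)).

Lemma gauss_rV_grad c x : has_grad (gauss_rV c) x
  (fun i => (- (2 * c)) * x ord0 i * gauss_rV c x).
Proof.
have hE : gauss_rV c = fun x => expR ((- c) * enorm x ^+ 2).
  by apply/funext => y; rewrite /gauss_rV enorm_sqr mulNr.
rewrite hE.
have := has_grad_comp (is_derive_expR _) (has_gradZ (- c) (has_grad_sqnorm x)).
by move=> /has_grad_eq; apply => i; ring.
Qed.

(** With q = c/(N+1) and r = min(1, q), one has r (1 + |x|^2) <= 1 + q |x|^2 <= exp(q |x|^2); the
    power N+1 of this gives the bound. *)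
Lemma rapid_gauss_rV c : 0 < c -> rapid (gauss_rV c).
Proof.
move=> c0 N; pose q := c / N.+1%:R.
have q0 : 0 < q by rewrite divr_gt0.
pose r := Num.min 1 q.
have r0 : 0 < r by rewrite lt_min ltr01.
exists (r ^- N.+1) => x.
rewrite ger0_norm ?expR_ge0// /gauss_rV expRN ler_pdivrMr ?expR_gt0//.
rewrite mulrC ler_pdivlMr ?exprn_gt0//.
apply: (@le_trans _ _ ((jap x * r) ^+ N.+1)).
  rewrite exprMn ler_wpM2r ?exprn_ge0// ?(ltW r0)//.
  by rewrite ler_weXn2l ?jap_ge1.
have -> : expR (c * dotrV x x) = expR (q * dotrV x x) ^+ N.+1.
  rewrite -expRM_natl; congr expR; rewrite /q mulrA mulrCA mulfV ?mulr1//.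
rewrite lerXn2r ?nnegrE ?expR_ge0 ?mulr_ge0 ?(ltW r0) ?(ltW (jap0 _))//.
apply: le_trans (expR_ge1Dx _); rewrite /jap enorm_sqr mulrDl mul1r lerD//.
  by rewrite ge_min lexx.
by rewrite mulrC ler_wpM2r ?dotrVxx_ge0// ge_min lexx orbT.
Qed.

(** Every derivative of a Gaussian is a moderate function times the same Gaussian. *)
Lemma rschwartz_gauss c : 0 < c -> rschwartz (gauss_rV c).
Proof.
move=> c0.
pose P f := exists2 m, moderate m & f = fun x => m x * gauss_rV c x.
apply: (@rschwartz_coind P); last first.
  by exists (fun=> 1); [exact: moderate_cst|apply/funext => x; rewrite mul1r].
move=> _ [m mm ->]; have [dm [mdm mE]] := moderate_has_grad mm.
have H x := has_gradM (mE x) (gauss_rV_grad c x).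
split; first by move=> x; have [] := H x.
split; first exact/rapid_moderateM/rapid_gauss_rV.
move=> i; exists (fun x => m x * ((- (2 * c)) * x ord0 i) + dm i x).
  apply: moderateD => //; apply: moderateM => //; apply: moderateM.
    exact: moderate_cst.
  exact: moderate_coord.
by apply/funext => x; rewrite [LHS](H x).2; ring.
Qed.

Lemma rapid_ge0_bound h : rapid h -> forall N, exists2 C, 0 <= C &
  forall x, `|h x| <= C * (jap x ^+ N)^-1.
Proof.
move=> rh N; have [C HC] := rh N; exists C.
  by apply: le_trans (HC 0); rewrite mulr_ge0// exprn_ge0// ltW// jap0.
by move=> x; rewrite ler_pdivlMr ?exprn_gt0 ?jap0// mulrC.
Qed.

Lemma intg_rapid h : measurable_fun setT h -> rapid h -> intg (lebesgue_rV d) h.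
Proof.
move=> mh /rapid_ge0_bound/(_ d.+1)[C _ HC].
apply: le_intg mh HC _; apply: intgZ; exact: intg_japV.
Qed.

Lemma intg_rschwartz h : rschwartz h -> intg (lebesgue_rV d) h.
Proof.
by move=> sh; apply: intg_rapid; [exact: rschwartz_measurable|exact: rschwartz_rapid].
Qed.

Lemma rschwartz_bounded h : rschwartz h -> exists C, forall x, `|h x| <= C.
Proof.
move=> /rschwartz_rapid/(_ 0%N)[C HC]; exists C => x.
by have := HC x; rewrite expr0 mul1r.
Qed.

End schwartz.

(** * Translation, reflection and integration of derivatives *)

Section rV_integrals.
Context {R : realType} {d : nat}.
Notation mu := (@lebesgue_rV R d).
Implicit Types (h f g m : 'rV[R]_d -> R) (x : 'rV[R]_d).

Lemma intg_affine (l : R) (b : 'rV[R]_d) f : l != 0 -> intg mu f ->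
  intg mu (fun x => f (l *: x + b)).
Proof.
move=> l0 fi; have mf := measurable_int mu fi.
have ma := @measurable_affine_rV R d l b.
apply/integrableP; split; first exact: measurableT_comp mf ma.
have := @ge0_integral_affine R d l b (fun x => `|(f x)%:E|%E) l0.
have mn : measurable_fun setT (fun x => `|(f x)%:E|)%E by apply: measurableT_comp.
move=> /(_ mn (fun x => abse_ge0 _))/= ->.
have /integrableP[_ H] := fi.
by rewrite lte_mul_pinfty// ?lee_fin ?invr_ge0 ?exprn_ge0//.
Qed.

Lemma Rintegral_affine (l : R) (b : 'rV[R]_d) f : l != 0 -> intg mu f ->
  \int[mu]_x f (l *: x + b) = `|l| ^- d * \int[mu]_x f x.
Proof.
move=> l0 fi; have mf := measurable_int mu fi.
apply: EFin_inj; rewrite EFinM !EFin_Rintegral//; last exact: intg_affine.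
have Fp := integrable_pos_fin_num measurableT fi.
have Fn := integrable_neg_fin_num measurableT fi.
have E : (\int[mu]_x (f x)%:E = \int[mu]_x (EFin \o f)^\+%E x -
  \int[mu]_x (EFin \o f)^\-%E x)%E by exact: integralE.
have H (g : 'rV[R]_d -> \bar R) := @ge0_integral_affine R d l b g l0.
have Hp := H (EFin \o f)^\+%E (measurable_funepos mf) (fun x => funepos_ge0 _ x).
have Hn := H (EFin \o f)^\-%E (measurable_funeneg mf) (fun x => funeneg_ge0 _ x).
have E' : (\int[mu]_x (f (l *: x + b)%R)%:E =
  \int[mu]_x (EFin \o f)^\+%E (l *: x + b)%R -
  \int[mu]_x (EFin \o f)^\-%E (l *: x + b)%R)%E.
  rewrite [LHS]integralE; congr (_ - _)%E; apply: eq_integral => x _.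
    by rewrite !funeposE.
  by rewrite !funenegE.
rewrite E' E Hp Hn -(fineK Fp) -(fineK Fn).
by rewrite -EFinB -!EFinM mulrBr EFinB.
Qed.

Lemma Rintegral_translate b f : intg mu f ->
  \int[mu]_x f (x + b) = \int[mu]_x f x.
Proof.
move=> fi; have := @Rintegral_affine 1 b f (oner_neq0 _) fi.
rewrite normr1 expr1n invr1 mul1r => <-.
by apply: eq_Rintegral => x _; rewrite scale1r.
Qed.

Lemma intg_translate b f : intg mu f -> intg mu (fun x => f (x + b)).
Proof.
move=> fi; have := @intg_affine 1 b f (oner_neq0 _) fi.
by congr (intg mu _); apply/funext => x; rewrite scale1r.
Qed.

Lemma Rintegral_reflect b f : intg mu f ->
  \int[mu]_x f (b - x) = \int[mu]_x f x.
Proof.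
move=> fi; have n0 : (- 1 : R) != 0 by rewrite oppr_eq0 oner_eq0.
have := @Rintegral_affine (- 1) b f n0 fi.
rewrite normrN normr1 expr1n invr1 mul1r => <-.
by apply: eq_Rintegral => x _; rewrite scaleN1r addrC.
Qed.

Lemma intg_reflect b f : intg mu f -> intg mu (fun x => f (b - x)).
Proof.
move=> fi; have n0 : (- 1 : R) != 0 by rewrite oppr_eq0 oner_eq0.
have := @intg_affine (- 1) b f n0 fi.
by congr (intg mu _); apply/funext => x; rewrite scaleN1r addrC.
Qed.

Lemma Rintegral_opp f : intg mu f -> \int[mu]_x f (- x) = \int[mu]_x f x.
Proof. by move/(Rintegral_reflect 0) <-; apply: eq_Rintegral => x _; rewrite sub0r. Qed.

Lemma intg_opp f : intg mu f -> intg mu (fun x => f (- x)).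
Proof.
by move/(intg_reflect 0); congr (intg mu _); apply/funext => x; rewrite sub0r.
Qed.

Lemma Rintegral_sum n (F : 'I_n -> 'rV[R]_d -> R) : (forall i, intg mu (F i)) ->
  intg mu (fun x => \sum_i F i x) /\
  \int[mu]_x (\sum_i F i x) = \sum_i \int[mu]_x F i x.
Proof.
elim: n F => [|n IH] F Fi.
  rewrite big_ord0 (_ : (fun x => _) = fun=> 0); last first.
    by apply/funext => x; rewrite big_ord0.
  split; first exact: integrable0.
  by rewrite /Rintegral integral0_eq.
have [IH1 IH2] := IH (fun i => F (widen_ord (leqnSn n) i)) (fun i => Fi _).
have E : (fun x => \sum_i F i x) =
   fun x => \sum_(i < n) F (widen_ord (leqnSn n) i) x + F ord_max x.
  by apply/funext => x; rewrite big_ord_recr.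
split; first by rewrite E; apply: intgD.
transitivity (\int[mu]_x (\sum_(i < n) F (widen_ord (leqnSn n) i) x + F ord_max x)).
  by apply: eq_Rintegral => x _; rewrite big_ord_recr.
by rewrite RintegralD// IH2 big_ord_recr.
Qed.

Lemma unit_rV_sqnorm i : dotrV (unit_rV i : 'rV[R]_d) (unit_rV i) = 1.
Proof.
rewrite /dotrV (bigD1 i)//= big1 ?addr0; last first.
  by move=> j ji; rewrite !mxE eqxx (negbTE ji) mul0r.
by rewrite !mxE !eqxx mulr1.
Qed.

Lemma rschwartz_pder_line h i x (s : R) : rschwartz h ->
  is_derive s 1 (fun t => h (x + t *: unit_rV i)) (pder i h (x + s *: unit_rV i)).
Proof.
move=> sh; have := is_derive_line (rschwartz_grad (x + s *: unit_rV i) sh).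
rewrite (bigD1 i)//= big1 ?addr0; last first.
  by move=> j ji; rewrite mxE eqxx (negbTE ji) mul0r.
by rewrite mxE !eqxx mul1r.
Qed.

Lemma jap_translate_le x b : dotrV b b <= 1 -> jap x <= 3 * jap (x + b).
Proof.
move=> b1; have := @dotrV_affine_le R d 1 b x (oner_neq0 _).
rewrite scale1r expr1n divr1 /jap !enorm_sqr => H.
have := dotrVxx_ge0 (x + b); lra.
Qed.

(* The difference quotients integrate to [0] by translation invariance. *)
Lemma Rintegral_pder h i : rschwartz h -> \int[mu]_x pder i h x = 0.
Proof.
move=> sh.
pose q n x := n.+1%:R * (h (x + n.+1%:R^-1 *: unit_rV i) - h x).
have [C C0 HC] := rapid_ge0_bound (rschwartz_rapid (rschwartz_pder i sh)) d.+1.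
have qE n : \int[mu]_x q n x = 0.
  have hi := intg_rschwartz sh.
  rewrite /q RintegralZl//; last by apply: intgB => //; exact: intg_translate.
  by rewrite RintegralB ?Rintegral_translate ?subrr ?mulr0//; exact: intg_translate.
(* The mean value inequality bounds the quotient by values of the derivative at points within
   distance 1 of x, where [jap] differs by a factor of at most 3. *)
have [] := @dominated_cvg_Rintegral _ _ _ mu q (pder i h)
  (fun x => C * 3 ^+ d.+1 * (jap x ^+ d.+1)^-1).
- move=> n; apply: measurable_funM => //; apply: measurable_funB.
    exact: intg_measurable (intg_translate _ (intg_rschwartz sh)).
  exact: rschwartz_measurable.
- by apply: rschwartz_measurable; exact: rschwartz_pder.
- move=> x.
  have [dh _] := rschwartz_pder_line i x 0 sh.
  have dE : (fun r : R => r^-1 *: (h (r *: unit_rV i + x) - h x)) @ 0^' --> pder i h x.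
    have := diff_derivable (v := unit_rV i) (rschwartz_diff x sh).
    by move/derivableP => [].
  have cvh : (fun n => n.+1%:R^-1 : R) @ \oo --> 0^'.
    move=> A; rewrite /dnbhs /within /= => A0.
    have := @cvg_harmonic R _ A0; rewrite /nbhs/=; apply: filterS => n /=.
    by apply; rewrite gt_eqF//= invr_gt0.
  have := cvg_comp _ _ cvh dE; apply: cvg_trans; apply: near_eq_cvg.
  by apply: nearW => n; rewrite /q /= invrK /GRing.scale/= [_ + x]addrC.
- move=> n x; rewrite /q normrM ger0_norm//.
  have b0 : 0 <= n.+1%:R^-1 :> R by rewrite invr_ge0.
  have H := @le_MVT R _ _ (C * 3 ^+ d.+1 * (jap x ^+ d.+1)^-1) n.+1%:R^-1
    (fun s => rschwartz_pder_line i x s sh).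
  rewrite scale0r addr0 in H.
  apply: (le_trans (ler_wpM2l (ler0n _ _) (H _))); last first.
    by rewrite (ger0_norm b0) mulrCA mulfV// mulr1.
  move=> t tn.
  apply: le_trans (HC _) _; rewrite -mulrA ler_wpM2l//.
  have t1 : t ^+ 2 <= 1.
    rewrite -real_normK ?num_real// expr_le1//; apply: le_trans tn _.
    by rewrite ger0_norm// invf_le1// ler1n.
  have := @jap_translate_le x (t *: unit_rV i).
  rewrite dotrVZl dotrVC dotrVZl unit_rV_sqnorm mulr1 -expr2 => /(_ t1) J.
  rewrite ler_pdivlMr ?exprn_gt0 ?jap0// mulrC ler_pdivrMr ?exprn_gt0 ?jap0//.
  by rewrite -exprMn lerXn2r ?nnegrE ?mulr_ge0 ?(ltW (jap0 _)).
- by apply: intgZ; exact: intg_japV.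
move=> _; rewrite (_ : (fun n => _) = fun=> 0); last by apply/funext => n; exact: qE.
by move=> /cvg_lim <-//; rewrite lim_cst.
Qed.

End rV_integrals.

(** * The Hartley transform *)

Section hartley.
Context {R : realType} {d : nat}.
Notation mu := (@lebesgue_rV R d).
Implicit Types (h f g m : 'rV[R]_d -> R) (x k : 'rV[R]_d).

Definition hartley_cst : R := (2 * pi) `^ (- (d%:R / 2)).

Definition hartley h k : R := hartley_cst * \int[mu]_x (cas (dotrV k x) * h x).

Lemma hartley_cst_gt0 : 0 < hartley_cst.
Proof. by rewrite powR_gt0// mulr_gt0// pi_gt0. Qed.

Lemma measurable_cas_dotrV k : measurable_fun setT (fun x => cas (dotrV k x)).
Proof.
apply: measurableT_comp; first exact: measurable_cas.
rewrite (_ : dotrV k = fun x => dotrV x k); first exact: measurable_dotrV.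
by apply/funext => x; rewrite dotrVC.
Qed.

Lemma intg_cas k h : intg mu h -> intg mu (fun x => cas (dotrV k x) * h x).
Proof.
by apply: intgMb; [exact: measurable_cas_dotrV|move=> x; exact: cas_le2].
Qed.

Lemma hartleyD f g k : intg mu f -> intg mu g ->
  hartley (fun x => f x + g x) k = hartley f k + hartley g k.
Proof.
move=> fi gi; rewrite /hartley -mulrDr; congr (_ * _).
by rewrite -RintegralD ?intg_cas//; apply: eq_Rintegral => x _; rewrite mulrDr.
Qed.

Lemma hartleyZ c f k : intg mu f -> hartley (fun x => c * f x) k = c * hartley f k.
Proof.
move=> fi; rewrite /hartley mulrCA; congr (_ * _).
by rewrite -RintegralZl ?intg_cas//; apply: eq_Rintegral => x _; rewrite mulrCA.
Qed.

Lemma hartleyB f g k : intg mu f -> intg mu g ->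
  hartley (fun x => f x - g x) k = hartley f k - hartley g k.
Proof.
move=> fi gi; rewrite -[in RHS]mulN1r -hartleyZ// -hartleyD//; last exact: intgZ.
by congr (hartley _ k); apply/funext => x; rewrite mulN1r.
Qed.

Lemma hartley_sum n (F : 'I_n -> 'rV[R]_d -> R) k : (forall i, intg mu (F i)) ->
  hartley (fun x => \sum_i F i x) k = \sum_i hartley (F i) k.
Proof.
move=> Fi; rewrite /hartley -mulr_sumr; congr (_ * _).
rewrite -(Rintegral_sum (fun i => intg_cas k (Fi i))).2.
by apply: eq_Rintegral => x _; rewrite mulr_sumr.
Qed.

Lemma hartley_le h k : intg mu h ->
  `|hartley h k| <= hartley_cst * (2 * \int[mu]_x `|h x|).
Proof.
move=> hi; rewrite normrM (ger0_norm (ltW hartley_cst_gt0)).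
rewrite ler_wpM2l ?(ltW hartley_cst_gt0)//.
apply: le_trans (le_normr_Rintegral measurableT (intg_cas k hi)) _.
rewrite -RintegralZl//; last exact: intg_norm.
apply: le_Rintegral => //; first exact/intg_norm/intg_cas.
  exact/intgZ/intg_norm.
by move=> x _; rewrite normrM ler_wpM2r// cas_le2.
Qed.

Lemma hartley_opp h k : intg mu h -> hartley h (- k) = hartley (fun x => h (- x)) k.
Proof.
move=> hi; rewrite /hartley -(Rintegral_opp (intg_cas _ hi)); congr (_ * _).
by apply: eq_Rintegral => x _; rewrite dotrVNl dotrVC dotrVNl opprK dotrVC.
Qed.

(** Here |k| is the sup norm, whence the factor d. *)
Lemma dotrV_le x k : `|dotrV k x| <= `|k| * (d%:R * jap x).
Proof.
apply: le_trans (ler_norm_sum _ _ _) _.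
apply: (@le_trans _ _ (\sum_(i < d) `|k| * jap x)).
  by apply: ler_sum => i _; rewrite normrM ler_pM ?rV_coord_le ?coord_le_jap.
by rewrite sumr_const card_ord -[leLHS]mulr_natl mulrCA.
Qed.

(** A quadratic remainder is a little-o of the increment, so the differential is obtained at once,
    and not merely the partial derivatives. *)
Lemma has_grad_quadratic f k (g : 'I_d -> R) C : 0 <= C ->
  (forall e, `|f (k + e) - f k - \sum_i e ord0 i * g i| <= C * `|e| ^+ 2) ->
  has_grad f k g.
Proof.
move=> C0 fC.
pose L (e : 'rV[R]_d) := \sum_i e ord0 i * g i.
have Llin : linear L.
  move=> a u v; rewrite /L /GRing.scale/= mulr_sumr -big_split; apply: eq_bigr => i _.
  by rewrite !mxE mulrDl mulrA.
pose LM := GRing.isLinear.Build _ _ _ _ _ Llin.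
pose LL : {linear _ -> _} := HB.pack L LM.
have cL : continuous LL.
  move=> e.
  have : differentiable (dotrV (\row_i g i)) e by have [] := has_grad_dotrV (\row_i g i) e.
  move=> /differentiable_continuous.
  rewrite (_ : dotrV _ = LL)//; apply/funext => u; apply: eq_bigr => i _.
  by rewrite mxE mulrC.
have E : f \o shift k = cst (f k) + LL +o_ (0 : 'rV[R]_d) id.
  apply/eqaddoP => e e0.
  (* C may vanish, so the radius is e / (C + 1). *)
  have C1 : 0 < C + 1 by rewrite ltr_wpDl.
  have ue : \forall u \near (0 : 'rV[R]_d), `|u| <= e / (C + 1).
    by apply: nbhs0_le; rewrite divr_gt0.
  near=> u.
  rewrite (_ : (_ - _) u = f (k + u) - f k - L u); last first.
    change (f (u + k) - (f k + L u) = f (k + u) - f k - L u).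
    by rewrite [u + k]addrC opprD addrA.
  apply: le_trans (fC u) _; rewrite expr2 mulrA ler_wpM2r//.
  have : `|u| <= e / (C + 1) by near: u; exact: ue.
  by rewrite ler_pdivlMr// => h; have := normr_ge0 u; lra.
have dE := diff_unique cL E.
have fd : differentiable f k.
  by apply/diff_locallyP; rewrite dE; split.
split => // i; rewrite deriveE// dE /=.
rewrite /L (bigD1 i)//= big1 ?addr0; last first.
  by move=> j ji; rewrite mxE eqxx (negbTE ji) mul0r.
by rewrite mxE !eqxx mul1r.
Unshelve. all: by end_near. Qed.

Lemma rapid_coordM i h : rapid h -> rapid (fun x => x ord0 i * h x).
Proof. exact/rapid_moderateM/moderate_coord. Qed.

Lemma measurable_coordM i h : measurable_fun setT h ->
  measurable_fun setT (fun x => x ord0 i * h x).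
Proof. by move=> mh; apply: measurable_funM => //; exact: measurable_coord. Qed.

Lemma measurable_jap_rV : measurable_fun setT (@jap R d).
Proof.
have := @measurable_jap R d 1; congr measurable_fun; apply/funext => x.
by rewrite powRr1// ltW// jap0.
Qed.

(** Since cas'(t) = cas(-t), differentiation under the integral yields a transform at the reflected
    point. The Taylor bound for [cas] controls the remainder by |e|^2 times the integral of 4 (d (1
    + |x|^2))^2 |h|, which is finite by rapid decay. *)
Lemma hartley_has_grad h k : measurable_fun setT h -> rapid h ->
  has_grad (hartley h) k (fun i => hartley (fun x => x ord0 i * h x) (- k)).
Proof.
move=> mh rh.
have hi := intg_rapid mh rh.
have hji i : intg mu (fun x => x ord0 i * h x).
  by apply: intg_rapid; [exact: measurable_coordM|exact: rapid_coordM].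
have hqi : intg mu (fun x => 4 * (d%:R * jap x) ^+ 2 * `|h x|).
  apply: intg_rapid.
    apply: measurable_funM; last exact: measurableT_comp.
    apply: measurable_funM => //.
    under eq_fun do rewrite expr2.
    by apply: measurable_funM; apply: measurable_funM => //; exact: measurable_jap_rV.
  move=> N; have [C HC] := rh (N + 2)%N; exists (4 * d%:R ^+ 2 * C) => x.
  rewrite normrM normr_id [in X in _ * (X * _)]ger0_norm; last by rewrite mulr_ge0// sqr_ge0.
  rewrite (_ : _ * _ = 4 * d%:R ^+ 2 * (jap x ^+ (N + 2) * `|h x|)); last first.
    by rewrite exprD; ring.
  by rewrite ler_wpM2l// mulr_ge0// sqr_ge0.
apply: (@has_grad_quadratic _ _ _ (hartley_cst *
   \int[mu]_x (4 * (d%:R * jap x) ^+ 2 * `|h x|))).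
  rewrite mulr_ge0 ?(ltW hartley_cst_gt0)//; apply: Rintegral_ge0 => x _.
  by rewrite mulr_ge0// mulr_ge0// sqr_ge0.
move=> e.
have e1 : \sum_i e ord0 i * hartley (fun x => x ord0 i * h x) (- k) =
    hartley_cst * \int[mu]_x (cas (- dotrV k x) * (dotrV e x * h x)).
  transitivity (hartley (fun x => dotrV e x * h x) (- k)); last first.
    by congr (_ * _); apply: eq_Rintegral => x _; rewrite dotrVNl.
  rewrite (_ : (fun x => _) = fun x => \sum_i e ord0 i * (x ord0 i * h x)); last first.
    by apply/funext => x; rewrite /dotrV mulr_suml; apply: eq_bigr => i _; rewrite mulrA.
  rewrite hartley_sum; last by move=> i; exact: intgZ.
  by apply: eq_bigr => i _; rewrite hartleyZ.
have ei : intg mu (fun x => dotrV e x * h x).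
  rewrite (_ : (fun x => _) = fun x => \sum_i e ord0 i * (x ord0 i * h x)); last first.
    by apply/funext => x; rewrite /dotrV mulr_suml; apply: eq_bigr => i _; rewrite mulrA.
  by apply: (Rintegral_sum (fun i => intgZ (e ord0 i) (hji i))).1.
have ci : intg mu (fun x => cas (- dotrV k x) * (dotrV e x * h x)).
  have := intg_cas (- k) ei; congr (intg mu _); apply/funext => x.
  by rewrite dotrVNl.
rewrite e1 /hartley -!mulrBr normrM ger0_norm ?(ltW hartley_cst_gt0)// -mulrA.
rewrite ler_wpM2l ?(ltW hartley_cst_gt0)//.
have i1 := intg_cas (k + e) hi; have i2 := intg_cas k hi.
rewrite -RintegralB// -RintegralB//; last exact: intgB.
rewrite -RintegralZr//.
have i3 := intgB (intgB i1 i2) ci.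
apply: le_trans (le_normr_Rintegral measurableT i3) _.
apply: le_Rintegral => //; first exact: intg_norm.
  by have := intgZ (`|e| ^+ 2) hqi; congr (intg mu _); apply/funext => x; rewrite mulrC.
move=> x _.
rewrite (_ : _ - _ = (cas (dotrV k x + dotrV e x) - cas (dotrV k x) -
   dotrV e x * cas (- dotrV k x)) * h x); last by rewrite dotrVDl; ring.
rewrite normrM mulrAC ler_wpM2r//.
apply: le_trans (cas_taylor _ _) _.
rewrite -mulrA ler_wpM2l// -exprMn mulrC.
rewrite -real_normK ?num_real// lerXn2r ?nnegrE ?mulr_ge0 ?(ltW (jap0 _))//.
exact: dotrV_le.
Qed.

(** Integration by parts: cas(-k.x) h(x) is a Schwartz function of x, so the integral of its partial
    derivative vanishes. *)
Lemma hartley_pder h i k : rschwartz h ->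
  k ord0 i * hartley h k = hartley (pder i h) (- k).
Proof.
move=> sh.
pose c x := cas (dotrV (- k) x).
have mc : moderate c by exact: moderate_cas.
have sch : rschwartz (fun x => c x * h x) by exact: rschwartz_moderateM.
have := Rintegral_pder i sch.
have E x : pder i (fun x => c x * h x) x =
    c x * pder i h x + (- k ord0 i) * (cas (dotrV k x) * h x).
  have Hc := has_grad_comp (is_derive_cas _) (has_grad_dotrV (- k) x).
  rewrite /pder (has_gradM Hc (rschwartz_grad x sh)).2.
  by rewrite -/(pder i h x) mxE !dotrVNl opprK /c dotrVNl; ring.
under eq_Rintegral do rewrite E.
rewrite RintegralD//; last 2 first.
- exact: intg_cas (intg_rschwartz (rschwartz_pder i sh)).
- exact/intgZ/intg_cas/intg_rschwartz.
rewrite RintegralZl//; last exact/intg_cas/intg_rschwartz.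
rewrite mulNr => /eqP; rewrite subr_eq0 => /eqP H.
by rewrite /hartley mulrCA H.
Qed.

(** Two integrations by parts in the same variable cancel the reflection, so 1 + |k|^2 corresponds
    to the identity minus the Laplacian. *)
Lemma hartley_jap h k : rschwartz h ->
  jap k * hartley h k =
  hartley (fun x => h x - \sum_i pder i (pder i h) x) k.
Proof.
move=> sh.
have si i : intg mu (pder i (pder i h)).
  exact/intg_rschwartz/rschwartz_pder/rschwartz_pder.
rewrite hartleyB; last 2 first.
- exact: intg_rschwartz.
- exact: (Rintegral_sum si).1.
rewrite hartley_sum// /jap enorm_sqr mulrDl mul1r; congr (_ + _).
rewrite /dotrV mulr_suml -sumrN; apply: eq_bigr => i _.
rewrite -mulrA hartley_pder//.
have := hartley_pder i (- k) (rschwartz_pder i sh); rewrite opprK mxE => <-.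
by rewrite mulNr opprK.
Qed.

Lemma rschwartz_sum n (F : 'I_n -> 'rV[R]_d -> R) :
  (forall i, rschwartz (F i)) -> rschwartz (fun x => \sum_i F i x).
Proof.
elim: n F => [|n IH] F sF.
  by rewrite (_ : (fun _ => _) = fun=> 0);
    [exact: rschwartz0|apply/funext => x; rewrite big_ord0].
rewrite (_ : (fun _ => _) = fun x => F ord0 x + \sum_i F (lift ord0 i) x).
  by apply: rschwartzD => //; exact: IH.
by apply/funext => x; rewrite big_ord_recl.
Qed.

(** By iteration, (1 + |k|^2)^N times the transform is the transform of another Schwartz function,
    hence bounded. *)
Lemma rapid_hartley h : rschwartz h -> rapid (hartley h).
Proof.
move=> sh N.
suff [g sg E] : exists2 g, rschwartz g & forall k, jap k ^+ N * hartley h k = hartley g k.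
  exists (hartley_cst * (2 * \int[mu]_x `|g x|)) => k.
  rewrite -[jap k ^+ N]ger0_norm ?exprn_ge0 ?(ltW (jap0 _))// -normrM E.
  exact/hartley_le/intg_rschwartz.
elim: N => [|N [g sg E]]; first by exists h => // k; rewrite mul1r.
exists (fun x => g x - \sum_i pder i (pder i g) x).
  apply: rschwartzB => //; apply: rschwartz_sum => i.
  exact/rschwartz_pder/rschwartz_pder.
by move=> k; rewrite exprS -mulrA E hartley_jap.
Qed.

Lemma rschwartz_hartley h : rschwartz h -> rschwartz (hartley h).
Proof.
move=> sh.
(* Each derivative multiplies g by a coordinate and reflects the argument, so the stable class has
   to carry a sign. *)
pose P f := exists c (s : R) g, [/\ rschwartz g, s = 1 \/ s = -1 &
  f = fun k => c * hartley g (s *: k + 0)].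
apply: (@rschwartz_coind R d P); last first.
  exists 1, 1, h; split => //; first by left.
  by apply/funext => k; rewrite mul1r scale1r addr0.
move=> _ [c [s [g [sg s1 ->]]]].
have s0 : s != 0 by case: s1 => ->; rewrite ?oppr_eq0 oner_eq0.
have H k := has_gradZ c (has_grad_affine
  (hartley_has_grad (s *: k + 0) (rschwartz_measurable sg) (rschwartz_rapid sg))).
split; first by move=> k; have [] := H k.
split; last first.
  move=> i; exists (c * s), (- s), (fun x => x ord0 i * g x); split.
  - exact: rschwartz_coordM.
  - by case: s1 => ->; [right|left; rewrite opprK].
  - apply/funext => k; rewrite [LHS](H k).2 mulrA; congr (_ * hartley _ _).
    by rewrite !addr0 scaleNr.
move=> N; have [C HC] := rapid_hartley sg N; exists (`|c| * C) => k.
rewrite normrM mulrCA ler_wpM2l//; apply: le_trans (HC (s *: k + 0)).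
rewrite (_ : jap (s *: k + 0) = jap k)//.
rewrite /jap !enorm_sqr addr0 dotrVZl dotrVC dotrVZl mulrA.
by case: s1 => ->; rewrite ?mulrNN !mul1r.
Qed.

End hartley.

(** * Fatou's lemma as an upper bound for limits *)

Section fatou_real.
Context {dd : measure_display} {T : measurableType dd} {R : realType}.
Variable mu : {measure set T -> \bar R}.

Lemma fatou_le (f_ : nat -> T -> R) (f : T -> R) (M : \bar R) :
  (forall n, measurable_fun setT (f_ n)) -> (forall n x, 0 <= f_ n x) ->
  (forall x, f_ ^~ x @ \oo --> f x) ->
  (forall n, (\int[mu]_x (f_ n x)%:E <= M)%E) ->
  (\int[mu]_x (f x)%:E <= M)%E.
Proof.
move=> mf f0 cf fM.
have := @fatou _ _ _ mu setT measurableT (fun n x => (f_ n x)%:E)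
  (fun n => (measurable_EFinP _ _).2 (mf n)) (fun n x _ => f0 n x).
have -> : (\int[mu]_x limn_einf (fun n => (f_ n x)%:E) = \int[mu]_x (f x)%:E)%E.
  apply: eq_integral => x _.
  have cE : (fun n => (f_ n x)%:E) @ \oo --> (f x)%:E.
    by apply: cvg_EFin; [exact: nearW|exact: cf].
  by rewrite is_cvg_limn_einfE; [exact/cvg_lim|apply/cvg_ex; exists (f x)%:E].
move=> /le_trans; apply.
rewrite limn_einf_lim; apply: lime_le.
  exact: is_cvg_einfs.
apply: nearW => n; apply: le_trans (fM n).
by apply: ereal_inf_lbound; exists n => //=.
Qed.

End fatou_real.

(** * Bounded kernels and self-adjointness *)

Section product_kernels.
Context {R : realType} {d : nat}.
Notation mu := (@lebesgue_rV R d).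
Notation V := 'rV[R]_d.
Implicit Types (f g h : V -> R) (K : V * V -> R).

Lemma measurable_Rintegral K : measurable_fun setT K ->
  measurable_fun setT (fun x => \int[mu]_y K (x, y)).
Proof.
move=> mK; have mE : measurable_fun setT (EFin \o K) by exact/measurable_EFinP.
have mp := measurable_fun_fubini_tonelli_F (m2 := mu) (EFin \o K)^\+%E
  (measurable_funepos mE) (fun x => funepos_ge0 _ x).
have mn := measurable_fun_fubini_tonelli_F (m2 := mu) (EFin \o K)^\-%E
  (measurable_funeneg mE) (fun x => funeneg_ge0 _ x).
have := emeasurable_funB mp mn => mpn.
have := measurableT_comp (fine_measurable measurableT) mpn.
congr measurable_fun; apply/funext => x; congr fine.
rewrite [RHS]integralE /fubini_F; congr (_ - _)%E.
  by apply: eq_integral => y _; rewrite !funeposE.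
by apply: eq_integral => y _; rewrite !funenegE.
Qed.

Lemma measurable_slice K x : measurable_fun setT K ->
  measurable_fun setT (fun y => K (x, y)).
Proof. by move=> mK; exact: (measurable_fun_pair2 x mK). Qed.

Lemma measurable_slice2 K y : measurable_fun setT K ->
  measurable_fun setT (fun x => K (x, y)).
Proof. by move=> mK; exact: (measurable_fun_pair1 y mK). Qed.

Lemma intg_kernel K C g x : measurable_fun setT K -> (forall z, `|K z| <= C) ->
  intg mu g -> intg mu (fun y => K (x, y) * g y).
Proof.
move=> mK KC; apply: intgMb; first exact: measurable_slice.
by move=> y; exact: KC.
Qed.

Lemma kernel_bound K C g x : measurable_fun setT K -> (forall z, `|K z| <= C) ->
  intg mu g -> `|\int[mu]_y (K (x, y) * g y)| <= C * \int[mu]_y `|g y|.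
Proof.
move=> mK KC gi; have Ki := intg_kernel x mK KC gi.
apply: le_trans (le_normr_Rintegral measurableT Ki) _.
rewrite -RintegralZl//; last exact: intg_norm.
apply: le_Rintegral => //; [exact: intg_norm|exact/intgZ/intg_norm|].
by move=> y _; rewrite normrM ler_wpM2r.
Qed.

Lemma measurable_kernel_Rintegral K g : measurable_fun setT K -> measurable_fun setT g ->
  measurable_fun setT (fun x => \int[mu]_y (K (x, y) * g y)).
Proof.
move=> mK mg; apply: (@measurable_Rintegral (fun z => K z * g z.2)).
apply: measurable_funM => //.
exact: (measurableT_comp mg measurable_snd).
Qed.

(** Boundedness of K makes f(x) K(x, y) g(y) integrable on the product, so Fubini applies. *)
Lemma kernel_swap K C f g : measurable_fun setT K -> (forall z, `|K z| <= C) ->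
  intg mu f -> intg mu g ->
  \int[mu]_x (f x * \int[mu]_y (K (x, y) * g y)) =
  \int[mu]_y (g y * \int[mu]_x (K (x, y) * f x)).
Proof.
move=> mK KC fi gi.
have mf := intg_measurable fi; have mg := intg_measurable gi.
pose F (z : V * V) := f z.1 * (K z * g z.2).
have mF : measurable_fun setT F.
  apply: measurable_funM; first exact: (measurableT_comp mf measurable_fst).
  apply: measurable_funM => //; exact: (measurableT_comp mg measurable_snd).
have C0 : 0 <= C by apply: le_trans (KC (0, 0)).
have Fi : ((mu \x mu)%E).-integrable setT (EFin \o F).
  apply/integrable12ltyP; first exact/measurable_EFinP.
  have gfin : (\int[mu]_y `|(g y)%:E| < +oo)%E by have /integrableP[] := gi.
  apply: (@le_lt_trans _ _ (\int[mu]_x ((C * fine (\int[mu]_y `|(g y)%:E|)%E) * `|f x|)%:E)%E).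
    apply: ge0_le_integral => //.
    - by move=> x _; exact: integral_ge0.
    - have mE : measurable_fun setT (fun z => `|(EFin \o F) z|)%E.
        by apply: measurableT_comp => //; exact/measurable_EFinP.
      exact: (measurable_fun_fubini_tonelli_F (m2 := mu) _ mE).
    - apply/measurable_EFinP; apply: measurable_funM => //; exact: measurableT_comp.
    move=> x _.
    apply: (@le_trans _ _ (\int[mu]_y ((C * `|f x|) * `|g y|)%:E)%E).
      apply: ge0_le_integral => //.
      - apply: measurableT_comp => //; apply/measurable_EFinP.
        exact: (measurable_slice x mF).
      - by apply/measurable_EFinP; apply: measurable_funM => //; exact: measurableT_comp.
      move=> y _; rewrite /= lee_fin /F/= !normrM.
      by rewrite mulrA mulrC [C * _]mulrC mulrC ler_wpM2r// ler_wpM2l.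
    rewrite ge0_integral_scale ?mulr_ge0//; last exact: measurableT_comp.
    rewrite -[X in (_ * X)%E]fineK; last by rewrite ge0_fin_numE// integral_ge0.
    by rewrite -EFinM lee_fin mulrAC.
  rewrite ge0_integral_scale ?mulr_ge0 ?fine_ge0 ?integral_ge0//; last exact: measurableT_comp.
  rewrite lte_mul_pinfty ?lee_fin ?mulr_ge0 ?fine_ge0 ?integral_ge0//.
  by have /integrableP[] := fi.
have := Fubini Fi.
have E1 : (\int[mu]_x \int[mu]_y (EFin \o F) (x, y) =
    \int[mu]_x (f x * \int[mu]_y (K (x, y) * g y))%:E)%E.
  apply: eq_integral => x _; have Ki := intg_kernel x mK KC gi.
  by rewrite -RintegralZl// EFin_Rintegral//; exact: intgZ.
have E2 : (\int[mu]_y \int[mu]_x (EFin \o F) (x, y) =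
    \int[mu]_y (g y * \int[mu]_x (K (x, y) * f x))%:E)%E.
  apply: eq_integral => y _.
  have Ki : intg mu (fun x => K (x, y) * f x).
    by apply: intgMb fi; [exact: measurable_slice2|move=> x; exact: KC].
  rewrite -RintegralZl// EFin_Rintegral; last exact: intgZ.
  by apply: eq_integral => x _; rewrite /F/= mulrCA mulrC -mulrA [g y * _]mulrC mulrA mulrC mulrA mulrAC.
by rewrite /Rintegral -E1 -E2 => ->.
Qed.

Lemma measurable_dotrV2 : measurable_fun setT (fun z : V * V => dotrV z.1 z.2).
Proof.
apply: measurable_sum => i; apply: measurable_funM.
  exact: (measurableT_comp (@measurable_coord R d i) measurable_fst).
exact: (measurableT_comp (@measurable_coord R d i) measurable_snd).
Qed.

Lemma measurable_cas2 : measurable_fun setT (fun z : V * V => cas (dotrV z.1 z.2)).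
Proof. exact: measurableT_comp measurable_cas measurable_dotrV2. Qed.

Lemma measurable_hartley h : measurable_fun setT h -> measurable_fun setT (hartley h).
Proof.
move=> mh; apply: measurable_funM => //.
exact: (measurable_kernel_Rintegral measurable_cas2 mh).
Qed.

(** The kernel cas(x.y) is bounded and symmetric. *)
Lemma hartley_adjoint f g : intg mu f -> intg mu g ->
  \int[mu]_x (f x * hartley g x) = \int[mu]_x (g x * hartley f x).
Proof.
move=> fi gi.
have H := kernel_swap measurable_cas2 (fun z => cas_le2 _) fi gi.
have E (u v : V -> R) : intg mu u -> intg mu v ->
    \int[mu]_x (u x * hartley v x) =
    @hartley_cst R d * \int[mu]_x (u x * \int[mu]_y (cas (dotrV x y) * v y)).
  move=> ui vi; rewrite -RintegralZl//; last first.
    have ci := intgMb (measurable_kernel_Rintegral measurable_cas2 (intg_measurable vi))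
      (fun x => kernel_bound x measurable_cas2 (fun z => cas_le2 _) vi) ui.
    by move: ci; congr (intg mu _); apply/funext => x; rewrite mulrC.
  by apply: eq_Rintegral => x _; rewrite /hartley mulrCA.
rewrite (E f g fi gi) (E g f gi fi) H; congr (_ * _).
apply: eq_Rintegral => x _; congr (_ * _).
by apply: eq_Rintegral => y _; rewrite dotrVC.
Qed.

End product_kernels.

(** * Gaussian regularization and the inversion formula *)

Section hartley_inversion.
Context {R : realType} {d : nat}.
Notation mu := (@lebesgue_rV R d).
Notation V := 'rV[R]_d.
Notation c0 := (@hartley_cst R d).
Implicit Types (f g h v : V -> R).

Lemma has_grad0_cst f : (forall k, has_grad f k (fun=> 0)) -> forall k, f k = f 0.
Proof.
move=> H k.
have hd (t : R) : is_derive t 1 (fun s : R => f (0 + s *: k)) ((fun=> 0) t).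
  have := is_derive_line (H (0 + t *: k)).
  by rewrite big1// => i _; rewrite mulr0.
have := le_MVT hd (M := 0) (b := 1).
rewrite scale0r scale1r !add0r mul0r => h.
apply/eqP; rewrite -subr_eq0 -normr_le0; apply: h => t _.
by rewrite normr0.
Qed.

Lemma dotrV0 (x : V) : dotrV 0 x = 0.
Proof. by rewrite /dotrV big1// => i _; rewrite mxE mul0r. Qed.

Lemma Rintegral_gauss (c : R) : 0 < c ->
  \int[mu]_x gauss_rV c x = (pi / c) `^ (d%:R / 2).
Proof. by move=> c0'; rewrite /Rintegral integral_gauss_rV. Qed.

Lemma hartley_gauss0 c : 0 < c ->
  hartley (gauss_rV c) (0 : V) = c0 * (pi / c) `^ (d%:R / 2).
Proof.
move=> cp; rewrite /hartley -(Rintegral_gauss cp); congr (_ * _).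
by apply: eq_Rintegral => x _; rewrite dotrV0 /cas cos0 sin0 addr0 mul1r.
Qed.

Lemma coord_gauss c i : 0 < c ->
  (fun x : V => x ord0 i * gauss_rV c x) =
  fun x => (- (2 * c)^-1) * pder i (gauss_rV c) x.
Proof.
move=> cp; apply/funext => x; rewrite /pder (gauss_rV_grad c x).2.
by field; rewrite gt_eqF.
Qed.

(* [H g_c] solves the same first-order system as the Gaussian [g_(1/4c)]. *)
Lemma hartley_gauss c (k : V) : 0 < c ->
  hartley (gauss_rV c) k = c0 * (pi / c) `^ (d%:R / 2) * gauss_rV (4 * c)^-1 k.
Proof.
move=> cp.
have sg := rschwartz_gauss (d := d) cp.
have Hg (k' : V) : has_grad (hartley (gauss_rV c)) k'
    (fun i => (- (2 * c)^-1) * k' ord0 i * hartley (gauss_rV c) k').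
  have := hartley_has_grad k' (rschwartz_measurable sg) (rschwartz_rapid sg).
  move=> /has_grad_eq; apply => i.
  rewrite coord_gauss// hartleyZ; last exact/intg_rschwartz/rschwartz_pder.
  by rewrite -hartley_pder// mulrA.
(* A Gaussian with negative parameter is the reciprocal of the expected one; its product with the
   transform has zero gradient, hence is constant. *)
have H (k' : V) := has_gradM (Hg k') (gauss_rV_grad (- (4 * c)^-1) k').
have E : hartley (gauss_rV c) k * gauss_rV (- (4 * c)^-1) k =
    c0 * (pi / c) `^ (d%:R / 2).
  have g01 : gauss_rV (- (4 * c)^-1) (0 : V) = 1.
    by rewrite /gauss_rV dotrV0 mulr0 oppr0 expR0.
  rewrite -(hartley_gauss0 cp) -[RHS]mulr1 -[X in _ = _ * X]g01.
  apply: (@has_grad0_cst (fun x => hartley (gauss_rV c) x * gauss_rV _ x)) => k'.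
  by apply: has_grad_eq (H k') _ => i; field; rewrite gt_eqF.
rewrite -E.
by rewrite -mulrA /gauss_rV -expRD mulNr opprK subrr expR0 mulr1.
Qed.

(** The inversion formula for a Gaussian at the origin. It makes [c0 * hartley (gauss_rV c)] a
    kernel of mass one, and is where the factor (2 pi)^(-d/2) is used. *)
Lemma hartley_gauss_norm c : 0 < c ->
  c0 * \int[mu]_z hartley (gauss_rV c) z = 1.
Proof.
move=> cp; have c4 : 0 < (4 * c)^-1 by rewrite invr_gt0 mulr_gt0.
have -> : \int[mu]_z hartley (gauss_rV c) z =
    c0 * (pi / c) `^ (d%:R / 2) * \int[mu]_z gauss_rV (4 * c)^-1 z.
  rewrite -RintegralZl//; last exact/intg_rschwartz/rschwartz_gauss.
  by apply: eq_Rintegral => z _; rewrite hartley_gauss.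
rewrite Rintegral_gauss// -mulrA -powRM ?divr_ge0 ?pi_ge0 ?(ltW cp) ?(ltW c4)//.
rewrite (_ : pi / c * _ = (2 * pi) * (2 * pi)); last first.
  by field; rewrite gt_eqF.
rewrite powRM ?mulr_ge0 ?pi_ge0// /hartley_cst powRN.
have p0 : 0 < ((2 * pi) `^ (d%:R / 2) : R) by rewrite powR_gt0// mulr_gt0 ?pi_gt0.
by field; rewrite gt_eqF.
Qed.

(** For a = y.k and b = x.k the two sine terms are odd in k and vanish against a Gaussian. What
    remains depends only on x - y, which is what makes the regularized transform a convolution. *)
Lemma casM (a b : R) : cas a * cas b = cas (b - a) + (sin (a + b) + sin (a - b)).
Proof. by rewrite /cas cosB !sinB sinD; ring. Qed.

Lemma Rintegral_odd f : (forall x, f (- x) = - f x) -> intg mu f ->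
  \int[mu]_x f x = 0.
Proof.
move=> fo fi; have := Rintegral_opp fi.
under eq_Rintegral do rewrite fo -mulN1r.
rewrite RintegralZl// mulN1r => h; lra.
Qed.

Lemma gauss_rV_opp c (x : V) : gauss_rV c (- x) = gauss_rV c x.
Proof. by rewrite /gauss_rV dotrVNl dotrVC dotrVNl opprK. Qed.

Lemma intg_gauss c : 0 < c -> intg mu (gauss_rV c).
Proof. by move=> ?; exact/intg_rschwartz/rschwartz_gauss. Qed.

Lemma hartley_cas_gauss c (x y : V) : 0 < c ->
  hartley (fun k => cas (dotrV x k) * gauss_rV c k) y =
  hartley (gauss_rV c) (x - y).
Proof.
move=> cp; have gi := intg_gauss cp.
have si z : intg mu (fun k => sin (dotrV z k) * gauss_rV c k).
  apply: (@intgMb _ _ _ _ _ _ 1) gi; last first.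
    by move=> k; rewrite ler_norml sin_geN1 sin_le1.
  have ms : measurable_fun setT (@sin R).
    by apply: continuous_measurable_fun; exact: continuous_sin.
  apply: (measurableT_comp ms).
  rewrite (_ : dotrV z = fun x => dotrV x z); first exact: measurable_dotrV.
  by apply/funext => u; rewrite dotrVC.
have s0 z : \int[mu]_k (sin (dotrV z k) * gauss_rV c k) = 0.
  apply: Rintegral_odd => // k.
  by rewrite gauss_rV_opp dotrVC dotrVNl dotrVC sinN mulNr.
rewrite /hartley; congr (_ * _).
transitivity (\int[mu]_k (cas (dotrV (x - y) k) * gauss_rV c k +
   (sin (dotrV (y + x) k) * gauss_rV c k + sin (dotrV (y - x) k) * gauss_rV c k))).
  apply: eq_Rintegral => k _; rewrite mulrA casM !dotrVDl !dotrVNl.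
  ring.
rewrite RintegralD; [|by []|exact: intg_cas|exact: intgD].
by rewrite RintegralD// !s0 !addr0.
Qed.

(** Self-adjointness moves the inner transform onto cas(x.k) times the Gaussian, whose own transform
    is a translate of that of the Gaussian. *)
Lemma hartley_regularize f c x : 0 < c -> intg mu f ->
  hartley (fun k => hartley f k * gauss_rV c k) x =
  c0 * \int[mu]_y (f y * hartley (gauss_rV c) (x - y)).
Proof.
move=> cp fi; have gi := intg_gauss cp.
have cgi : intg mu (fun k => cas (dotrV x k) * gauss_rV c k) by exact: intg_cas.
have := hartley_adjoint fi cgi.
under eq_Rintegral do rewrite hartley_cas_gauss//.
move=> ->; congr (_ * _); apply: eq_Rintegral => k _.
by rewrite mulrCA mulrC.
Qed.

Lemma hartley_gauss_ge0 c (k : V) : 0 < c -> 0 <= hartley (gauss_rV c) k.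
Proof.
by move=> cp; rewrite hartley_gauss// !mulr_ge0 ?powR_ge0 ?expR_ge0// ltW ?hartley_cst_gt0.
Qed.

Lemma gauss_rVZ c l (x : V) : gauss_rV c (l *: x) = gauss_rV (c * l ^+ 2) x.
Proof. by rewrite /gauss_rV dotrVZl dotrVC dotrVZl !mulrA. Qed.

Lemma cvg_gauss_rV_harmonic (x : V) :
  (fun n => gauss_rV (n.+1%:R^-1) x) @ \oo --> (1 : R).
Proof.
rewrite -[X in _ --> X]expR0; apply: continuous_cvg; first exact: continuous_expR.
rewrite -[X in _ --> X]oppr0; apply: cvgN.
rewrite -[X in _ --> X](mul0r (dotrV x x)); apply: cvgMl.
exact: cvg_harmonic.
Qed.

Lemma gauss_rV_le1 c (x : V) : 0 < c -> gauss_rV c x <= 1.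
Proof.
by move=> cp; rewrite -expR0 ler_expR oppr_le0 mulr_ge0 ?dotrVxx_ge0 ?(ltW cp).
Qed.

(* With [4 c = e^2], substituting [y = x - e w]. *)
Lemma hartley_regularize_scaled f (e : R) (x : V) : 0 < e -> intg mu f ->
  (\int[mu]_w gauss_rV 1 w) * hartley (fun k => hartley f k * gauss_rV (e ^+ 2 / 4) k) x =
  \int[mu]_w (f (x - e *: w) * gauss_rV 1 w).
Proof.
move=> e0 fi; have cp : 0 < e ^+ 2 / 4 by rewrite divr_gt0// exprn_gt0.
pose g := gauss_rV (e ^+ 2 / 4) : V -> R.
have gE (w : V) : hartley g (e *: w) = hartley g 0 * gauss_rV 1 w.
  rewrite !hartley_gauss// gauss_rVZ -!mulrA; congr (_ * (_ * _)).
  rewrite (_ : (_ * _)^-1 * _ = 1); last by field; rewrite gt_eqF.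
  by rewrite [gauss_rV _ 0]/gauss_rV dotrV0 mulr0 oppr0 expR0 mul1r.
have gi : intg mu (hartley g) by exact/intg_rschwartz/rschwartz_hartley/rschwartz_gauss.
have e0' : e != 0 by rewrite gt_eqF.
rewrite hartley_regularize//.
have bd (z : V) : `|hartley g z| <= c0 * (2 * \int[mu]_x `|g x|).
  exact/hartley_le/intg_gauss.
have mg : measurable_fun setT (hartley g) by exact: intg_measurable gi.
have fgi : intg mu (fun z => f (x - z) * hartley g z).
  have := intgMb mg bd (intg_reflect x fi); congr (intg mu _).
  by apply/funext => z; rewrite mulrC.
have -> : \int[mu]_y (f y * hartley g (x - y)) = \int[mu]_z (f (x - z) * hartley g z).
  rewrite -(Rintegral_reflect x fgi); apply: eq_Rintegral => y _.
  by rewrite opprB addrCA subrr addr0.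
have N : `|e| ^- d * (c0 * \int[mu]_z hartley g z) = c0 * (hartley g 0 * \int[mu]_w gauss_rV 1 w).
  rewrite mulrCA; congr (_ * _); rewrite -(Rintegral_affine 0 e0' gi).
  rewrite -RintegralZl//; last exact: intg_gauss.
  by apply: eq_Rintegral => w _; rewrite addr0 gE.
have A0 : hartley g 0 != 0.
  by rewrite hartley_gauss0// gt_eqF// mulr_gt0 ?hartley_cst_gt0// powR_gt0// divr_gt0// pi_gt0.
have fE (w : V) : f (x - e *: w) * gauss_rV 1 w =
    (hartley g 0)^-1 * (f (x - (e *: w + 0)) * hartley g (e *: w + 0)).
  by rewrite addr0 gE; field.
rewrite hartley_gauss_norm// mulr1 in N.
under [RHS]eq_Rintegral do rewrite fE.
rewrite RintegralZl//; last exact: (intg_affine 0 e0' fgi).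
by rewrite (Rintegral_affine 0 e0' fgi) N; field.
Qed.

(** The scaled identity is passed to the limit e -> 0 on both sides: on the frequency side
    domination comes from the integrability of H f, on the space side from the bound M, and
    continuity of f gives the pointwise limit. *)
Lemma hartley_inversion f (M : R) : continuous f -> (forall x, `|f x| <= M) ->
  intg mu f -> intg mu (hartley f) -> forall x, hartley (hartley f) x = f x.
Proof.
move=> cf fM fi Hi x.
have g1 : 0 < 1 :> R by [].
have I0 : 0 < \int[mu]_w gauss_rV 1 (w : V).
  by rewrite Rintegral_gauss// powR_gt0// divr_gt0// pi_gt0.
pose e n : R := n.+1%:R^-1.
have e0 n : 0 < e n by rewrite invr_gt0.
have ecv : e @ \oo --> (0 : R) := @cvg_harmonic R.
have mf : measurable_fun setT f := intg_measurable fi.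
have gcv (k : V) : (fun n => gauss_rV (e n ^+ 2 / 4) k) @ \oo --> (1 : R).
  rewrite -[X in _ --> X](_ : gauss_rV (0 ^+ 2 / 4) k = 1); last first.
    by rewrite /gauss_rV expr0n/= !mul0r oppr0 expR0.
  apply: continuous_cvg; first exact: continuous_expR.
  apply: cvgN; apply: cvgMl; apply: cvgMl.
  by rewrite expr2; under eq_fun do rewrite expr2; exact: cvgM.
have [_ L] : intg mu (fun k => cas (dotrV x k) * hartley f k) /\
    (fun n => \int[mu]_k (cas (dotrV x k) * (hartley f k * gauss_rV (e n ^+ 2 / 4) k))) @ \oo
      --> \int[mu]_k (cas (dotrV x k) * hartley f k).
  apply: (@dominated_cvg_Rintegral _ _ _ mu _ _ (fun k => 2 * `|hartley f k|)).
  - move=> n; apply: measurable_funM; first exact: measurable_cas_dotrV.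
    apply: measurable_funM; first exact: measurable_hartley.
    by apply: rschwartz_measurable; apply: rschwartz_gauss; rewrite divr_gt0// exprn_gt0.
  - by apply: measurable_funM; [exact: measurable_cas_dotrV|exact: measurable_hartley].
  - move=> k; rewrite -[X in _ --> X]mulr1 -mulrA; apply: cvgMr; apply: cvgMr.
    exact: gcv.
  - move=> n k; rewrite !normrM ler_pM ?cas_le2// ler_piMr//.
    by rewrite ger0_norm ?expR_ge0// gauss_rV_le1// divr_gt0// exprn_gt0.
  - exact/intgZ/intg_norm.
have [_ L'] : intg mu (fun w => f x * gauss_rV 1 w) /\
    (fun n => \int[mu]_w (f (x - e n *: w) * gauss_rV 1 w)) @ \oo
      --> \int[mu]_w (f x * gauss_rV 1 w).
  apply: (@dominated_cvg_Rintegral _ _ _ mu _ _ (fun k => M * gauss_rV 1 k)).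
  - move=> n; apply: measurable_funM; last exact: measurable_gauss_rV.
    have := measurableT_comp mf (@measurable_affine_rV R d (- e n) x).
    by congr measurable_fun; apply/funext => w; rewrite /= scaleNr addrC.
  - by apply: measurable_funM => //; exact: measurable_gauss_rV.
  - move=> w; apply: cvgMl; apply: continuous_cvg; first exact: cf.
    rewrite -[X in _ --> X](_ : x - 0 *: w = x); last by rewrite scale0r subr0.
    by apply: cvgB; [exact: cvg_cst|apply: cvgZl].
  - by move=> n w; rewrite normrM [X in _ * X]ger0_norm ?expR_ge0// ler_wpM2r ?expR_ge0.
  - exact/intgZ/intg_gauss.
have E n : (\int[mu]_w gauss_rV 1 w) * (c0 *
      \int[mu]_k (cas (dotrV x k) * (hartley f k * gauss_rV (e n ^+ 2 / 4) k))) =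
    \int[mu]_w (f (x - e n *: w) * gauss_rV 1 w).
  exact: hartley_regularize_scaled.
have L2 : (fun n => \int[mu]_w (f (x - e n *: w) * gauss_rV 1 w)) @ \oo -->
    (\int[mu]_w gauss_rV 1 w) * hartley (hartley f) x.
  under eq_fun do rewrite -E.
  by apply: cvgMr; apply: cvgMr; exact: L.
have : (\int[mu]_w gauss_rV 1 w) * hartley (hartley f) x =
    \int[mu]_w (f x * gauss_rV 1 w) by exact: cvg_unique L2 L'.
rewrite RintegralZl//; last exact: intg_gauss.
by rewrite mulrC; apply: mulIf; rewrite gt_eqF.
Qed.

Lemma hartleyK h : rschwartz h -> hartley (hartley h) =1 h.
Proof.
move=> sh; have [M hM] := rschwartz_bounded sh.
apply: hartley_inversion hM _ _; first exact: rschwartz_continuous.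
  exact: intg_rschwartz.
exact/intg_rschwartz/rschwartz_hartley.
Qed.

End hartley_inversion.

(** * Square-integrable functions *)

Section square_integrable.
Context {dd : measure_display} {T : measurableType dd} {R : realType}.
Variable mu : {measure set T -> \bar R}.
Implicit Types u v w : T -> R.

Definition sq_intg u := measurable_fun setT u /\ intg mu (fun x => u x ^+ 2).

Definition sqnorm u := \int[mu]_x u x ^+ 2.

Lemma sqnorm_ge0 u : 0 <= sqnorm u.
Proof. by apply: Rintegral_ge0 => x _; exact: sqr_ge0. Qed.

Lemma sq_intgZ c u : sq_intg u -> sq_intg (fun x => c * u x).
Proof.
move=> [mu0 ui]; split; first exact: measurable_funM.
have := intgZ (c ^+ 2) ui; congr (intg mu _).
by apply/funext => x; rewrite exprMn.
Qed.

Lemma sq_intgD u v : sq_intg u -> sq_intg v -> sq_intg (fun x => u x + v x).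
Proof.
by move=> [mu0 ui] [mv vi]; split; [exact: measurable_funD|exact: intgD_sq].
Qed.

Lemma sq_intgB u v : sq_intg u -> sq_intg v -> sq_intg (fun x => u x - v x).
Proof.
move=> su sv; have := sq_intgD su (sq_intgZ (-1) sv).
by congr sq_intg; apply/funext => x; rewrite mulN1r.
Qed.

Lemma sq_intgM u v : sq_intg u -> sq_intg v -> intg mu (fun x => u x * v x).
Proof. by move=> [? ?] [? ?]; exact: intgM_sq. Qed.

Lemma sq_intgMb (h u : T -> R) C : measurable_fun setT h -> (forall x, `|h x| <= C) ->
  sq_intg u -> sq_intg (fun x => h x * u x).
Proof.
move=> mh hC [mu0 ui]; split; first exact: measurable_funM.
have := @intgMb _ _ _ mu (fun x => u x ^+ 2) (fun x => h x ^+ 2) (C ^+ 2).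
have -> : (fun x => h x ^+ 2 * u x ^+ 2) = fun x => (h x * u x) ^+ 2.
  by apply/funext => x; rewrite exprMn.
apply => //; first exact: measurable_funX.
move=> x; rewrite normrX lerXn2r ?nnegrE//.
exact: le_trans (hC x).
Qed.

Lemma sqnormZ c u : sq_intg u -> sqnorm (fun x => c * u x) = c ^+ 2 * sqnorm u.
Proof.
move=> [_ ui]; rewrite /sqnorm -RintegralZl//.
by apply: eq_Rintegral => x _; rewrite exprMn.
Qed.

Lemma sqnormD u v : sq_intg u -> sq_intg v ->
  sqnorm (fun x => u x + v x) = sqnorm u + sqnorm v + 2 * \int[mu]_x (u x * v x).
Proof.
move=> su sv; have ui := su.2; have vi := sv.2; have uvi := sq_intgM su sv.
rewrite /sqnorm -RintegralZl// -RintegralD// -RintegralD//.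
- by apply: eq_Rintegral => x _; ring.
- exact: intgD.
- exact: intgZ.
Qed.

Lemma sqnormD_le u v : sq_intg u -> sq_intg v ->
  sqnorm (fun x => u x + v x) <= 2 * (sqnorm u + sqnorm v).
Proof.
move=> su sv.
have := sqnorm_ge0 (fun x => u x + (-1) * v x).
rewrite sqnormD//; last exact: sq_intgZ.
rewrite sqnormD// sqnormZ// => h.
have E : \int[mu]_x (u x * ((-1) * v x)) = - \int[mu]_x (u x * v x).
  rewrite -[RHS]mulN1r -RintegralZl//; last exact: sq_intgM.
  by apply: eq_Rintegral => x _; ring.
rewrite E in h; lra.
Qed.

(** The polynomial t |-> |u + t v|^2 is nonnegative. For B > 0 it is evaluated at its minimum -D/B;
    for B = 0 it is affine with slope 2D, and t = -(A+1)/(2D) would give the value -1. *)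
Lemma cauchy_schwarz u v : sq_intg u -> sq_intg v ->
  (\int[mu]_x (u x * v x)) ^+ 2 <= sqnorm u * sqnorm v.
Proof.
move=> su sv.
have H t : 0 <= sqnorm u + t ^+ 2 * sqnorm v + 2 * (t * \int[mu]_x (u x * v x)).
  have := sqnorm_ge0 (fun x => u x + t * v x).
  rewrite sqnormD//; last exact: sq_intgZ.
  rewrite sqnormZ// (_ : \int[mu]_x (u x * (t * v x)) = t * \int[mu]_x (u x * v x))//.
  by rewrite -RintegralZl//; [apply: eq_Rintegral => x _; ring|exact: sq_intgM].
move: H; set D := \int[mu]_x _; set A := sqnorm u; set B := sqnorm v => H.
have A0 : 0 <= A := sqnorm_ge0 u.
have : 0 <= B := sqnorm_ge0 v; rewrite le_eqVlt => /predU1P[B0|B0].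
  rewrite -B0 mulr0; have [->|D0] := eqVneq D 0; first by rewrite expr0n.
  have := H (- (A + 1) / (2 * D)); rewrite -B0 mulr0 addr0.
  rewrite (_ : 2 * _ = - (A + 1)); first by lra.
  by field.
have := H (- D / B); rewrite (_ : _ + _ = A - D ^+ 2 / B); last by field; rewrite gt_eqF.
by rewrite subr_ge0 ler_pdivrMr.
Qed.

Lemma sqnorm_eq0_ae u : sq_intg u -> sqnorm u = 0 -> {ae mu, forall x, u x = 0}.
Proof.
move=> [mu0 ui] u0.
have := Rintegral_eq0_ae ui (fun x => sqr_ge0 (u x)) u0.
by apply: filterS => x /eqP; rewrite sqrf_eq0 => /eqP.
Qed.

Lemma eq_sqnorm_ae u v : sq_intg u -> measurable_fun setT v ->
  {ae mu, forall x, u x = v x} -> sq_intg v /\ sqnorm v = sqnorm u.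
Proof.
move=> [mu0 ui] mv uv; split; last first.
  apply: ae_eq_Rintegral; try exact: measurable_funX.
  by apply: filterS uv => x ->.
split => //; apply/integrableP; split; first by apply/measurable_EFinP; exact: measurable_funX.
have /integrableP[_] := ui; congr (_ < _)%E; apply: ae_eq_integral => //.
- by apply: measurableT_comp => //; apply/measurable_EFinP; exact: measurable_funX.
- by apply: measurableT_comp => //; apply/measurable_EFinP; exact: measurable_funX.
- by apply: filterS uv => x /= -> _.
Qed.

Lemma EFin_sqnorm u : sq_intg u -> (sqnorm u)%:E = (\int[mu]_x (u x ^+ 2)%:E)%E.
Proof. by move=> [_ ui]; exact: EFin_Rintegral. Qed.

Lemma sq_intg_le u M : measurable_fun setT u ->
  (\int[mu]_x (u x ^+ 2)%:E <= M%:E)%E -> sq_intg u /\ sqnorm u <= M.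
Proof.
move=> mu0 uM; have ui : sq_intg u.
  split => //; apply: ge0_intg; first exact: measurable_funX.
    by move=> x; exact: sqr_ge0.
  exact: le_lt_trans uM (ltry _).
by split => //; rewrite -lee_fin EFin_sqnorm.
Qed.

Lemma cvg_sqr (f : nat -> R) (a : R) : f @ \oo --> a -> (fun n => f n ^+ 2) @ \oo --> a ^+ 2.
Proof. by move=> fa; under eq_fun do rewrite expr2; rewrite expr2; exact: cvgM. Qed.

(* A rapidly Cauchy sequence converges almost everywhere; it is modified on a
   null set so as to converge everywhere. *)
Lemma sq_complete (u : nat -> T -> R) (C : R) :
  (forall n, sq_intg (u n)) ->
  (forall m n, (m <= n)%N -> sqnorm (fun x => u n x - u m x) <= C * 16 ^- m) ->
  exists w, [/\ sq_intg w,
    forall m, sqnorm (fun x => w x - u m x) <= C * 16 ^- m &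
    forall M, (forall n, sqnorm (u n) <= M) -> sqnorm w <= M].
Proof.
move=> su uC.
pose D n x := u n.+1 x - u n x.
have sD n : sq_intg (D n) by exact: sq_intgB.
(* The integral of the n-th squared increment is at most C 16^(-n), so the weights 4^n still leave a
   finite integral. Where S is finite, the n-th increment is at most sqrt(S) 2^(-n), which is
   summable. *)
pose S x := (\sum_(0 <= n <oo) (4 ^+ n * D n x ^+ 2)%:E)%E.
have mD n : measurable_fun setT (fun x => (4 ^+ n * D n x ^+ 2)%:E).
  by apply/measurable_EFinP; apply: measurable_funM => //; apply: measurable_funX; exact: (sD n).1.
have D0 n x : (0 <= (4 ^+ n * D n x ^+ 2)%:E)%E.
  by rewrite lee_fin mulr_ge0 ?sqr_ge0// exprn_ge0.
have mS : measurable_fun setT S.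
  exact: ge0_emeasurable_sum.
have Soo : (\int[mu]_x S x < +oo)%E.
  rewrite integral_nneseries//.
  apply: (@le_lt_trans _ _ (C * 4)%:E); last exact: ltry.
  apply: lime_le; first by apply: is_cvg_nneseries => n _ _; exact: integral_ge0.
  apply: nearW => n.
  have C0 : 0 <= C.
    have := uC 0%N 0%N (leqnn _); rewrite expr0 invr1 mulr1.
    exact: le_trans (sqnorm_ge0 _).
  have gs : \sum_(0 <= i < n) (4 ^- i : R) <= 4 - 2 * 4 ^- n.
    elim: n => [|n IH]; first by rewrite big_geq// expr0; lra.
    rewrite big_nat_recr//= exprS invfM.
    have : 0 < 4 ^- n :> R by rewrite invr_gt0 exprn_gt0.
    lra.
  apply: (@le_trans _ _ (\sum_(0 <= i < n) (C * 4 ^- i)%:E)%E).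
    apply: lee_sum => i _.
    rewrite ge0_integral_scale ?exprn_ge0//; first last.
    - by move=> x; exact: sqr_ge0.
    - by apply: measurable_funX; exact: (sD i).1.
    rewrite -(EFin_sqnorm (sD i)) -EFinM lee_fin.
    apply: le_trans (ler_wpM2l (exprn_ge0 i (ler0n R 4)) (uC i i.+1 (leqnSn i))) _.
    rewrite (_ : (16 : R) = 4 * 4); last by ring.
    have E4 : 4 ^+ i / 4 ^+ i = 1 :> R by rewrite divff// expf_neq0// pnatr_eq0.
    by rewrite exprMn invfM mulrCA ler_wpM2l// mulrA E4 mul1r.
  rewrite sumEFin lee_fin -mulr_sumr ler_wpM2l//.
  have : 0 < 4 ^- n :> R by rewrite invr_gt0 exprn_gt0.
  lra.
pose A : set T := [set x | S x \is a fin_num].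
have mA : measurable A.
  by rewrite -[X in measurable X]setTI; exact: emeasurable_fin_num.
have aeA : {ae mu, forall x, A x}.
  have Si : mu.-integrable setT S.
    apply/integrableP; split => //.
    under eq_integral do rewrite gee0_abs ?nneseries_ge0//.
    by [].
  by apply: filterS (integrable_ae measurableT Si) => x; apply.
pose u' n x := \1_A x * u n x.
have u'E n x : A x -> u' n x = u n x by move=> Ax; rewrite /u' indicE mem_set// mul1r.
have mu' n : measurable_fun setT (u' n).
  by apply: measurable_funM; [exact: measurable_indic|exact: (su n).1].
have cu' x : cvgn (u' ^~ x).
  have [Ax|nAx] := pselect (A x); last first.
    rewrite (_ : u' ^~ x = fun=> 0); first exact: is_cvg_cst.
    by apply/funext => n; rewrite /u' indicE memNset// mul0r.
  rewrite (_ : u' ^~ x = u ^~ x); last by apply/funext => n; exact: u'E.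
  rewrite (_ : u ^~ x = fun n => u 0%N x + series (telescope (u ^~ x)) n); last first.
    by apply/funext => n; rewrite -eq_sum_telescope.
  apply: is_cvgD; first exact: is_cvg_cst.
  apply: normed_cvg.
  have s0 : 0 <= fine (S x) by rewrite fine_ge0// nneseries_ge0.
  apply: (@series_le_cvg _ _ (geometric (Num.sqrt (fine (S x))) 2^-1)).
  - by move=> n; exact: normr_ge0.
  - by move=> n; rewrite /geometric/= mulr_ge0 ?sqrtr_ge0// exprn_ge0.
  - move=> n; rewrite /geometric/= /telescope -/(D n x).
    have : 4 ^+ n * D n x ^+ 2 <= fine (S x).
      rewrite -lee_fin fineK//.
      have := @nneseries_lim_ge _ (fun n => (4 ^+ n * D n x ^+ 2)%:E) xpredT 0 n.+1 (fun n _ _ => D0 n x).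
      apply: le_trans; rewrite big_nat_recr//= leeDr// sume_ge0//.
    rewrite mulrC -ler_pdivlMr ?exprn_gt0// => h.
    rewrite -sqrtr_sqr -[X in _ <= _ * X]ger0_norm ?exprn_ge0// -sqrtr_sqr.
    rewrite -sqrtrM// ler_sqrt ?mulr_ge0 ?sqr_ge0//.
    rewrite (_ : (2^-1 ^+ n) ^+ 2 = 4 ^- n)//.
    by rewrite exprAC !exprVn (_ : 2 ^+ 2 = 4 :> R)//; ring.
  - by apply: is_cvg_geometric_series; rewrite ger0_norm// invf_lt1// ltr1n.
pose w x := limn (u' ^~ x).
have cw x : u' ^~ x @ \oo --> w x := cu' x.
have mw : measurable_fun setT w.
  by apply: measurable_fun_cvg mu' _ => x _; exact: cw.
have H m : sq_intg (fun x => w x - u' m x) /\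
    sqnorm (fun x => w x - u' m x) <= C * 16 ^- m.
  apply: sq_intg_le; first exact: measurable_funB.
  (* Fatou along the shifted sequence turns the Cauchy bound into a bound on the distance to the
     limit. *)
  apply: (@fatou_le _ _ _ mu (fun k x => (u' (k + m)%N x - u' m x) ^+ 2)).
  - by move=> k; apply: measurable_funX; exact: measurable_funB.
  - by move=> k x; exact: sqr_ge0.
  - move=> x; have c1 : (fun k => u' (k + m)%N x) @ \oo --> w x.
      by rewrite (cvg_shiftn m (u' ^~ x)); exact: cw.
    apply: (@cvg_sqr (fun k => u' (k + m)%N x - u' m x)).
    by apply: cvgB => //; exact: cvg_cst.
  move=> k.
  have [sq' nE] := @eq_sqnorm_ae (fun x => u (k + m)%N x - u m x)
    (fun x => u' (k + m)%N x - u' m x) (sq_intgB (su _) (su _))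
    (measurable_funB (mu' _) (mu' _))
    (filterS (fun x Ax => congr2 (fun a b => a - b) (esym (u'E _ x Ax)) (esym (u'E _ x Ax))) aeA).
  by rewrite -EFin_sqnorm// lee_fin nE uC// leq_addl.
have su' m : sq_intg (u' m).
  apply: sq_intgMb (su m); first exact: measurable_indic.
  by move=> x; rewrite indicE; case: (_ \in _); rewrite ?normr1 ?normr0.
exists w; split.
- have := sq_intgD (H 0%N).1 (su' 0%N); congr sq_intg.
  by apply/funext => x; rewrite subrK.
- move=> m; have [_ ->] := @eq_sqnorm_ae (fun x => w x - u' m x)
    (fun x => w x - u m x) (H m).1 (measurable_funB mw (su m).1)
    (filterS (fun x Ax => congr1 (fun a => w x - a) (u'E _ x Ax)) aeA).
  exact: (H m).2.
- move=> M uM.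
  apply: (sq_intg_le mw _).2.
  apply: (@fatou_le _ _ _ mu (fun k x => u' k x ^+ 2)).
  - by move=> k; exact: measurable_funX.
  - by move=> k x; exact: sqr_ge0.
  - by move=> x; apply: (@cvg_sqr (u' ^~ x)); exact: cw.
  move=> k; have [sk nk] := @eq_sqnorm_ae (u k) (u' k) (su k) (mu' k)
    (filterS (fun x Ax => esym (u'E _ x Ax)) aeA).
  by rewrite -EFin_sqnorm// lee_fin nk uM.
Qed.

End square_integrable.

(** * Extension of the Hartley transform to L^2 *)

Section hartley_L2.
Context {R : realType} {d : nat}.
Notation mu := (@lebesgue_rV R d).
Notation V := 'rV[R]_d.
Notation c0 := (@hartley_cst R d).
Implicit Types (f g h v u w p : V -> R).

Lemma measurable_subrV : measurable_fun setT (fun z : V * V => z.1 - z.2).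
Proof.
apply: measurable_rV => i.
rewrite (_ : _ \o _ = fun z : V * V => Defs.coord i z.1 - Defs.coord i z.2); last first.
  by apply/funext => z; rewrite /Defs.coord/= !mxE.
apply: measurable_funB.
  exact: (measurableT_comp (@measurable_coord R d i) measurable_fst).
exact: (measurableT_comp (@measurable_coord R d i) measurable_snd).
Qed.

(** Tonelli gives the mass of the convolution; the bound C on k makes the inner integral finite at
    every point. *)
Lemma convolution_ge0 (k w : V -> R) C : intg mu k -> (forall x, 0 <= k x <= C) ->
  intg mu w -> (forall x, 0 <= w x) ->
  intg mu (fun x : V => \int[mu]_y (k (x - y) * w y)) /\
  Rintegral mu setT (fun x : V => \int[mu]_y (k (x - y) * w y)) = (\int[mu]_x k x) * \int[mu]_x w x.
Proof.
move=> ki k0 wi w0.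
have mk := intg_measurable ki; have mw := intg_measurable wi.
have mK : measurable_fun setT (fun z : V * V => k (z.1 - z.2)).
  exact: (measurableT_comp mk measurable_subrV).
have KC (z : V * V) : `|k (z.1 - z.2)| <= C.
  by have /andP[h1 h2] := k0 (z.1 - z.2); rewrite ger0_norm.
pose F (z : V * V) := (k (z.1 - z.2) * w z.2)%:E.
have mF : measurable_fun setT F.
  apply/measurable_EFinP; apply: measurable_funM => //.
  exact: (measurableT_comp mw measurable_snd).
have F0 z : (0 <= F z)%E.
  by rewrite lee_fin mulr_ge0//; have /andP[] := k0 (z.1 - z.2).
have E1 x : (\int[mu]_y F (x, y))%E = (\int[mu]_y (k (x - y) * w y))%:E.
  by rewrite EFin_Rintegral//; exact: (intg_kernel x mK KC wi).
have ks y : intg mu (fun x => k (x - y)).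
  exact: (intg_translate (- y) ki).
have E2 y : (\int[mu]_x F (x, y))%E = ((\int[mu]_x k x) * w y)%:E.
  rewrite -(Rintegral_translate (- y) ki) mulrC -RintegralZl; [|by []|exact: ks].
  rewrite EFin_Rintegral; last exact: intgZ.
  by apply: eq_integral => x _; rewrite /F/= mulrC.
have E : (\int[mu]_x (\int[mu]_y (k (x - y) * w y))%:E = ((\int[mu]_x k x) * \int[mu]_x w x)%:E)%E.
  transitivity (\int[mu]_x \int[mu]_y F (x, y))%E.
    by apply: eq_integral => x _; rewrite E1.
  rewrite fubini_tonelli//.
  rewrite -RintegralZl// EFin_Rintegral; last exact: intgZ.
  by apply: eq_integral => y _; exact: E2.
have G0 x : 0 <= \int[mu]_y (k (x - y) * w y).
  by apply: Rintegral_ge0 => y _; rewrite mulr_ge0//; have /andP[] := k0 (x - y).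
split; last by rewrite [LHS]/Rintegral E.
apply: ge0_intg => //; last by rewrite E ltry.
exact: (measurable_kernel_Rintegral mK mw).
Qed.

Lemma hartley_gauss_bound c : 0 < c -> exists C, forall z : V, 0 <= hartley (gauss_rV c) z <= C.
Proof.
move=> c0'; have [C HC] := rschwartz_bounded (rschwartz_hartley (@rschwartz_gauss R d c c0')).
exists C => z; rewrite hartley_gauss_ge0//=.
exact: le_trans (ler_norm _) (HC z).
Qed.

(** By self-adjointness and regularization, the integral of |H v|^2 against a Gaussian is the double
    integral of v(x) k(x-y) v(y), with k nonnegative of mass one. As v(x) v(y) <= (v(x)^2 +
    v(y)^2)/2, it is at most |v|^2, and Fatou removes the Gaussian. *)
Lemma hartley_contraction v : intg mu v -> sq_intg mu v ->
  sq_intg mu (hartley v) /\ sqnorm mu (hartley v) <= sqnorm mu v.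
Proof.
move=> vi sv.
have mHv := measurable_hartley sv.1.
pose c n : R := (n.+1%:R)^-1.
have c_gt0 n : 0 < c n by rewrite invr_gt0 ltr0Sn.
apply: sq_intg_le => //.
apply: (@fatou_le _ _ _ mu (fun n x => hartley v x ^+ 2 * gauss_rV (c n) x)).
- move=> n; apply: measurable_funM; first exact: measurable_funX.
  exact: measurable_gauss_rV.
- by move=> n x; rewrite mulr_ge0 ?sqr_ge0// expR_ge0.
- move=> x; rewrite -[X in _ --> X]mulr1; apply: cvgMr.
  exact: cvg_gauss_rV_harmonic.
move=> n.
have Gi : intg mu (fun x => hartley v x * gauss_rV (c n) x).
  by apply: intgMb (intg_gauss _) => //; exact: (fun x => hartley_le x vi).
have G2i : intg mu (fun x => hartley v x ^+ 2 * gauss_rV (c n) x).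
  have := intgMb mHv (fun x => hartley_le x vi) Gi.
  by congr (intg mu _); apply/funext => x; rewrite mulrA expr2.
rewrite -EFin_Rintegral// lee_fin.
have -> : \int[mu]_x (hartley v x ^+ 2 * gauss_rV (c n) x) =
    \int[mu]_x (v x * hartley (fun k => hartley v k * gauss_rV (c n) k) x).
  rewrite hartley_adjoint//.
  by apply: eq_Rintegral => x _; rewrite expr2 mulrAC.
pose k (x : V) := c0 * hartley (gauss_rV (c n)) x.
have [C HC] := hartley_gauss_bound (c_gt0 n).
have ki : intg mu k by apply/intgZ/intg_rschwartz/rschwartz_hartley/rschwartz_gauss.
have k1 : \int[mu]_x k x = 1.
  rewrite RintegralZl//; first exact: hartley_gauss_norm.
  exact/intg_rschwartz/rschwartz_hartley/rschwartz_gauss.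
have kC x : 0 <= k x <= c0 * C.
  have /andP[h1 h2] := HC x.
  by rewrite mulr_ge0 ?(ltW (hartley_cst_gt0))//= ler_wpM2l// ltW// hartley_cst_gt0.
have [Ai AE] := convolution_ge0 ki kC sv.2 (fun x => sqr_ge0 (v x)).
have mK : measurable_fun setT (fun z : V * V => k (z.1 - z.2)).
  exact: (measurableT_comp (intg_measurable ki) measurable_subrV).
have KC (z : V * V) : `|k (z.1 - z.2)| <= c0 * C.
  by have /andP[h1 h2] := kC (z.1 - z.2); rewrite ger0_norm.
have kiv g x : intg mu g -> intg mu (fun y => k (x - y) * g y).
  by move=> gi; exact: (intg_kernel x mK KC gi).
have E x : v x * hartley (fun k => hartley v k * gauss_rV (c n) k) x =
    v x * \int[mu]_y (k (x - y) * v y).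
  rewrite hartley_regularize//; congr (_ * _).
  rewrite -RintegralZl//; last first.
    have := kiv _ x vi => /(intgZ (c0^-1)).
    congr (intg mu _); apply/funext => y; rewrite /k.
    by field; rewrite gt_eqF// hartley_cst_gt0.
  by apply: eq_Rintegral => y _; rewrite /k mulrA mulrAC.
under eq_Rintegral do rewrite E.
have kx x : intg mu (fun y => k (x - y)) by have := intg_reflect x ki.
have kx1 x : \int[mu]_y k (x - y) = 1 by rewrite (Rintegral_reflect x ki).
apply: (@le_trans _ _ (\int[mu]_x (2^-1 * (v x ^+ 2 + \int[mu]_y (k (x - y) * v y ^+ 2))))); last first.
  rewrite RintegralZl//; last exact: intgD sv.2 Ai.
  rewrite RintegralD//; last exact: sv.2.
  rewrite AE k1 /sqnorm; lra.
apply: le_Rintegral => //.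
- have := intgMb (measurable_kernel_Rintegral mK sv.1) (fun x => kernel_bound x mK KC vi) vi.
  by congr (intg mu _); apply/funext => x; rewrite mulrC.
- by apply: intgZ; exact: intgD sv.2 Ai.
move=> x _.
have -> : v x ^+ 2 = \int[mu]_y (v x ^+ 2 * k (x - y)).
  by rewrite RintegralZl// kx1 mulr1.
rewrite -RintegralD//; [|exact: intgZ|exact: kiv sv.2].
rewrite -!RintegralZl//; [|by apply: intgD; [exact: intgZ|exact: kiv sv.2]|exact: kiv].
apply: le_Rintegral => //.
- by apply/intgZ/kiv.
- by apply/intgZ/intgD; [exact: intgZ|exact: kiv sv.2].
move=> y _; have /andP[h1 h2] := kC (x - y).
have := mulr_ge0 h1 (sqr_ge0 (v x - v y)); rewrite sqrrB; nra.
Qed.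

Lemma geo16_eq0 (a K : R) : 0 <= a -> (forall m, a <= K * 16 ^- m) -> a = 0.
Proof.
move=> a0 aK; apply/eqP; rewrite eq_le a0 andbT.
have H : (fun m => K * 16 ^- m) @ \oo --> (0 : R).
  rewrite -[X in _ --> X](mulr0 K); apply: cvgMr.
  under eq_fun do rewrite -exprVn.
  by apply: cvg_expr; rewrite ger0_norm ?invr_ge0// invf_lt1// ltr1n.
rewrite -(cvg_lim (@Rhausdorff R) H); apply: limr_ge; first exact: cvgP H.
exact: nearW.
Qed.

Lemma sq_intg_rschwartz p : rschwartz p -> sq_intg mu p.
Proof.
move=> sp; split; first exact: rschwartz_measurable.
have [C HC] := rschwartz_bounded sp.
have := intgMb (rschwartz_measurable sp) HC (intg_rschwartz sp).
by congr (intg mu _); apply/funext => x; rewrite expr2.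
Qed.

(** Damping v by wide Gaussians gives functions that are both integrable and square-integrable and
    tend to v in L^2. The contraction property makes their transforms Cauchy, and Cauchy-Schwarz
    carries the pairing with p to the limit. *)
Lemma hartley_extension v : sq_intg mu v ->
  exists w, [/\ sq_intg mu w, sqnorm mu w <= sqnorm mu v &
    forall p, rschwartz p -> \int[mu]_x (w x * p x) = \int[mu]_x (v x * hartley p x)].
Proof.
move=> sv.
pose c n : R := (n.+1%:R)^-1.
have c_gt0 n : 0 < c n by rewrite invr_gt0 ltr0Sn.
have gle n (x : V) : `|gauss_rV (c n) x| <= 1.
  by rewrite ger0_norm ?expR_ge0// gauss_rV_le1.
pose z n x := gauss_rV (c n) x * v x.
have sz n : sq_intg mu (z n).
  by apply: sq_intgMb sv; [exact: measurable_gauss_rV|exact: gle].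
have zi n : intg mu (z n).
  by apply: sq_intgM => //; exact/sq_intg_rschwartz/rschwartz_gauss.
have zv : (fun n => sqnorm mu (fun x => v x - z n x)) @ \oo --> (0 : R).
  have -> : (0 : R) = \int[mu]_x (v x * 0) ^+ 2.
    rewrite /Rintegral integral0_eq// => x _; by rewrite mulr0 expr0n.
  apply: (proj2 (@dominated_cvg_Rintegral _ V R mu (fun n x => (v x - z n x) ^+ 2)
    (fun x => (v x * 0) ^+ 2) (fun x => v x ^+ 2) _ _ _ _ _)).
  - by move=> n; apply: measurable_funX; exact: (sq_intgB sv (sz n)).1.
  - by apply: measurable_funX; apply: measurable_funM => //; exact: sv.1.
  - move=> x; apply: (@cvg_sqr _ (fun n => v x - z n x)).
    rewrite mulr0 -[X in _ --> X](subrr (v x)); apply: cvgB; first exact: cvg_cst.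
    rewrite -[X in _ --> X]mul1r; apply: cvgMl.
    exact: cvg_gauss_rV_harmonic.
  - move=> n x; rewrite ger0_norm ?sqr_ge0// /z -{1}[v x]mul1r -mulrBl exprMn.
    rewrite -[leRHS]mul1r ler_wpM2r ?sqr_ge0// exprn_ile1 ?subr_ge0 ?gauss_rV_le1//.
    by rewrite lerBlDr lerDl expR_ge0.
  - exact: sv.2.
have [N HN] : exists N : nat -> nat, forall j,
    sqnorm mu (fun x => v x - z (N j) x) <= 16 ^- j.
  suff /boolp.choice[N HN] : forall j, exists k, sqnorm mu (fun x => v x - z k x) <= 16 ^- j.
    by exists N.
  move=> j.
  have j0 : 0 < 16 ^- j :> R by rewrite invr_gt0 exprn_gt0.
  have /cvgrPdist_le/(_ _ j0)[n _ Hn] := zv.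
  exists n; have := Hn n (leqnn n).
  by rewrite sub0r normrN ger0_norm// sqnorm_ge0.
pose u j := hartley (z (N j)).
have su j : sq_intg mu (u j) by have [] := hartley_contraction (zi (N j)) (sz (N j)).
(* The constant 4 arises from 2 (16^(-n) + 16^(-m)) <= 4 * 16^(-m) for m <= n. *)
have [||w [sw wu wM]] := @sq_complete _ _ _ mu u 4; first exact: su.
  move=> m n mn.
  have -> : (fun x => u n x - u m x) = hartley (fun x => z (N n) x - z (N m) x).
    by apply/funext => x; rewrite hartleyB.
  have [_] := hartley_contraction (intgB (zi (N n)) (zi (N m))) (sq_intgB (sz (N n)) (sz (N m))).
  move=> /le_trans; apply.
  have -> : (fun x => z (N n) x - z (N m) x) =
      fun x => (-1) * (v x - z (N n) x) + (v x - z (N m) x).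
    by apply/funext => x; ring.
  have s1 := sq_intgB sv (sz (N n)); have s2 := sq_intgB sv (sz (N m)).
  apply: le_trans (sqnormD_le (sq_intgZ (-1) s1) s2) _.
  rewrite sqnormZ// sqrrN expr1n mul1r.
  have h1 := HN n; have h2 := HN m.
  have h3 : 16 ^- n <= 16 ^- m :> R.
    by rewrite lef_pV2 ?posrE ?exprn_gt0// ler_weXn2l// ler1n.
  move: h1 h2 h3; move: (sqnorm _ _) => A; move: (sqnorm _ _) => B.
  by move: (16 ^- n) (16 ^- m) => a b; lra.
exists w; split => //.
  apply: wM => j; have [_] := hartley_contraction (zi (N j)) (sz (N j)).
  move=> /le_trans; apply.
  rewrite /sqnorm; apply: le_Rintegral => //; [exact: (sz _).2|exact: sv.2|].
  move=> x _; rewrite /z exprMn -[leRHS]mul1r ler_wpM2r ?sqr_ge0//.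
  by rewrite exprn_ile1 ?expR_ge0 ?gauss_rV_le1.
move=> p sp; have sHp := rschwartz_hartley sp.
have s2p := sq_intg_rschwartz sp; have s2Hp := sq_intg_rschwartz sHp.
apply/eqP; rewrite -subr_eq0 -sqrf_eq0; apply/eqP.
(* By (A - B)^2 <= 2 A^2 + 2 B^2, where Cauchy-Schwarz bounds A^2 by 4 * 16^(-m) |p|^2 and B^2 by
   16^(-m) |H p|^2. *)
apply: (@geo16_eq0 _ (8 * sqnorm mu p + 2 * sqnorm mu (hartley p))); first exact: sqr_ge0.
move=> m.
have E : \int[mu]_x (w x * p x) - \int[mu]_x (v x * hartley p x) =
    \int[mu]_x ((w x - u m x) * p x) - \int[mu]_x ((v x - z (N m) x) * hartley p x).
  have E1 : \int[mu]_x ((w x - u m x) * p x) =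
      \int[mu]_x (w x * p x) - \int[mu]_x (u m x * p x).
    rewrite -RintegralB//; try exact: sq_intgM.
    by apply: eq_Rintegral => x _; rewrite mulrBl.
  have E2 : \int[mu]_x ((v x - z (N m) x) * hartley p x) =
      \int[mu]_x (v x * hartley p x) - \int[mu]_x (z (N m) x * hartley p x).
    rewrite -RintegralB//; try exact: sq_intgM.
    by apply: eq_Rintegral => x _; rewrite mulrBl.
  have E3 : \int[mu]_x (u m x * p x) = \int[mu]_x (z (N m) x * hartley p x).
    rewrite hartley_adjoint//; last exact: intg_rschwartz.
    by apply: eq_Rintegral => x _; rewrite mulrC.
  by rewrite E1 E2 E3; ring.
rewrite E.
have c1 := cauchy_schwarz (sq_intgB sw (su m)) s2p.
have c2 := cauchy_schwarz (sq_intgB sv (sz (N m))) s2Hp.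
have c1' := le_trans c1 (ler_wpM2r (sqnorm_ge0 mu p) (wu m)).
have c2' := le_trans c2 (ler_wpM2r (sqnorm_ge0 mu (hartley p)) (HN m)).
move: c1' c2'; set A := \int[mu]_x _; set B := \int[mu]_x _ => c1' c2'.
have := sqr_ge0 (A + B); rewrite sqrrD sqrrB.
move: c1' c2'; move: (sqnorm _ _) => P; move: (sqnorm _ _) => Q.
by move: (16 ^- m) => a; nra.
Qed.

End hartley_L2.

(** * Schwartz functions separate functions almost everywhere *)

Section separation.
Context {R : realType} {d : nat}.
Notation mu := (@lebesgue_rV R d).
Notation V := 'rV[R]_d.
Implicit Types (f g h v u w p m : V -> R).

Definition orthant (a : V) : set V := [set x | forall i, a ord0 i < x ord0 i].

Lemma indic_orthant a x : \1_(orthant a) x = \prod_i ((a ord0 i < x ord0 i)%R)%:R :> R.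
Proof.
have [ax|nax] := pselect (orthant a x).
  rewrite indicE mem_set// big1// => i _; by rewrite ax.
rewrite indicE memNset//; have /existsNP[i /negP ai] := nax.
by rewrite (bigD1 i)//= (negbTE ai) mul0r.
Qed.

Lemma measurable_orthant a : measurable (orthant a).
Proof.
have mi : measurable_fun setT (fun x : V => \1_(orthant a) x : R).
  under eq_fun do rewrite indic_orthant.
  apply: measurable_prod => i _.
  have mc := @measurable_coord R d i.
  have : measurable_fun setT (fun t : R => ((a ord0 i < t)%R)%:R : R).
    have := @measurable_indic _ _ R setT _ (measurable_itv `]a ord0 i, +oo[).
    congr measurable_fun; apply/funext => t; rewrite indicE; congr (_%:R).
    by rewrite mem_setE in_itv/= andbT.
  by move=> h; exact: measurableT_comp h mc.
have := mi measurableT _ (measurable_set1 (1 : R)).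
rewrite setTI; congr measurable; apply/seteqP; split => x /=; rewrite indicE.
  by case: (boolP (x \in orthant a)) => [/set_mem//|_ /esym/eqP]; rewrite oner_eq0.
by move=> xa; rewrite mem_set.
Qed.

(** A half-space c < x_i is the union over n of the orthants whose corner has i-th coordinate c and
    all other coordinates -n. *)
Lemma orthant_generate : @measurable _ V = <<s range orthant >>.
Proof.
apply/seteqP; split; last first.
  apply: smallest_sub; first exact: sigma_algebra_measurable.
  by move=> _ [a _ <-]; exact: measurable_orthant.
move=> A mA.
have : measurable_fun setT (id : g_sigma_algebraType (range orthant) -> V).
  apply: measurable_rV => i.
  apply: (@measurability _ _ _ _ setT _ (@RGenOInfty.G R)).
    exact: RGenOInfty.measurableE.
  move=> _ [_ [c ->] <-].
  rewrite setTI.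
  pose b n : V := \row_j (if j == i then c else - n%:R).
  rewrite (_ : _ @^-1` _ = \bigcup_n orthant (b n)).
    apply: bigcup_measurable => n _; apply: sub_sigma_algebra.
    by exists (b n).
  apply/seteqP; split => x /=; rewrite /Defs.coord in_itv/= andbT.
    move=> cx; exists (Num.truncn `|x|).+1 => // j; rewrite mxE.
    case: eqP => [->//|_].
    rewrite ltrNl; apply: le_lt_trans (truncnS_gt `|x|).
    by apply: le_trans (rV_coord_le x j); rewrite ler_normr lexx orbT.
  by move=> [n _ /(_ i)]; rewrite mxE eqxx.
by move=> /(_ measurableT A mA); rewrite setTI.
Qed.

(** For t > 0 the term n^2 t overcomes the shift -n. At t = 0 the shift alone sends the value to 0,
    so that the limit is the strict inequality. *)
Lemma sigmoid_heaviside (t : R) :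
  (fun n => sigmoid (n%:R ^+ 2 * t - n%:R)) @ \oo --> (((0 < t)%R)%:R : R).
Proof.
apply/cvgrPdist_le => e e0.
have p1 (s : R) : 0 < 1 + expR s by rewrite ltr_wpDl ?expR_gt0.
have [t0|t0] := leP t 0.
  near=> n.
  have n0 : 0 <= n%:R :> R by exact: ler0n.
  rewrite sub0r normrN ger0_norm; last exact/ltW/sigmoid_gt0.
  apply: (@le_trans _ _ (n.+1%:R)^-1); last by apply: ltW; near: n; exact: (near_infty_natSinv_lt (PosNum e0)).
  rewrite /sigmoid lef_pV2 ?posrE ?ltr0Sn//.
  rewrite -[n.+1]add1n natrD lerD2l.
  have h1 : n%:R <= - (n%:R ^+ 2 * t - n%:R) by have := mulr_ge0_le0 (sqr_ge0 (n%:R : R)) t0; lra.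
  apply: le_trans h1 _; have := expR_ge1Dx (- (n%:R ^+ 2 * t - n%:R)); lra.
near=> n.
have n0 : 0 <= n%:R :> R by exact: ler0n.
have h1 : 2 <= n%:R * t.
  rewrite -ler_pdivrMr//; apply: ltW.
  apply: (lt_le_trans (truncnS_gt _)); rewrite ler_nat.
  by near: n; exact: nbhs_infty_ge.
have h2 : n%:R <= n%:R ^+ 2 * t - n%:R by nra.
rewrite ger0_norm ?subr_ge0 ?sigmoid_le1//.
apply: (@le_trans _ _ (n.+1%:R)^-1); last by apply: ltW; near: n; exact: (near_infty_natSinv_lt (PosNum e0)).
move: h2; set s := _ - n%:R => h2.
have es := expR_gt0 s.
have -> : 1 - sigmoid s = (1 + expR s)^-1.
  rewrite /sigmoid expRN; field.
  by rewrite !gt_eqF// -?expRN ?p1// addrC p1.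
rewrite lef_pV2 ?posrE ?ltr0Sn//.
rewrite -[n.+1]add1n natrD lerD2l.
by apply: le_trans h2 _; have := expR_ge1Dx s; lra.
Unshelve. all: by end_near. Qed.

Definition smooth_orthant (a : V) n (x : V) : R :=
  \prod_(i < d) sigmoid (n%:R ^+ 2 * (x ord0 i - a ord0 i) - n%:R).

Lemma moderate_prod k (F : 'I_k -> V -> R) : (forall i, moderate (F i)) ->
  moderate (fun x => \prod_i F i x).
Proof.
elim: k F => [|k IH] F mF.
  under eq_fun do rewrite big_ord0.
  exact: moderate_cst.
under eq_fun do rewrite big_ord_recl.
by apply: moderateM => //; exact: IH.
Qed.

Lemma moderate_smooth_orthant a n : moderate (smooth_orthant a n).
Proof.
apply: moderate_prod => i.
have := moderate_sigmoid (n%:R ^+ 2) (- (n%:R ^+ 2 * a ord0 i) - n%:R) i.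
congr moderate; apply/funext => x; congr sigmoid; ring.
Qed.

Lemma cvg_smooth_orthant a x :
  (fun n => smooth_orthant a n x) @ \oo --> (\1_(orthant a) x : R).
Proof.
rewrite indic_orthant /smooth_orthant.
apply: (@cvg_big R 'I_d *%R 1 xpredT _ nat \oo (index_enum _) (fun i n => sigmoid (n%:R ^+ 2 * (x ord0 i - a ord0 i) - n%:R))
  (fun i => ((a ord0 i < x ord0 i)%R)%:R)).
  exact: mul_continuous.
move=> i _; rewrite -subr_gt0; exact: sigmoid_heaviside.
Qed.

Lemma smooth_orthant_bound a n x : `|smooth_orthant a n x| <= 1.
Proof.
rewrite normr_prod; apply: prodr_ile1 => i _.
by rewrite normr_ge0/= ger0_norm ?sigmoid_le1// ltW// sigmoid_gt0.
Qed.

Lemma moderate_measurable m : moderate m -> measurable_fun setT m.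
Proof.
move=> mm; apply: measurable_continuous_rV => x.
exact/differentiable_continuous/moderate_diff.
Qed.

(** The density D = u times a Gaussian is orthogonal to every moderate function, since a moderate
    function times a Gaussian is Schwartz. Products of sigmoids tend boundedly to indicators of
    orthants, so D integrates to zero over orthants, then over all measurable sets by Dynkin's
    theorem. Hence D vanishes almost everywhere, and the Gaussian is positive. *)
Lemma rschwartz_separating u : measurable_fun setT u ->
  intg mu (fun x => u x * gauss_rV 1 x) ->
  (forall p, rschwartz p -> \int[mu]_x (u x * p x) = 0) ->
  {ae mu, forall x, u x = 0}.
Proof.
move=> mu_ Di up.
pose D x := u x * gauss_rV 1 x.
have mD : measurable_fun setT D := intg_measurable Di.
pose P (A : set V) := (\int[mu]_(x in A) (D x)%:E = 0)%E.
have sm m : moderate m -> \int[mu]_x (m x * D x) = 0.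
  move=> mm; rewrite -(up _ (rschwartz_moderateM mm (rschwartz_gauss ltr01))).
  by apply: eq_Rintegral => x _; rewrite /D mulrCA.
have DiA (A : set V) : measurable A -> mu.-integrable A (EFin \o D).
  by move=> mA; apply: (integrableS measurableT mA (@subsetT _ A)).
have PT : P setT.
  rewrite /P -EFin_Rintegral//; congr EFin.
  rewrite -(sm (fun=> 1) (moderate_cst _)).
  by apply: eq_Rintegral => x _; rewrite mul1r.
have PA A : measurable A -> P A.
  rewrite orthant_generate; apply: dynkin_induction => //.
  - exact: orthant_generate.
  - move=> _ _ [a _ <-] [b _ <-].
    exists (\row_i Num.max (a ord0 i) (b ord0 i)) => //.
    apply/seteqP; split => x; rewrite /orthant/=.
      by move=> h; split => i; have := h i; rewrite mxE gt_max => /andP[].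
    by move=> [h1 h2] i; rewrite mxE gt_max h1 h2.
  - move=> _ [a _ <-]; rewrite /P integral_mkcond.
    have [||x|n x|_] := @dominated_cvg_Rintegral _ _ _ mu
      (fun n x => smooth_orthant a n x * D x) (fun x => \1_(orthant a) x * D x)
      (fun x => `|D x|) _ _ _ _ (intg_norm Di).
    + move=> n; apply: measurable_funM => //.
      apply: moderate_measurable; exact: moderate_smooth_orthant.
    + apply: measurable_funM => //; apply: measurable_indic.
      exact: measurable_orthant.
    + by apply: cvgMl; exact: cvg_smooth_orthant.
    + by rewrite normrM -[leRHS]mul1r ler_wpM2r// smooth_orthant_bound.
    under eq_fun do rewrite (sm _ (moderate_smooth_orthant a _)).
    move=> c0; have E0 : 0 = \int[mu]_x (\1_(orthant a) x * D x).
      exact: (cvg_unique _ (cvg_cst 0) c0).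
    have : intg mu (fun x => \1_(orthant a) x * D x).
      apply: (@intgMb _ _ _ mu D _ 1) => //.
        by apply: measurable_indic; exact: measurable_orthant.
      by move=> x; rewrite indicE; case: (_ \in _); rewrite ?normr1 ?normr0.
    move=> /EFin_Rintegral; rewrite -E0 => E; rewrite [RHS]E.
    apply: eq_integral => x _; rewrite patchE indicE.
    by case: ifP => _; rewrite ?mul1r ?mul0r.
  - move=> S mS PS; have := PT; rewrite /P -(setUv S) integral_setU//=.
    + by rewrite PS add0e.
    + exact: measurableC.
    + by rewrite setUv; exact/measurable_EFinP.
    + by rewrite disj_set2E setICr.
  move=> F mF tF PF; rewrite /P integral_bigcup//; last first.
    by apply: DiA; exact: bigcupT_measurable.
  by rewrite eseries0// => i _ _; exact: PF.
have := @integral_ae_eq _ _ _ mu setT measurableT (cst 0%E) (EFin \o D) Di (measurable_cst _).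
move=> /(_ (fun E _ mE => etrans (PA E mE) (esym (integral0 _ _)))).
apply: filterS => x /= /(_ I) [] /eqP; rewrite mulf_eq0 => /orP[/eqP//|].
by rewrite gt_eqF// expR_gt0.
Qed.

Lemma sq_intg_separating u v : sq_intg mu u -> sq_intg mu v ->
  (forall p, rschwartz p -> \int[mu]_x (u x * p x) = \int[mu]_x (v x * p x)) ->
  {ae mu, forall x, u x = v x}.
Proof.
move=> su sv uv.
have sg p : rschwartz p -> sq_intg mu p by exact: sq_intg_rschwartz.
have : {ae mu, forall x, u x - v x = 0}.
  apply: rschwartz_separating.
  - exact: (sq_intgB su sv).1.
  - by apply: sq_intgM (sq_intgB su sv) (sg _ (rschwartz_gauss ltr01)).
  move=> p sp; transitivity (\int[mu]_x (u x * p x) - \int[mu]_x (v x * p x)).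
    rewrite -RintegralB//; try by apply: sq_intgM (sg _ sp).
    by apply: eq_Rintegral => x _; rewrite mulrBl.
  by rewrite uv// subrr.
by apply: filterS => x /eqP; rewrite subr_eq0 => /eqP.
Qed.

(** The extension is only known through its pairings. Applied twice it yields v' with the pairings
    of v, so v' = v almost everywhere by separation, and |v| = |v'| <= |w| <= |v|. *)
Lemma hartley_isometry v : sq_intg mu v ->
  exists w, [/\ sq_intg mu w, sqnorm mu w = sqnorm mu v &
    forall p, rschwartz p -> \int[mu]_x (w x * p x) = \int[mu]_x (v x * hartley p x)].
Proof.
move=> sv; have [w [sw wv wp]] := hartley_extension sv.
have [v' [sv' v'w v'p]] := hartley_extension sw.
exists w; split => //; apply/le_anti; rewrite wv/=.
suff [_ ->] : sq_intg mu v /\ sqnorm mu v = sqnorm mu v' by [].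
apply: eq_sqnorm_ae => //; first exact: sv.1.
apply: sq_intg_separating => // p sp.
rewrite v'p// wp; last exact: rschwartz_hartley.
by apply: eq_Rintegral => x _; rewrite hartleyK.
Qed.

End separation.

(** * Distributions *)

Local Open Scope complex_scope.

(** * Complex Schwartz functions and distributions given by functions *)

Section complex_schwartz.
Context {R : realType} {d : nat}.
Notation mu := (@lebesgue_rV R d).
Notation V := 'rV[R]_d.
Implicit Types (a b p q h A B : V -> R) (u v w phi psi : V -> R[i]).

Lemma complex_ReM (x y : R[i]) : complex.Re (x * y) =
  complex.Re x * complex.Re y - complex.Im x * complex.Im y.
Proof. by case: x y => [? ?] [? ?]. Qed.

Lemma complex_ImM (x y : R[i]) : complex.Im (x * y) =
  complex.Re x * complex.Im y + complex.Im x * complex.Re y.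
Proof. by case: x y => [? ?] [? ?]. Qed.

Lemma RefunImfunE u : u = fun x => Refun u x +i* Imfun u x.
Proof. by apply/funext => x; rewrite /Refun /Imfun; case: (u x). Qed.

Lemma absfunE u x : absfun u x = Num.sqrt (Refun u x ^+ 2 + Imfun u x ^+ 2).
Proof. by rewrite /absfun /Refun /Imfun; case: (u x). Qed.

Lemma absfun_ge0 u x : 0 <= absfun u x.
Proof. by rewrite absfunE sqrtr_ge0. Qed.

Lemma Re_le_absfun u x : `|Refun u x| <= absfun u x.
Proof. by rewrite absfunE -sqrtr_sqr ler_wsqrtr// lerDl sqr_ge0. Qed.

Lemma Im_le_absfun u x : `|Imfun u x| <= absfun u x.
Proof. by rewrite absfunE -sqrtr_sqr ler_wsqrtr// lerDr sqr_ge0. Qed.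

Lemma absfun_le u x : absfun u x <= `|Refun u x| + `|Imfun u x|.
Proof.
rewrite absfunE -[leRHS]ger0_norm ?addr_ge0// -sqrtr_sqr ler_wsqrtr//.
rewrite sqrrD !real_normK ?num_real// addrAC lerDl mulrn_wge0// mulr_ge0//.
Qed.

Lemma Refun_partials s phi : Refun (partials s phi) = pders s (Refun phi).
Proof. by elim: s => //= i s IH; rewrite /Refun/= -/(Refun _) IH. Qed.

Lemma Imfun_partials s phi : Imfun (partials s phi) = pders s (Imfun phi).
Proof. by elim: s => //= i s IH; rewrite /Imfun/= -/(Imfun _) IH. Qed.

Lemma seminorm_le N phi s x : (size s <= N)%N ->
  ((jap x ^+ N * absfun (partials s phi) x)%:E <= schwartz_seminorm N phi)%E.
Proof. by move=> sN; apply: ereal_sup_ubound; exists x => //; exists s. Qed.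

Lemma seminorm_ge0 N phi : (0 <= schwartz_seminorm N phi)%E.
Proof.
apply: le_trans (@seminorm_le N phi [::] 0 (leq0n N)).
by rewrite lee_fin mulr_ge0 ?absfun_ge0// exprn_ge0// ltW// jap0.
Qed.

(** The induction peels off the derivative that is applied first, which is the last entry of s; the
    d bounds so obtained are added up. *)
Lemma rschwartz_uniform_bound (M N : nat) h : rschwartz h -> exists C,
  forall s x, (size s <= N)%N -> jap x ^+ M * `|pders s h x| <= C.
Proof.
elim: N h => [|N IH] h sh.
  have [C HC] := rschwartz_rapid sh M.
  by exists C => -[|//] x _; exact: HC.
have [C HC] := rschwartz_rapid sh M.
have /boolp.choice[K HK] : forall i : 'I_d, exists K, forall s x, (size s <= N)%N ->
    jap x ^+ M * `|pders s (pder i h) x| <= K.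
  by move=> i; apply: IH; exact: rschwartz_pder.
have K0 i : 0 <= K i.
  apply: le_trans (HK i [::] 0 (leq0n N)).
  by rewrite mulr_ge0// exprn_ge0// ltW// jap0.
have C0 : 0 <= C.
  by apply: le_trans (HC 0); rewrite mulr_ge0// exprn_ge0// ltW// jap0.
exists (C + \sum_i K i) => s x; case/lastP: s => [|s i].
  by move=> _; apply: le_trans (HC x) _; rewrite lerDl sumr_ge0.
rewrite size_rcons ltnS /pders -cats1 foldr_cat/= -/(pders s (pder i h)) => sN.
apply: le_trans (HK i s x sN) _.
by rewrite (bigD1 i)//= addrCA lerDl addr_ge0// sumr_ge0.
Qed.

(** The bridge from the complex definition to pairs of real Schwartz functions, through which all
    later arguments pass. *)
Lemma schwartzP phi : schwartz phi <-> rschwartz (Refun phi) /\ rschwartz (Imfun phi).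
Proof.
split.
  move=> [sm sn]; split => s; (split; first by
    move=> x; have [] := sm s x; rewrite Refun_partials Imfun_partials) => N.
  (* One index governs both weight and order of derivation in the seminorm, so it must dominate N
     and the length of s. *)
  - have := sn (maxn N (size s)).
    case E : (schwartz_seminorm _ _) (seminorm_ge0 (maxn N (size s)) phi) => [r| |]// _ _.
    exists r => x; rewrite -lee_fin -E.
    apply: le_trans (@seminorm_le _ phi s x (leq_maxr N (size s))).
    rewrite lee_fin -Refun_partials ler_pM ?exprn_ge0 ?(ltW (jap0 _))//.
      by rewrite ler_weXn2l ?jap_ge1// leq_maxl.
    exact: Re_le_absfun.
  - have := sn (maxn N (size s)).
    case E : (schwartz_seminorm _ _) (seminorm_ge0 (maxn N (size s)) phi) => [r| |]// _ _.
    exists r => x; rewrite -lee_fin -E.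
    apply: le_trans (@seminorm_le _ phi s x (leq_maxr N (size s))).
    rewrite lee_fin -Imfun_partials ler_pM ?exprn_ge0 ?(ltW (jap0 _))//.
      by rewrite ler_weXn2l ?jap_ge1// leq_maxl.
    exact: Im_le_absfun.
move=> [sr si]; split.
  by move=> s x; rewrite Refun_partials Imfun_partials; split; [have [] := sr s|have [] := si s].
move=> N; have [C HC] := rschwartz_uniform_bound N N sr.
have [D HD] := rschwartz_uniform_bound N N si.
apply: (@le_lt_trans _ _ (C + D)%:E); last exact: ltry.
apply: ge_ereal_sup => _ [x _ [s sN <-]].
rewrite lee_fin; apply: le_trans (ler_wpM2l _ (absfun_le _ x)) _.
  by rewrite exprn_ge0// ltW// jap0.
by rewrite mulrDr lerD// ?Refun_partials ?Imfun_partials; [exact: HC|exact: HD].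
Qed.

(** A common roof for integrable, bounded and square-integrable functions: what the pairing with
    Schwartz functions requires. *)
Definition test_integrable a :=
  measurable_fun setT a /\ forall p, rschwartz p -> intg mu (fun x => a x * p x).

Lemma intg_test_integrable a : intg mu a -> test_integrable a.
Proof.
move=> ai; split; first exact: (intg_measurable ai).
move=> p sp; have [C HC] := rschwartz_bounded sp.
have := intgMb (rschwartz_measurable sp) HC ai.
by congr (intg mu _); apply/funext => x; rewrite mulrC.
Qed.

Lemma bounded_test_integrable a C : measurable_fun setT a -> (forall x, `|a x| <= C) ->
  test_integrable a.
Proof.
by move=> ma aC; split => // p sp; apply: intgMb ma aC (intg_rschwartz sp).
Qed.

Lemma sq_intg_test_integrable a : sq_intg mu a -> test_integrable a.
Proof.
by move=> sa; split => [|p sp]; [exact: sa.1|exact: sq_intgM sa (sq_intg_rschwartz sp)].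
Qed.

Lemma rschwartz_test_integrable a : rschwartz a -> test_integrable a.
Proof. by move=> /sq_intg_rschwartz; exact: sq_intg_test_integrable. Qed.

Lemma rschwartz_opp p : rschwartz p -> rschwartz (fun x => p (- x)).
Proof.
move=> sp; have := @rschwartz_affine R d (-1) 0 p _ sp.
rewrite oppr_eq0 oner_eq0 => /(_ isT); congr rschwartz.
by apply/funext => x; rewrite scaleN1r addr0.
Qed.

Lemma measurable_opp_rV a : measurable_fun setT a -> measurable_fun setT (fun x : V => a (- x)).
Proof.
move=> ma; have := measurableT_comp ma (measurable_affine_rV (-1 : R) (0 : V)).
by congr measurable_fun; apply/funext => x /=; rewrite scaleN1r addr0.
Qed.

Lemma test_integrable_opp a : test_integrable a -> test_integrable (fun x => a (- x)).
Proof.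
move=> [ma ai]; split; first exact: measurable_opp_rV.
move=> p sp; have := intg_opp (ai _ (rschwartz_opp sp)).
by congr (intg mu _); apply/funext => x; rewrite opprK.
Qed.

Lemma test_integrableD a b : test_integrable a -> test_integrable b ->
  test_integrable (fun x => a x + b x).
Proof.
move=> [ma ai] [mb bi]; split; first exact: measurable_funD.
move=> p sp; have := intgD (ai _ sp) (bi _ sp).
by congr (intg mu _); apply/funext => x; rewrite mulrDl.
Qed.

Lemma test_integrableZ c a : test_integrable a -> test_integrable (fun x => c * a x).
Proof.
move=> [ma ai]; split; first exact: measurable_funM.
move=> p sp; have := intgZ c (ai _ sp).
by congr (intg mu _); apply/funext => x; rewrite mulrA.
Qed.

Definition test_integrableC u := test_integrable (Refun u) /\ test_integrable (Imfun u).

Lemma distr_ofE u phi : test_integrableC u -> schwartz phi -> distr_of u phi =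
  (\int[mu]_x (Refun u x * Refun phi x) - \int[mu]_x (Imfun u x * Imfun phi x)) +i*
  (\int[mu]_x (Refun u x * Imfun phi x) + \int[mu]_x (Imfun u x * Refun phi x)).
Proof.
move=> [[_ ur] [_ ui]] /schwartzP[sr si].
rewrite /distr_of /cintegral -RintegralB ?ur ?ui// -RintegralD ?ur ?ui//.
by congr (_ +i* _); apply: eq_Rintegral => x _; rewrite /Refun /Imfun ?complex_ReM ?complex_ImM.
Qed.

End complex_schwartz.

(** * The Fourier transform and its inverse on Schwartz functions *)

Section fourier_schwartz.
Context {R : realType} {d : nat}.
Notation mu := (@lebesgue_rV R d).
Notation V := 'rV[R]_d.
Notation c0 := (@hartley_cst R d).
Implicit Types (a b p q h A B : V -> R) (u v w phi psi : V -> R[i]).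

(* The even part of a Hartley transform is the cosine transform, the odd part is
   the sine transform. *)
Definition fourier_of A B (x : V) : R[i] :=
  ((A x + A (- x) + (B x - B (- x))) / 2) +i*
  ((B x + B (- x) - (A x - A (- x))) / 2).

Lemma measurable_cos_dotrV k : measurable_fun setT (fun x : V => cos (dotrV k x)).
Proof.
have mc : measurable_fun setT (cos : R -> R).
  by apply: continuous_measurable_fun; exact: continuous_cos.
rewrite (_ : (fun x => _) = (cos : R -> R) \o dotrV ^~ k).
  exact: measurableT_comp mc (measurable_dotrV k).
by apply/funext => x /=; rewrite dotrVC.
Qed.

Lemma measurable_sin_dotrV k : measurable_fun setT (fun x : V => sin (dotrV k x)).
Proof.
have mc : measurable_fun setT (sin : R -> R).
  by apply: continuous_measurable_fun; exact: continuous_sin.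
rewrite (_ : (fun x => _) = (sin : R -> R) \o dotrV ^~ k).
  exact: measurableT_comp mc (measurable_dotrV k).
by apply/funext => x /=; rewrite dotrVC.
Qed.

Lemma intg_cos k h : intg mu h -> intg mu (fun x => cos (dotrV k x) * h x).
Proof.
by move=> hi; apply: intgMb (measurable_cos_dotrV k) _ hi => x; exact: cos_max.
Qed.

Lemma intg_sin k h : intg mu h -> intg mu (fun x => sin (dotrV k x) * h x).
Proof.
by move=> hi; apply: intgMb (measurable_sin_dotrV k) _ hi => x; exact: sin_max.
Qed.

Lemma hartley_even h k : intg mu h ->
  (hartley h k + hartley h (- k)) / 2 = c0 * \int[mu]_x (cos (dotrV k x) * h x).
Proof.
move=> hi; rewrite /hartley -mulrDr -RintegralD ?intg_cas// -mulrA; congr (_ * _).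
rewrite mulrC -RintegralZl//; last by apply: intgD; exact: intg_cas.
by apply: eq_Rintegral => x _; rewrite dotrVNl /cas cosN sinN; field.
Qed.

Lemma hartley_odd h k : intg mu h ->
  (hartley h k - hartley h (- k)) / 2 = c0 * \int[mu]_x (sin (dotrV k x) * h x).
Proof.
move=> hi; rewrite /hartley -mulrBr -RintegralB ?intg_cas// -mulrA; congr (_ * _).
rewrite mulrC -RintegralZl//; last by apply: intgB; exact: intg_cas.
by apply: eq_Rintegral => x _; rewrite dotrVNl /cas cosN sinN; field.
Qed.

Lemma fourierE_intg phi : intg mu (Refun phi) -> intg mu (Imfun phi) ->
  fourier phi = fourier_of (hartley (Refun phi)) (hartley (Imfun phi)).
Proof.
move=> pi' qi; apply/funext => k.
rewrite /fourier /cintegral -/(@hartley_cst R d) /fourier_of.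
rewrite [X in _ = X +i* _]mulrDl [X in _ = _ +i* X]mulrBl.
rewrite !hartley_even// !hartley_odd//.
rewrite -[in RHS]mulrDr -[in RHS]mulrBr -RintegralD ?intg_cos ?intg_sin//.
rewrite -RintegralB ?intg_cos ?intg_sin//.
have -> (c x y : R) : c%:C * (x +i* y) = (c * x) +i* (c * y).
  by apply/eqP; rewrite eq_complex/= !mul0r subr0 addr0 !eqxx.
congr ((_ * _) +i* (_ * _)); apply: eq_Rintegral => x _.
  by rewrite /Refun /Imfun; case: (phi x) => a b /=; rewrite mulNr opprK.
by rewrite /Refun /Imfun; case: (phi x) => a b /=; rewrite mulNr.
Qed.

Lemma fourierE phi : schwartz phi ->
  fourier phi = fourier_of (hartley (Refun phi)) (hartley (Imfun phi)).
Proof. by move=> /schwartzP[sr si]; apply: fourierE_intg; exact: intg_rschwartz. Qed.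

Lemma schwartz_fourier_of A B : rschwartz A -> rschwartz B -> schwartz (fourier_of A B).
Proof.
move=> sA sB; have sA' := rschwartz_opp sA; have sB' := rschwartz_opp sB.
apply/schwartzP; split.
  have := rschwartzZ 2^-1 (rschwartzD (rschwartzD sA sA') (rschwartzB sB sB')).
  by congr rschwartz; apply/funext => x; rewrite mulrC.
have := rschwartzZ 2^-1 (rschwartzB (rschwartzD sB sB') (rschwartzB sA sA')).
by congr rschwartz; apply/funext => x; rewrite mulrC.
Qed.

Lemma schwartz_fourier phi : schwartz phi -> schwartz (fourier phi).
Proof.
move=> sp; rewrite fourierE//; have /schwartzP[sr si] := sp.
by apply: schwartz_fourier_of; exact: rschwartz_hartley.
Qed.

Lemma schwartz_opp phi : schwartz phi -> schwartz (fun x => phi (- x)).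
Proof.
move=> /schwartzP[sr si]; apply/schwartzP.
by split; [exact: (rschwartz_opp sr)|exact: (rschwartz_opp si)].
Qed.

Definition ifourier phi (x : V) : R[i] := fourier phi (- x).

Lemma schwartz_ifourier phi : schwartz phi -> schwartz (ifourier phi).
Proof. by move=> sp; exact/schwartz_opp/schwartz_fourier. Qed.

Lemma ifourier_opp phi : schwartz phi -> ifourier phi = fourier (fun x => phi (- x)).
Proof.
move=> sp; have sp' := schwartz_opp sp; have /schwartzP[sr si] := sp.
have H h k : rschwartz h -> hartley (fun y => h (- y)) k = hartley h (- k).
  by move=> sh; rewrite hartley_opp//; exact: intg_rschwartz.
have ER : Refun (fun x => phi (- x)) = fun x => Refun phi (- x) by [].
have EI : Imfun (fun x => phi (- x)) = fun x => Imfun phi (- x) by [].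
by apply/funext => x; rewrite /ifourier !fourierE// ER EI /fourier_of !H// !opprK.
Qed.

Lemma hartley_half A B C D x : rschwartz A -> rschwartz B -> rschwartz C -> rschwartz D ->
  hartley (fun x => (A x + B x + (C x - D x)) / 2) x =
  (hartley A x + hartley B x + (hartley C x - hartley D x)) / 2.
Proof.
move=> sA sB sC sD; under [X in hartley X]funext do rewrite mulrC.
have iA := intg_rschwartz sA; have iB := intg_rschwartz sB.
have iC := intg_rschwartz sC; have iD := intg_rschwartz sD.
rewrite hartleyZ; last by apply: intgD; [exact: intgD|exact: intgB].
rewrite hartleyD; [|exact: intgD|exact: intgB].
by rewrite hartleyD// hartleyB// mulrC.
Qed.

(** Both transforms are combinations of A, B and their reflections. Since H is an involution
    commuting with reflections, only a linear identity in the values of p and q at x and -x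
    remains. *)
Lemma ifourierK phi : schwartz phi -> fourier (ifourier phi) = phi.
Proof.
move=> sp; rewrite fourierE; last exact: schwartz_ifourier.
have /schwartzP[sr si] := sp.
set p := Refun phi in sr *; set q := Imfun phi in si *.
have sA := rschwartz_hartley sr; have sB := rschwartz_hartley si.
set A := hartley p in sA; set B := hartley q in sB.
have sA' := rschwartz_opp sA; have sB' := rschwartz_opp sB.
have HA : hartley A =1 p := hartleyK sr.
have HB : hartley B =1 q := hartleyK si.
have HA' x : hartley (fun y => A (- y)) x = p (- x).
  by rewrite -hartley_opp ?HA//; exact: intg_rschwartz.
have HB' x : hartley (fun y => B (- y)) x = q (- x).
  by rewrite -hartley_opp ?HB//; exact: intg_rschwartz.
have -> : Refun (ifourier phi) = fun x => (A (- x) + A x + (B (- x) - B x)) / 2.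
  by rewrite /ifourier fourierE// /Refun/=; apply/funext => x; rewrite opprK.
have -> : Imfun (ifourier phi) = fun x => (B (- x) + B x + (A x - A (- x))) / 2.
  by rewrite /ifourier fourierE// /Imfun/=; apply/funext => x; rewrite opprK opprB.
rewrite [RHS]RefunImfunE; apply/funext => x; rewrite /fourier_of.
rewrite !(@hartley_half (fun y => A (- y)) A (fun y => B (- y)) B)//.
rewrite !(@hartley_half (fun y => B (- y)) B A (fun y => A (- y)))//.
rewrite !HA !HB !HA' !HB' !opprK -/p -/q.
by congr (_ +i* _); field.
Qed.

(** The other inversion formula, applied to the reflection of [phi]. *)
Lemma fourierK phi : schwartz phi -> ifourier (fourier phi) = phi.
Proof.
move=> sp; have sp' := schwartz_opp sp.
rewrite /ifourier -[X in fourier X](_ : ifourier (fun x => phi (- x)) = _).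
  by rewrite ifourierK//; apply/funext => x; rewrite opprK.
rewrite ifourier_opp//; congr fourier; apply/funext => x; by rewrite opprK.
Qed.

End fourier_schwartz.

(** * Plancherel's theorem by duality *)

Section plancherel.
Context {R : realType} {d : nat}.
Notation mu := (@lebesgue_rV R d).
Notation V := 'rV[R]_d.
Implicit Types (a b p q h A B : V -> R) (u v w phi psi : V -> R[i]).

(** The weak form of A = H a, meaningful also when a is only square-integrable. *)
Definition hartley_pair a A := forall p, rschwartz p ->
  \int[mu]_x (A x * p x) = \int[mu]_x (a x * hartley p x).

Lemma Rintegral_opp_pair a p : test_integrable a -> rschwartz p ->
  \int[mu]_x (a (- x) * p x) = \int[mu]_x (a x * p (- x)).
Proof.
move=> [ma ai] sp; rewrite -(Rintegral_opp (ai _ (rschwartz_opp sp))).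
by apply: eq_Rintegral => x _; rewrite opprK.
Qed.

Lemma hartley_pair_opp a A : test_integrable a -> test_integrable A ->
  hartley_pair a A -> hartley_pair (fun x => a (- x)) (fun x => A (- x)).
Proof.
move=> ta tA aA p sp; have sp' := rschwartz_opp sp.
rewrite (Rintegral_opp_pair tA sp) (aA _ sp') (Rintegral_opp_pair ta (rschwartz_hartley sp)).
by apply: eq_Rintegral => x _; rewrite hartley_opp//; exact: intg_rschwartz.
Qed.

Lemma hartley_pair_intg a : intg mu a -> hartley_pair a (hartley a).
Proof.
move=> ai p sp; rewrite (hartley_adjoint ai (intg_rschwartz sp)).
by apply: eq_Rintegral => x _; rewrite mulrC.
Qed.

Lemma Rintegral_half (f1 f2 f3 f4 : V -> R) :
  intg mu f1 -> intg mu f2 -> intg mu f3 -> intg mu f4 ->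
  \int[mu]_x ((f1 x + f2 x + (f3 x - f4 x)) / 2) =
  (\int[mu]_x f1 x + \int[mu]_x f2 x + (\int[mu]_x f3 x - \int[mu]_x f4 x)) / 2.
Proof.
move=> i1 i2 i3 i4; under eq_Rintegral do rewrite mulrC.
rewrite RintegralZl//; last by apply: intgD; [exact: intgD|exact: intgB].
rewrite mulrC RintegralD//; [|exact: intgD|exact: intgB].
by rewrite RintegralD// RintegralB.
Qed.

Lemma test_integrable_half A B C D : test_integrable A -> test_integrable B ->
  test_integrable C -> test_integrable D ->
  test_integrable (fun x => (A x + B x + (C x - D x)) / 2).
Proof.
move=> tA tB tC tD.
have := test_integrableZ 2^-1 (test_integrableD (test_integrableD tA tB)
  (test_integrableD tC (test_integrableZ (-1) tD))).
by congr test_integrable; apply/funext => x; rewrite mulrC mulN1r.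
Qed.

Lemma test_integrable_fourier_of A B : test_integrable A -> test_integrable B ->
  test_integrableC (fourier_of A B).
Proof.
move=> tA tB; have tA' := test_integrable_opp tA; have tB' := test_integrable_opp tB.
split; first exact: test_integrable_half.
have := test_integrable_half tB tB' tA' tA; congr test_integrable.
by apply/funext => x; rewrite /Imfun/= opprB.
Qed.

Let fourier_re A B (x : V) := (A x + A (- x) + (B x - B (- x))) / 2.
Let fourier_im A B (x : V) := (B x + B (- x) - (A x - A (- x))) / 2.

(** The real and imaginary parts of the transpose identity <a + ib, F(p + iq)> = <F(a + ib), p +
    iq>. Distributing the integrals leaves pairings with a, b, A, B or reflections, which the two
    [hartley_pair] hypotheses match up. *)
Lemma fourier_pairing a b A B p q :
  test_integrable a -> test_integrable b -> test_integrable A -> test_integrable B ->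
  hartley_pair a A -> hartley_pair b B -> rschwartz p -> rschwartz q ->
  \int[mu]_x (a x * fourier_re (hartley p) (hartley q) x) -
  \int[mu]_x (b x * fourier_im (hartley p) (hartley q) x) =
  \int[mu]_x (fourier_re A B x * p x) - \int[mu]_x (fourier_im A B x * q x) /\
  \int[mu]_x (a x * fourier_im (hartley p) (hartley q) x) +
  \int[mu]_x (b x * fourier_re (hartley p) (hartley q) x) =
  \int[mu]_x (fourier_re A B x * q x) + \int[mu]_x (fourier_im A B x * p x).
Proof.
move=> ta tb tA tB aA bB sp sq.
have sP := rschwartz_hartley sp; have sQ := rschwartz_hartley sq.
have sP' := rschwartz_opp sP; have sQ' := rschwartz_opp sQ.
have tA' := test_integrable_opp tA; have tB' := test_integrable_opp tB.
have aA' := hartley_pair_opp ta tA aA; have bB' := hartley_pair_opp tb tB bB.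
have L c P Q : test_integrable c -> rschwartz P -> rschwartz Q ->
    \int[mu]_x (c x * ((P x + P (- x) + (Q x - Q (- x))) / 2)) =
    (\int[mu]_x (c x * P x) + \int[mu]_x (c x * P (- x)) +
    (\int[mu]_x (c x * Q x) - \int[mu]_x (c x * Q (- x)))) / 2.
  move=> [_ ti] s1 s2; have s1' := rschwartz_opp s1; have s2' := rschwartz_opp s2.
  rewrite -Rintegral_half; try exact: ti.
  by apply: eq_Rintegral => x _; field.
have L' c C D : test_integrable C -> test_integrable D -> rschwartz c ->
    \int[mu]_x ((C x + C (- x) + (D x - D (- x))) / 2 * c x) =
    (\int[mu]_x (C x * c x) + \int[mu]_x (C (- x) * c x) +
    (\int[mu]_x (D x * c x) - \int[mu]_x (D (- x) * c x))) / 2.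
  move=> t1 t2 s; have t1' := test_integrable_opp t1; have t2' := test_integrable_opp t2.
  rewrite -Rintegral_half; [|exact: t1.2|exact: t1'.2|exact: t2.2|exact: t2'.2].
  by apply: eq_Rintegral => x _; field.
(* This puts imaginary parts in the shape of real parts, with one function reflected, so that [L]
   and [L'] serve for both. *)
have N c P Q : \int[mu]_x (c x * ((P x + P (- x) - (Q x - Q (- x))) / 2)) =
    \int[mu]_x (c x * ((P x + P (- x) + (Q (- x) - Q (- - x))) / 2)).
  by apply: eq_Rintegral => x _; rewrite opprK; field.
have N' c P Q : \int[mu]_x ((P x + P (- x) - (Q x - Q (- x))) / 2 * c x) =
    \int[mu]_x ((P x + P (- x) + (Q (- x) - Q (- - x))) / 2 * c x).
  by apply: eq_Rintegral => x _; rewrite opprK; field.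
have O c P : \int[mu]_x (c x * P (- - x)) = \int[mu]_x (c x * P x).
  by apply: eq_Rintegral => x _; rewrite opprK.
have O' c P : \int[mu]_x (P (- - x) * c x) = \int[mu]_x (P x * c x).
  by apply: eq_Rintegral => x _; rewrite opprK.
rewrite /fourier_re /fourier_im !N !N'.
have := (L a _ _ ta sP sQ, L b _ _ tb sQ sP', L a _ _ ta sQ sP', L b _ _ tb sP sQ).
have := (L' p _ _ tA tB sp, L' q _ _ tB tA' sq, L' q _ _ tA tB sq, L' p _ _ tB tA' sp).
move=> /= LL' LL; rewrite !LL !LL' {L L' N N' LL LL'}.
rewrite !O !O'.
have E c C r : hartley_pair c C -> test_integrable c -> test_integrable C -> rschwartz r ->
    \int[mu]_x (C (- x) * r x) = \int[mu]_x (c x * hartley r (- x)).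
  move=> cC tc tC sr; rewrite (hartley_pair_opp tc tC cC sr).
  by rewrite Rintegral_opp_pair//; exact: rschwartz_hartley.
rewrite !(aA _ sp) !(aA _ sq) !(bB _ sp) !(bB _ sq).
rewrite (E _ _ _ aA ta tA sp) (E _ _ _ aA ta tA sq).
rewrite (E _ _ _ bB tb tB sp) (E _ _ _ bB tb tB sq).
have alg1 (x1 x2 x3 x4 y1 y2 y3 y4 : R) :
    (x1 + x2 + (x3 - x4)) / 2 - (y1 + y2 + (y3 - y4)) / 2 =
    (x1 + x2 + (y4 - y3)) / 2 - (y1 + y2 + (x4 - x3)) / 2 by field.
have alg2 (x1 x2 x3 x4 y1 y2 y3 y4 : R) :
    (x1 + x2 + (x3 - x4)) / 2 + (y1 + y2 + (y3 - y4)) / 2 =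
    (x1 + x2 + (y3 - y4)) / 2 + (y1 + y2 + (x3 - x4)) / 2 by field.
by split; [exact: alg1|exact: alg2].
Qed.

Lemma distr_of_fourier v A B phi : test_integrableC v ->
  test_integrable A -> test_integrable B ->
  hartley_pair (Refun v) A -> hartley_pair (Imfun v) B -> schwartz phi ->
  distr_of v (fourier phi) = distr_of (fourier_of A B) phi.
Proof.
move=> tv tA tB aA bB sp.
rewrite !distr_ofE//; [|exact: test_integrable_fourier_of|exact: schwartz_fourier].
have [ta tb] := tv; have /schwartzP[sr si] := sp.
rewrite fourierE//.
have [e1 e2] := fourier_pairing ta tb tA tB aA bB sr si.
by congr (_ +i* _); [exact: e1|exact: e2].
Qed.

Lemma distr_of_opp w phi : test_integrableC w -> schwartz phi ->
  distr_of w (fun x => phi (- x)) = distr_of (fun x => w (- x)) phi.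
Proof.
move=> [tr ti] sp; have /schwartzP[sr si] := sp.
rewrite !distr_ofE//; [|by split; [exact: (test_integrable_opp tr)|exact: (test_integrable_opp ti)]|exact: schwartz_opp].
congr ((_ - _) +i* (_ + _)).
- by rewrite -(Rintegral_opp_pair tr sr).
- by rewrite -(Rintegral_opp_pair ti si).
- by rewrite -(Rintegral_opp_pair tr si).
- by rewrite -(Rintegral_opp_pair ti sr).
Qed.

Lemma distr_of_ifourier v A B phi : test_integrableC v ->
  test_integrable A -> test_integrable B ->
  hartley_pair (Refun v) A -> hartley_pair (Imfun v) B -> schwartz phi ->
  distr_of v (ifourier phi) = distr_of (fun x => fourier_of A B (- x)) phi.
Proof.
move=> tv tA tB aA bB sp; rewrite ifourier_opp//.
rewrite (@distr_of_fourier _ A B)//; last exact: schwartz_opp.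
by apply: distr_of_opp => //; exact: test_integrable_fourier_of.
Qed.

Definition csq_intg u := sq_intg mu (Refun u) /\ sq_intg mu (Imfun u).
Definition csqnorm u := sqnorm mu (Refun u) + sqnorm mu (Imfun u).

Lemma sq_intg_opp a : sq_intg mu a -> sq_intg mu (fun x => a (- x)).
Proof. by move=> [ma ai]; split; [exact: measurable_opp_rV|exact: (intg_opp ai)]. Qed.

Lemma sqnorm_opp a : sq_intg mu a -> sqnorm mu (fun x => a (- x)) = sqnorm mu a.
Proof. by move=> [ma ai]; exact: (Rintegral_opp ai). Qed.

(** The squared modulus is half the sum of the squares of A, B and their reflections, plus the cross
    term A(-x) B(x) - A(x) B(-x), which is odd and integrates to zero. *)
Lemma csq_fourier_of A B : sq_intg mu A -> sq_intg mu B ->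
  csq_intg (fourier_of A B) /\ csqnorm (fourier_of A B) = sqnorm mu A + sqnorm mu B.
Proof.
move=> sA sB; have sA' := sq_intg_opp sA; have sB' := sq_intg_opp sB.
have s1 : sq_intg mu (Refun (fourier_of A B)).
  have := sq_intgZ 2^-1 (sq_intgD (sq_intgD sA sA') (sq_intgB sB sB')).
  by congr sq_intg; apply/funext => x; rewrite mulrC.
have s2 : sq_intg mu (Imfun (fourier_of A B)).
  have := sq_intgZ 2^-1 (sq_intgB (sq_intgD sB sB') (sq_intgB sA sA')).
  by congr sq_intg; apply/funext => x; rewrite mulrC.
split => //; rewrite /csqnorm /sqnorm -RintegralD//; [|exact: s1.2|exact: s2.2].
have iAB' := sq_intgM sA sB'; have iA'B := sq_intgM sA' sB.
transitivity (\int[mu]_x (2^-1 * (A (- x) ^+ 2 + B x ^+ 2 + (A x ^+ 2 + B (- x) ^+ 2)) +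
    (A (- x) * B x - A x * B (- x)))).
  by apply: eq_Rintegral => x _; rewrite /Refun /Imfun/=; field.
have I1 := intgD sA'.2 sB.2; have I2 := intgD sA.2 sB'.2.
rewrite RintegralD//; [|exact/intgZ/intgD|exact: intgB].
rewrite RintegralZl//; last exact: intgD.
rewrite RintegralD// RintegralD//; [|exact: sA'.2|exact: sB.2].
rewrite RintegralD//; [|exact: sA.2|exact: sB'.2].
rewrite RintegralB//.
have -> : \int[mu]_x (A (- x) * B x) = \int[mu]_x (A x * B (- x)).
  by rewrite -(Rintegral_opp iAB'); apply: eq_Rintegral => x _; rewrite opprK.
have := sqnorm_opp sA; have := sqnorm_opp sB; rewrite /sqnorm => -> ->.
by field.
Qed.

Lemma csq_opp u : csq_intg u ->
  csq_intg (fun x => u (- x)) /\ csqnorm (fun x => u (- x)) = csqnorm u.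
Proof.
move=> [s1 s2]; split; last by rewrite /csqnorm -(sqnorm_opp s1) -(sqnorm_opp s2).
by split; [exact: (sq_intg_opp s1)|exact: (sq_intg_opp s2)].
Qed.

Lemma csq_test_integrable u : csq_intg u -> test_integrableC u.
Proof. by move=> [s1 s2]; split; exact: sq_intg_test_integrable. Qed.

Lemma plancherel v : csq_intg v -> exists w, [/\ csq_intg w, csqnorm w = csqnorm v &
  forall phi, schwartz phi -> distr_of v (ifourier phi) = distr_of w phi].
Proof.
move=> [sa sb]; have [A [sA nA pA]] := hartley_isometry sa.
have [B [sB nB pB]] := hartley_isometry sb.
have [sw nw] := csq_fourier_of sA sB; have [sw' nw'] := csq_opp sw.
exists (fun x => fourier_of A B (- x)); split => //; first by rewrite nw' nw nA nB.
move=> phi sp; apply: distr_of_ifourier => //; first exact: csq_test_integrable.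
- exact: sq_intg_test_integrable.
- exact: sq_intg_test_integrable.
Qed.

End plancherel.

(** * L^2 and L^oo norms of distributions *)

Section distribution_norms.
Context {R : realType} {d : nat}.
Notation mu := (@lebesgue_rV R d).
Notation V := 'rV[R]_d.
Implicit Types (a b p q h A B : V -> R) (u v w phi psi : V -> R[i]) (T U : functional R d).

(** On a null space the Gaussian integral would be 0. Positivity selects the branch of the L^oo norm
    that is the essential supremum. *)
Lemma lebesgue_rV_gt0 : (0 < mu setT)%E.
Proof.
rewrite lt_neqAle measure_ge0 andbT; apply/eqP => /esym m0.
have := @Rintegral_gauss R d 1 ltr01.
rewrite /Rintegral; have -> : (\int[mu]_x (gauss_rV 1 x)%:E = 0)%E.
  by apply: null_set_integral => //; apply/measurable_EFinP; exact: measurable_gauss_rV.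
by move=> /esym/eqP; rewrite gt_eqF// powR_gt0// divr_gt0// pi_gt0.
Qed.

Lemma measurable_absfun u : cmeasurable u -> measurable_fun setT (absfun u).
Proof.
move=> [mr mi]; rewrite (_ : absfun u = fun x => Num.sqrt (Refun u x ^+ 2 + Imfun u x ^+ 2)).
  have ms : measurable_fun setT (@Num.sqrt R).
    by apply: continuous_measurable_fun; exact: sqrt_continuous.
  by apply: measurableT_comp ms _; apply: measurable_funD; exact: measurable_funX.
by apply/funext => x; rewrite absfunE.
Qed.

Lemma absfun_sqr u x : absfun u x ^+ 2 = Refun u x ^+ 2 + Imfun u x ^+ 2.
Proof. by rewrite absfunE sqr_sqrtr// addr_ge0// sqr_ge0. Qed.

Lemma cLnorm2_sqr u : cmeasurable u ->
  (cLnorm 2%:E u `^ 2 = \int[mu]_x (Refun u x ^+ 2 + Imfun u x ^+ 2)%:E)%E.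
Proof.
move=> mu0; rewrite poweR_Lnorm ?pnatr_eq0//; apply: eq_integral => x _ /=.
by rewrite -absfun_sqr ger0_norm ?absfun_ge0// powR_mulrn ?absfun_ge0.
Qed.

Lemma in_Lp2P u : in_Lp 2%:E u <-> csq_intg u.
Proof.
split.
  move=> [mu0 uoo]; have E := cLnorm2_sqr mu0.
  have I : (\int[mu]_x (Refun u x ^+ 2 + Imfun u x ^+ 2)%:E < +oo)%E.
    by rewrite -E; apply: poweR_lty.
  have [mr mi] := mu0.
  have i2 : intg mu (fun x => Refun u x ^+ 2 + Imfun u x ^+ 2).
    apply: ge0_intg => //; first by apply: measurable_funD; exact: measurable_funX.
    by move=> x; rewrite addr_ge0 ?sqr_ge0.
  split; (split => //; apply: le_intg i2; first exact: measurable_funX) => x;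
    by rewrite ger0_norm ?sqr_ge0 ?lerDl ?lerDr ?sqr_ge0.
move=> [[mr ir] [mi ii]]; split => //.
have := cLnorm2_sqr (conj mr mi).
have iD := intgD ir ii; rewrite -(EFin_Rintegral iD).
case E : (cLnorm 2%:E u) => [r| |]//; first by rewrite ltry.
by rewrite poweRyr ?pnatr_eq0.
Qed.

Lemma cLnorm2E u : csq_intg u -> cLnorm 2%:E u = (Num.sqrt (csqnorm u))%:E.
Proof.
move=> su; have [mu0 uoo] := (in_Lp2P u).2 su.
have [[mr ir] [mi ii]] := su.
have := cLnorm2_sqr mu0; rewrite -(EFin_Rintegral (intgD ir ii)) RintegralD//.
have : (0 <= cLnorm 2%:E u)%E by exact: Lnorm_ge0.
case: (cLnorm 2%:E u) uoo => [r| |]// _; rewrite lee_fin => r0.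
rewrite poweR_EFin powR_mulrn// /csqnorm /sqnorm => -[<-].
by rewrite sqrtr_sqr ger0_norm.
Qed.

Lemma in_LpooP u : in_Lp +oo%E u ->
  exists2 M, 0 <= M & {ae mu, forall x, absfun u x <= M}.
Proof.
move=> [mu0 uoo]; have : (0 <= cLnorm +oo%E u)%E by exact: Lnorm_ge0.
case E : (cLnorm +oo%E u) uoo => [r| |]// _; rewrite lee_fin => r0.
exists r => //; move: E; rewrite /cLnorm unlock lebesgue_rV_gt0 => E.
have := ess_sup_ge mu (abse \o (EFin \o absfun u)).
by rewrite E; apply: filterS => x /=; rewrite lee_fin; apply: le_trans; exact: ler_norm.
Qed.

Lemma ae_bounded_test_integrable a M : measurable_fun setT a ->
  {ae mu, forall x, `|a x| <= M} -> test_integrable a.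
Proof.
move=> ma aM; split => // p sp.
have ip := intg_norm (intg_rschwartz sp).
have mp := rschwartz_measurable sp.
apply/integrableP; split; first by apply/measurable_EFinP; exact: measurable_funM.
apply: (@le_lt_trans _ _ (\int[mu]_x (`|M| * `|p x|)%:E)%E).
  apply: ae_ge0_le_integral => //.
  - apply: measurableT_comp => //; apply/measurable_EFinP; exact: measurable_funM.
  - by apply/measurable_EFinP; apply: measurable_funM => //; exact: measurableT_comp.
  apply: filterS aM => x axM _ /=.
  by rewrite lee_fin normrM ler_wpM2r// (le_trans axM)// ler_norm.
by apply: ge0_intg_lty; [move=> x; rewrite mulr_ge0|exact: intgZ].
Qed.

Lemma in_Lpoo_test_integrable u : in_Lp +oo%E u -> test_integrableC u.
Proof.
move=> uoo; have [M M0 uM] := in_LpooP uoo; have [[mr mi] _] := uoo.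
split; apply: (@ae_bounded_test_integrable _ M) => //; apply: filterS uM => x.
  exact/le_trans/Re_le_absfun.
exact/le_trans/Im_le_absfun.
Qed.

Lemma test_integrable_separating a b : test_integrable a -> test_integrable b ->
  (forall p, rschwartz p -> \int[mu]_x (a x * p x) = \int[mu]_x (b x * p x)) ->
  {ae mu, forall x, a x = b x}.
Proof.
move=> [ma ai] [mb bi] ab.
have : {ae mu, forall x, a x - b x = 0}.
  apply: rschwartz_separating; first exact: measurable_funB.
    have := intgB (ai _ (rschwartz_gauss ltr01)) (bi _ (rschwartz_gauss ltr01)).
    by congr (intg mu _); apply/funext => x; rewrite mulrBl.
  move=> p sp; transitivity (\int[mu]_x (a x * p x) - \int[mu]_x (b x * p x)).
    rewrite -RintegralB//; [|exact: ai|exact: bi].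
    by apply: eq_Rintegral => x _; rewrite mulrBl.
  by rewrite ab// subrr.
by apply: filterS => x /eqP; rewrite subr_eq0 => /eqP.
Qed.

Lemma schwartz_real p : rschwartz p -> schwartz (fun x => (p x)%:C).
Proof. by move=> sp; apply/schwartzP; split => //; exact: rschwartz0. Qed.

Lemma eqD_ae u w : test_integrableC u -> test_integrableC w ->
  eqD (distr_of u) (distr_of w) ->
  {ae mu, forall x, Refun u x = Refun w x /\ Imfun u x = Imfun w x}.
Proof.
move=> tu tw uw.
have H p : rschwartz p -> \int[mu]_x (Refun u x * p x) = \int[mu]_x (Refun w x * p x) /\
    \int[mu]_x (Imfun u x * p x) = \int[mu]_x (Imfun w x * p x).
  move=> sp; have := uw _ (schwartz_real sp).
  rewrite !distr_ofE//; [|exact: schwartz_real|exact: schwartz_real].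
  have Z h : \int[mu]_x (h x * Imfun (fun x => (p x)%:C) x) = 0.
    by rewrite /Rintegral integral0_eq// => x _; rewrite mulr0.
  by rewrite !Z !subr0 !add0r => -[e1 e2].
have h1 := test_integrable_separating tu.1 tw.1 (fun p sp => (H p sp).1).
have h2 := test_integrable_separating tu.2 tw.2 (fun p sp => (H p sp).2).
by apply: filterS2 h1 h2 => x -> ->.
Qed.

Lemma in_Lp_test_integrable (r : \bar R) u : r = 2%:E \/ r = +oo%E -> in_Lp r u ->
  test_integrableC u.
Proof.
move=> [->|->]; last exact: in_Lpoo_test_integrable.
by move=> /in_Lp2P; exact: csq_test_integrable.
Qed.

(** Representatives agree almost everywhere by separation, so the infimum runs over a single
    value. *)
Lemma LnormDE (r : \bar R) T u : r = 2%:E \/ r = +oo%E -> in_Lp r u ->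
  eqD T (distr_of u) -> LnormD r T = cLnorm r u.
Proof.
move=> r2 ur Tu; rewrite /LnormD.
rewrite (_ : [set _ | _ in _] = [set cLnorm r u]); first by rewrite ereal_inf1.
apply/seteqP; split => [_ [w [wr Tw] <-]|_ ->]; last by exists u.
have uw : {ae mu, forall x, Refun w x = Refun u x /\ Imfun w x = Imfun u x}.
  apply: eqD_ae; [exact: in_Lp_test_integrable wr|exact: in_Lp_test_integrable ur|].
  by move=> phi sp; rewrite -Tw// -Tu.
have uwa : {ae mu, forall x, absfun w x = absfun u x}.
  by apply: filterS uw => x [h1 h2]; rewrite !absfunE h1 h2.
move=> {Tw}; case: r2 => r2; subst r.
  rewrite /= !cLnorm2E; try exact/in_Lp2P.
  have [h1 h2] := (in_Lp2P w).1 wr; have [_ [m1 m2]] := (in_Lp2P u).1 ur.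
  congr (Num.sqrt _)%:E; rewrite /csqnorm; congr (_ + _); apply/esym.
    by apply: (@eq_sqnorm_ae _ _ _ mu _ _ h1 ur.1.1 _).2; apply: filterS uw => x [].
  by apply: (@eq_sqnorm_ae _ _ _ mu _ _ h2 ur.1.2 _).2; apply: filterS uw => x [].
rewrite /= /cLnorm unlock lebesgue_rV_gt0; apply: eq_ess_sup.
by apply: filterS uwa => x /= ->.
Qed.

Lemma cLnormoo_le u M : (forall x, absfun u x <= M) -> (cLnorm +oo%E u <= M%:E)%E.
Proof.
move=> uM; rewrite /cLnorm unlock lebesgue_rV_gt0; apply/ess_supP.
by apply: nearW => x /=; rewrite lee_fin ger0_norm ?absfun_ge0.
Qed.

End distribution_norms.

(** * Sobolev spaces *)

Section sobolev.
Context {R : realType} {d : nat}.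
Notation mu := (@lebesgue_rV R d).
Notation V := 'rV[R]_d.
Implicit Types (a b p q h A B : V -> R) (u v w phi psi : V -> R[i]) (T U f : functional R d).

Lemma Re_realM (c : R) (z : R[i]) : complex.Re (c%:C * z) = c * complex.Re z.
Proof. by case: z => x y /=; rewrite mul0r subr0. Qed.

Lemma Im_realM (c : R) (z : R[i]) : complex.Im (c%:C * z) = c * complex.Im z.
Proof. by case: z => x y /=; rewrite mul0r addr0. Qed.

Lemma schwartz_lin (c : R[i]) phi psi : schwartz phi -> schwartz psi ->
  schwartz (fun x => c * phi x + psi x).
Proof.
move=> /schwartzP[s1 s2] /schwartzP[s3 s4]; apply/schwartzP; split.
  have := rschwartzD (rschwartzB (rschwartzZ (complex.Re c) s1) (rschwartzZ (complex.Im c) s2)) s3.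
  by congr rschwartz; apply/funext => x; rewrite /Refun /Imfun -complex_ReM; case: (_ * _) (psi x) => [? ?] [? ?].
have := rschwartzD (rschwartzD (rschwartzZ (complex.Re c) s2) (rschwartzZ (complex.Im c) s1)) s4.
by congr rschwartz; apply/funext => x; rewrite /Refun /Imfun -complex_ImM; case: (_ * _) (psi x) => [? ?] [? ?].
Qed.

Lemma test_integrable_lin a (r s : R) p q h : test_integrable a ->
  rschwartz p -> rschwartz q -> rschwartz h ->
  \int[mu]_x (a x * (r * p x + s * q x + h x)) =
  r * \int[mu]_x (a x * p x) + s * \int[mu]_x (a x * q x) + \int[mu]_x (a x * h x).
Proof.
move=> [_ ai] sp sq sh.
rewrite -!RintegralZl ?ai// -RintegralD//; [|exact/intgZ/ai|exact/intgZ/ai].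
rewrite -RintegralD ?ai//; last by apply: intgD; exact/intgZ/ai.
by apply: eq_Rintegral => x _; ring.
Qed.

Lemma distr_of_lin u (c : R[i]) phi psi : test_integrableC u ->
  schwartz phi -> schwartz psi ->
  distr_of u (fun x => c * phi x + psi x) = c * distr_of u phi + distr_of u psi.
Proof.
move=> tu sp sq; rewrite !distr_ofE//; last exact: schwartz_lin.
have [tr ti] := tu; have /schwartzP[s1 s2] := sp; have /schwartzP[s3 s4] := sq.
have ER : Refun (fun x => c * phi x + psi x) =
    fun x => complex.Re c * Refun phi x + - complex.Im c * Imfun phi x + Refun psi x.
  apply/funext => x; rewrite /Refun /Imfun mulNr -complex_ReM.
  by case: (_ * _) (psi x) => [? ?] [? ?].
have EI : Imfun (fun x => c * phi x + psi x) =
    fun x => complex.Re c * Imfun phi x + complex.Im c * Refun phi x + Imfun psi x.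
  apply/funext => x; rewrite /Refun /Imfun -complex_ImM.
  by case: (_ * _) (psi x) => [? ?] [? ?].
rewrite ER EI !test_integrable_lin//.
move: (\int[mu]_x _) (\int[mu]_x _) (\int[mu]_x _) (\int[mu]_x _).
move=> i1 i2 i3 i4.
move: (\int[mu]_x _) (\int[mu]_x _) (\int[mu]_x _) (\int[mu]_x _) => i5 i6 i7 i8.
case: c {ER EI} => cr ci /=.
by apply/eqP; rewrite eq_complex /=; apply/andP; split; apply/eqP; ring.
Qed.

Lemma normc_le (x y : R) : ComplexField.Normc.normc (x +i* y) <= `|x| + `|y|.
Proof. exact: (@absfun_le R d (fun=> x +i* y) 0). Qed.

(** The seminorm of index d+1 supplies the integrable weight (1 + |x|^2)^(-(d+1)); the factor 2
    accounts for real and imaginary parts. *)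
Lemma tempered_bounded u M : cmeasurable u -> (forall x, absfun u x <= M) ->
  tempered (distr_of u).
Proof.
move=> [mr mi] uM.
have M0 : 0 <= M := le_trans (absfun_ge0 u 0) (uM 0).
have tu : test_integrableC u.
  split; apply: (@bounded_test_integrable _ _ _ M) => // x.
    exact: le_trans (Re_le_absfun _ _) (uM x).
  exact: le_trans (Im_le_absfun _ _) (uM x).
split; first by move=> c phi psi; exact: distr_of_lin.
pose N := d.+1; pose J := \int[mu]_x ((1 + enorm x ^+ 2) ^+ N)^-1.
have Ji := @intg_japV R d N (leqnSn d) (ltn0Sn d).
have J0 : 0 <= J.
  by apply: Rintegral_ge0 => x _; rewrite invr_ge0 exprn_ge0// ltW// jap_gt0.
exists N, (2 * M * J) => phi sp.
have := seminorm_ge0 N phi; have := sp.2 N.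
case E : (schwartz_seminorm N phi) => [S| |]// _; rewrite lee_fin => S0.
rewrite -EFinM lee_fin.
have phiS x : absfun phi x <= S * ((1 + enorm x ^+ 2) ^+ N)^-1.
  rewrite ler_pdivlMr ?exprn_gt0 ?jap_gt0// mulrC -lee_fin -E.
  exact: (@seminorm_le _ _ N phi [::] x (leq0n _)).
have upS x : absfun u x * absfun phi x <= M * S * ((1 + enorm x ^+ 2) ^+ N)^-1.
  by rewrite -mulrA ler_pM ?absfun_ge0.
rewrite /distr_of /cintegral; apply: le_trans (normc_le _ _) _.
have [ti1 ti2] := tu; have /schwartzP[s1 s2] := sp.
have absM x : absfun (fun x => u x * phi x) x = absfun u x * absfun phi x.
  exact: ComplexField.Normc.normcM.
have L h : intg mu h -> (forall x, `|h x| <= absfun (fun x => u x * phi x) x) ->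
    `|\int[mu]_x h x| <= M * S * J.
  move=> hi hx; apply: le_trans (le_normr_Rintegral measurableT hi) _.
  rewrite -RintegralZl//; apply: le_Rintegral => //; [exact: intg_norm|exact: intgZ|].
  by move=> x _; apply: le_trans (hx x) _; rewrite absM.
have i1 : intg mu (Refun (fun x => u x * phi x)).
  have := intgB (ti1.2 _ s1) (ti2.2 _ s2).
  by congr (intg mu _); apply/funext => x; rewrite /Refun /Imfun complex_ReM.
have i2 : intg mu (Imfun (fun x => u x * phi x)).
  have := intgD (ti1.2 _ s2) (ti2.2 _ s1).
  by congr (intg mu _); apply/funext => x; rewrite /Refun /Imfun complex_ImM.
apply: le_trans (lerD (L _ i1 (Re_le_absfun _)) (L _ i2 (Im_le_absfun _))) _.
by rewrite mulrAC -!mulrA mulr2n mulrDl !mul1r.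
Qed.

Definition jw (s : R) u (k : V) : R[i] := (jweight s k)%:C * u k.

Lemma jweightE (s : R) (k : V) : jweight s k = jap k `^ (s / 2).
Proof. by []. Qed.

Lemma jweight_gt0 (s : R) (k : V) : 0 < jweight s k.
Proof. by rewrite powR_gt0// jap_gt0. Qed.

Lemma jweightN (s : R) (k : V) : jweight (- s) k * jweight s k = 1.
Proof. by rewrite !jweightE mulNr powRN mulVf// gt_eqF// powR_gt0// jap0. Qed.

Lemma measurable_jweight (s : R) : measurable_fun setT (@jweight R d s).
Proof. exact: measurable_jap. Qed.

Lemma schwartz_jw s phi : schwartz phi -> schwartz (jw s phi).
Proof.
move=> /schwartzP[s1 s2]; apply/schwartzP; split.
  have := rschwartz_moderateM (moderate_jap (s / 2)) s1.
  by congr rschwartz; apply/funext => x; rewrite /Refun /jw Re_realM.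
have := rschwartz_moderateM (moderate_jap (s / 2)) s2.
by congr rschwartz; apply/funext => x; rewrite /Imfun /jw Im_realM.
Qed.

Lemma jwNK s u : jw s (jw (- s) u) = u.
Proof.
apply/funext => k; rewrite /jw mulrA -(rmorphM (real_complex R)).
by rewrite [_ * jweight _ _]mulrC jweightN mul1r.
Qed.

Lemma jwKN s u : jw (- s) (jw s u) = u.
Proof. by rewrite -{2}[s]opprK jwNK. Qed.

Lemma Refun_jw s u x : Refun (jw s u) x = jweight s x * Refun u x.
Proof. exact: Re_realM. Qed.

Lemma Imfun_jw s u x : Imfun (jw s u) x = jweight s x * Imfun u x.
Proof. exact: Im_realM. Qed.

Lemma cmeasurable_jw s u : cmeasurable u -> cmeasurable (jw s u).
Proof.
have mj := measurable_jweight s.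
move=> [mr mi]; split.
  by rewrite (_ : Refun _ = fun x => jweight s x * Refun u x);
    [exact: measurable_funM|apply/funext => x; exact: Refun_jw].
by rewrite (_ : Imfun _ = fun x => jweight s x * Imfun u x);
  [exact: measurable_funM|apply/funext => x; exact: Imfun_jw].
Qed.

Lemma distr_of_jw s u phi : distr_of (jw s u) phi = distr_of u (jw s phi).
Proof.
by rewrite /distr_of; congr cintegral; apply/funext => x; rewrite /jw mulrAC mulrC.
Qed.

(* [v] is the Fourier transform of [f]. *)
Definition fourier_repr f v := forall psi, schwartz psi -> f psi = distr_of v (ifourier psi).

(** Dividing the L^2 representative of <k>^n F f by the weight gives v. The pairing is checked on
    <k>^(-n) times an inverse transform, which is again Schwartz because the weight is moderate. *)
Lemma in_sobolev_repr n f : in_sobolev n f -> exists v, [/\ cmeasurable v,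
  csq_intg (jw n v) & fourier_repr f v].
Proof.
move=> [_ [u [/in_Lp2P su fu]]]; exists (jw (- n) u); rewrite jwNK; split => //.
  by apply: cmeasurable_jw; split; [exact: su.1.1|exact: su.2.1].
move=> psi sp; rewrite distr_of_jw.
have sp' := schwartz_jw (- n) (schwartz_ifourier sp).
by rewrite -fu// /mulD /fourierD -/(jw n _) jwNK ifourierK.
Qed.

Lemma sobolev_eqD n f v : fourier_repr f v ->
  eqD (mulD (jweight n) (fourierD f)) (distr_of (jw n v)).
Proof.
move=> fv phi sp; rewrite /mulD /fourierD -/(jw n phi) fv.
  by rewrite fourierK ?distr_of_jw//; exact: schwartz_jw.
exact/schwartz_fourier/schwartz_jw.
Qed.

Lemma sobolev_normE n f v : fourier_repr f v -> csq_intg (jw n v) ->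
  sobolev_norm n f = (Num.sqrt (csqnorm (jw n v)))%:E.
Proof.
move=> fv sv; rewrite /sobolev_norm (LnormDE _ _ (sobolev_eqD n fv)); [|by left|exact/in_Lp2P].
exact: cLnorm2E.
Qed.

Lemma Lnorm2_repr f v : fourier_repr f v -> csq_intg v ->
  LnormD 2%:E f = (Num.sqrt (csqnorm v))%:E.
Proof.
move=> fv sv; have [w [sw nw wv]] := plancherel sv.
rewrite -nw -cLnorm2E//; apply: LnormDE; [by left|exact/in_Lp2P|].
by move=> phi sp; rewrite fv// wv.
Qed.

Lemma jweight_le1 n (k : V) : 0 <= n -> jweight (- n) k <= 1.
Proof.
move=> n0; rewrite jweightE mulNr powRN invf_le1 ?powR_gt0 ?jap0//.
by rewrite -[leLHS](powRr0 (jap k)) ler_powR ?jap_ge1// divr_ge0.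
Qed.

Lemma csq_jw n v : 0 <= n -> csq_intg (jw n v) ->
  csq_intg v /\ csqnorm v <= csqnorm (jw n v).
Proof.
move=> n0 [sr si].
have H a : sq_intg mu a -> sq_intg mu (fun k => jweight (- n) k * a k) /\
    sqnorm mu (fun k => jweight (- n) k * a k) <= sqnorm mu a.
  move=> sa; have sja : sq_intg mu (fun k => jweight (- n) k * a k).
    apply: (@sq_intgMb _ _ _ mu _ _ 1) => //; first exact: measurable_jweight.
    by move=> x; rewrite gtr0_norm ?jweight_gt0// jweight_le1.
  split => //; apply: le_Rintegral => //; [exact: sja.2|exact: sa.2|].
  move=> x _; rewrite exprMn -[leRHS]mul1r ler_wpM2r ?sqr_ge0//.
  by rewrite exprn_ile1 ?jweight_le1// ltW// jweight_gt0.
have Er : Refun v = fun k => jweight (- n) k * Refun (jw n v) k.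
  by apply/funext => k; rewrite -Refun_jw jwKN.
have Ei : Imfun v = fun k => jweight (- n) k * Imfun (jw n v) k.
  by apply/funext => k; rewrite -Imfun_jw jwKN.
have [h1 h2] := H _ sr; have [h3 h4] := H _ si.
by rewrite /csq_intg /csqnorm Er Ei; split; [split|exact: lerD].
Qed.

Lemma sobolev_Lnorm2_le n f : 0 <= n -> in_sobolev n f ->
  (LnormD 2%:E f <= sobolev_norm n f)%E.
Proof.
move=> n0 /in_sobolev_repr[v [mv sv fv]]; have [sv' le] := csq_jw n0 sv.
by rewrite (sobolev_normE fv sv) (Lnorm2_repr fv sv') lee_fin ler_wsqrtr.
Qed.

End sobolev.

(** * Dilations and the limit of the norm quotient *)

Section dilations.
Context {R : realType} {d : nat}.
Notation mu := (@lebesgue_rV R d).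
Notation V := 'rV[R]_d.
Implicit Types (a b p q h A B : V -> R) (u v w phi psi : V -> R[i]) (T U f : functional R d).

Lemma Rintegral_dilate l a : 0 < l -> intg mu a ->
  \int[mu]_x a (l^-1 *: x) = l ^+ d * \int[mu]_x a x.
Proof.
move=> l0 ai; have l' : l^-1 != 0 by rewrite invr_eq0 gt_eqF.
have := Rintegral_affine (0 : V) l' ai; rewrite ger0_norm ?invr_ge0 ?(ltW l0)//.
rewrite exprVn invrK => <-; by apply: eq_Rintegral => x _; rewrite addr0.
Qed.

Lemma intg_dilate l a : l != 0 -> intg mu a -> intg mu (fun x => a (l *: x)).
Proof.
move=> l0 ai; have := intg_affine (0 : V) l0 ai; congr (intg mu _).
by apply/funext => x; rewrite addr0.
Qed.

Lemma hartley_dilate l h k : 0 < l -> intg mu h ->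
  hartley (fun x => h (l^-1 *: x)) k = l ^+ d * hartley h (l *: k).
Proof.
move=> l0 hi; rewrite /hartley mulrCA; congr (_ * _).
rewrite -Rintegral_dilate//; last exact: intg_cas.
apply: eq_Rintegral => x _; congr (cas _ * _).
by rewrite [in RHS]dotrVZl [in RHS]dotrVC [in RHS]dotrVZl mulrA divff ?gt_eqF// mul1r dotrVC.
Qed.

Lemma schwartz_dilate (l : R) psi : l != 0 -> schwartz psi -> schwartz (fun x => psi (l *: x)).
Proof.
move=> l0 /schwartzP[s1 s2]; apply/schwartzP; split.
  have := rschwartz_affine (0 : V) l0 s1; congr rschwartz.
  by apply/funext => x; rewrite /Refun addr0.
have := rschwartz_affine (0 : V) l0 s2; congr rschwartz.
by apply/funext => x; rewrite /Imfun addr0.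
Qed.

Lemma ifourier_dilate l psi : 0 < l -> schwartz psi ->
  ifourier (fun x => psi (l^-1 *: x)) =
  fun k => (l ^+ d)%:C * ifourier psi (l *: k).
Proof.
move=> l0 sp; have l' : l^-1 != 0 by rewrite invr_eq0 gt_eqF.
have /schwartzP[s1 s2] := sp.
have H h k : rschwartz h ->
    hartley (fun x => h (l^-1 *: x)) k = l ^+ d * hartley h (l *: k).
  by move=> sh; rewrite hartley_dilate//; exact: intg_rschwartz.
apply/funext => k; rewrite /ifourier !fourierE//; last exact: schwartz_dilate.
have ER : Refun (fun x => psi (l^-1 *: x)) = fun x => Refun psi (l^-1 *: x) by [].
have EI : Imfun (fun x => psi (l^-1 *: x)) = fun x => Imfun psi (l^-1 *: x) by [].
rewrite ER EI /fourier_of !H// !scalerN !opprK.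
by apply/eqP; rewrite eq_complex/= !mul0r subr0 addr0; apply/andP; split; apply/eqP; field.
Qed.

(** The Fourier transform of the dilate by l of the function whose Fourier transform is v. *)
Definition dilate_fun (l : R) v (k : V) : R[i] := ((l ^+ d)^-1)%:C * v (l^-1 *: k).

Lemma distr_of_dilate l v phi : 0 < l -> test_integrableC v -> schwartz phi ->
  distr_of (dilate_fun l v) phi = distr_of v (fun k => phi (l *: k)).
Proof.
move=> l0 [[_ tr] [_ ti]] sp; have l' : l != 0 by rewrite gt_eqF.
have /schwartzP[s1 s2] := schwartz_dilate l' sp.
rewrite /distr_of /cintegral.
have H a b : intg mu b -> (forall k, a k = (l ^+ d)^-1 * b (l^-1 *: k)) ->
    \int[mu]_x a x = \int[mu]_x b x.
  move=> bi ab; under eq_Rintegral do rewrite ab.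
  have l'' : l^-1 != 0 by rewrite invr_eq0.
  rewrite RintegralZl//; last exact: intg_dilate.
  by rewrite Rintegral_dilate// mulrA mulVf ?expf_neq0// mul1r.
congr (_ +i* _); apply: H.
- have := intgB (tr _ s1) (ti _ s2); congr (intg mu _).
  by apply/funext => x; rewrite /Refun /Imfun complex_ReM.
- move=> k; rewrite /Refun /dilate_fun -mulrA Re_realM.
  by rewrite scalerA divff// scale1r.
- have := intgD (tr _ s2) (ti _ s1); congr (intg mu _).
  by apply/funext => x; rewrite /Refun /Imfun complex_ImM.
- move=> k; rewrite /Imfun /dilate_fun -mulrA Im_realM.
  by rewrite scalerA divff// scale1r.
Qed.

Lemma dilate_repr l f v : 0 < l -> test_integrableC v -> fourier_repr f v ->
  fourier_repr (dilateD l f) (dilate_fun l v).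
Proof.
move=> l0 tv fv psi sp; have l' : l^-1 != 0 by rewrite invr_eq0 gt_eqF.
have sd := schwartz_dilate l' sp.
rewrite /dilateD fv// distr_of_dilate//; last exact: schwartz_ifourier.
have sl := schwartz_dilate (lt0r_neq0 l0) (schwartz_ifourier sp).
rewrite ifourier_dilate//.
have -> : (fun k => (l ^+ d)%:C * ifourier psi (l *: k)) =
    fun k => (l ^+ d)%:C * ifourier psi (l *: k) + (fun=> 0) k.
  by apply/funext => k; rewrite addr0.
have s0 : schwartz (fun _ : V => 0 : R[i]) by apply/schwartzP; split; exact: rschwartz0.
rewrite distr_of_lin// mulrDr mulrA -(rmorphM (real_complex R)).
rewrite mulVf ?expf_neq0 ?gt_eqF// mul1r.
suff -> : distr_of v (fun=> 0) = 0 by rewrite mulr0 addr0.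
rewrite distr_ofE//.
have Z a : \int[mu]_x (a x * 0) = 0.
  by rewrite /Rintegral integral0_eq// => x _; rewrite mulr0.
by rewrite !Z subrr addr0.
Qed.

(** The weight at the dilated frequency: after the substitution k |-> l k the function v stays fixed
    and only the weight depends on l. *)
Definition jwd (l s : R) u (k : V) : R[i] := (jweight s (l *: k))%:C * u k.

Lemma csq_dilate l n v : 0 < l -> csq_intg (jwd l n v) ->
  csq_intg (jw n (dilate_fun l v)) /\
  csqnorm (jw n (dilate_fun l v)) = (l ^+ d)^-1 * csqnorm (jwd l n v).
Proof.
move=> l0 [sr si]; have l' : l^-1 != 0 by rewrite invr_eq0 gt_eqF.
have H a b : sq_intg mu a -> (forall k, b k = (l ^+ d)^-1 * a (l^-1 *: k)) ->
    sq_intg mu b /\ sqnorm mu b = (l ^+ d)^-1 * sqnorm mu a.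
  move=> [ma ai] bE; have aid := intg_dilate l' ai.
  have -> : b = fun k => (l ^+ d)^-1 * a (l^-1 *: k) by apply/funext.
  have sad : sq_intg mu (fun x => a (l^-1 *: x)).
    split => //; have := measurableT_comp ma (measurable_affine_rV l^-1 (0 : V)).
    by congr measurable_fun; apply/funext => x /=; rewrite addr0.
  split; first exact: sq_intgZ.
  rewrite sqnormZ// /sqnorm (Rintegral_dilate l0 ai) expr2 -!mulrA.
  by congr (_ * _); rewrite mulrA mulVf ?expf_neq0 ?gt_eqF// mul1r.
have [|h1 h2] := @H _ (Refun (jw n (dilate_fun l v))) sr.
  move=> k; rewrite Refun_jw /Refun /dilate_fun /jwd !Re_realM scalerA.
  by rewrite divff ?gt_eqF// scale1r mulrCA.
have [|h3 h4] := @H _ (Imfun (jw n (dilate_fun l v))) si.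
  move=> k; rewrite Imfun_jw /Imfun /dilate_fun /jwd !Im_realM scalerA.
  by rewrite divff ?gt_eqF// scale1r mulrCA.
by split => //; rewrite /csqnorm h2 h4 mulrDr.
Qed.

Lemma enorm_dilate l (k : V) : enorm (l *: k) ^+ 2 = l ^+ 2 * enorm k ^+ 2.
Proof. by rewrite !enorm_sqr dotrVZl dotrVC dotrVZl mulrA expr2. Qed.

Lemma jweight_dilate_le l n (k : V) : 0 <= n -> 0 < l <= 1 ->
  jweight n (l *: k) <= jweight n k.
Proof.
move=> n0 /andP[l0 l1]; apply: ge0_ler_powR; rewrite ?nnegrE ?divr_ge0//.
- exact/ltW/jap_gt0.
- exact/ltW/jap_gt0.
- by rewrite lerD2l enorm_dilate ler_piMl ?sqr_ge0// exprn_ile1// ltW.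
Qed.

Lemma measurable_jweight_dilate l n : measurable_fun setT (fun k : V => jweight n (l *: k)).
Proof.
have := measurableT_comp (@measurable_jweight R d n) (measurable_affine_rV l (0 : V)).
by congr measurable_fun; apply/funext => x /=; rewrite addr0.
Qed.

Lemma sq_intg_jwd l n a : 0 <= n -> 0 < l <= 1 -> measurable_fun setT a ->
  sq_intg mu (fun k => jweight n k * a k) ->
  sq_intg mu (fun k => jweight n (l *: k) * a k).
Proof.
move=> n0 l01 ma [_ ji].
have mj : measurable_fun setT (fun k : V => jweight n (l *: k) * a k).
  by apply: measurable_funM => //; exact: measurable_jweight_dilate.
split; first exact: mj.
apply: (@le_intg _ _ _ mu _ (fun k => (jweight n k * a k) ^+ 2)); last exact: ji.
  exact: measurable_funX.
move=> k; rewrite (ger0_norm (sqr_ge0 _)) !exprMn; apply: ler_wpM2r; first exact: sqr_ge0.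
by rewrite lerXn2r ?nnegrE ?(ltW (jweight_gt0 _ _))// jweight_dilate_le.
Qed.

Lemma cvg_jweight0 n (u : nat -> R) (k : V) : u @ \oo --> (0 : R) ->
  (fun m => jweight n (u m *: k)) @ \oo --> (1 : R).
Proof.
move=> u0.
have c1 : {for (1 : R), continuous (fun y : R => y `^ (n / 2))}.
  apply: differentiable_continuous; apply/derivable1_diffP.
  exact: (@ex_derive _ _ _ _ _ _ _ (is_derive1_powR (n / 2) (@ltr01 R))).
have e1 : (1 : R) `^ (n / 2) = 1 by rewrite powR1.
rewrite -[X in _ --> X]e1.
apply: (@cvg_comp _ _ _ (fun m => 1 + enorm (u m *: k) ^+ 2) (fun y : R => y `^ (n / 2))
  _ (nbhs (1 : R))); last exact: c1.
under eq_fun do rewrite enorm_dilate.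
have : (fun m => 1 + u m ^+ 2 * enorm k ^+ 2) @ \oo --> (1 + 0 ^+ 2 * enorm k ^+ 2 : R).
  by apply: cvgD; [exact: cvg_cst|apply: cvgMl; exact: cvg_sqr].
by rewrite expr0n mul0r addr0.
Qed.

Lemma cvg_sqnorm_jwd n a (u : nat -> R) : 0 <= n -> measurable_fun setT a ->
  sq_intg mu (fun k => jweight n k * a k) ->
  (forall m, 0 < u m <= 1) -> u @ \oo --> (0 : R) ->
  (fun m => sqnorm mu (fun k => jweight n (u m *: k) * a k)) @ \oo --> sqnorm mu a.
Proof.
move=> n0 ma sja u01 u0.
apply: (proj2 (@dominated_cvg_Rintegral _ V R mu
  (fun m k => (jweight n (u m *: k) * a k) ^+ 2) (fun k => a k ^+ 2)
  (fun k => (jweight n k * a k) ^+ 2) _ _ _ _ _)).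
- by move=> m; apply: measurable_funX; exact: (sq_intg_jwd n0 (u01 m) ma sja).1.
- exact: measurable_funX.
- move=> k; apply: (@cvg_sqr _ (fun m => jweight n (u m *: k) * a k)).
  by rewrite -[X in _ --> X]mul1r; apply: cvgMl; exact: cvg_jweight0.
- move=> m k; rewrite (ger0_norm (sqr_ge0 _)) !exprMn; apply: ler_wpM2r; first exact: sqr_ge0.
  by rewrite lerXn2r ?nnegrE ?(ltW (jweight_gt0 _ _))// jweight_dilate_le.
- exact: sja.2.
Qed.

Lemma csqnorm_gt0 f v : csq_intg v -> fourier_repr f v -> ~ eqD f (fun=> 0) -> 0 < csqnorm v.
Proof.
move=> [sr si] fv f0; rewrite lt_neqAle addr_ge0 ?sqnorm_ge0// andbT.
apply: contra_notN f0 => /eqP/esym/eqP.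
rewrite paddr_eq0 ?sqnorm_ge0// => /andP[/eqP r0 /eqP i0] psi sp.
rewrite fv// distr_ofE; [|exact: csq_test_integrable|exact: schwartz_ifourier].
have Z a b : sq_intg mu a -> sqnorm mu a = 0 -> measurable_fun setT b ->
    \int[mu]_x (a x * b x) = 0.
  move=> sa a0 mb; rewrite (@ae_eq_Rintegral _ _ _ mu _ (fun=> 0)).
  - by rewrite /Rintegral integral0_eq.
  - by apply: measurable_funM => //; exact: sa.1.
  - exact: measurable_cst.
  by apply: filterS (sqnorm_eq0_ae sa a0) => x ->; rewrite mul0r.
have /schwartzP[/rschwartz_measurable m1 /rschwartz_measurable m2] := schwartz_ifourier sp.
by rewrite !Z// subrr addr0.
Qed.

Lemma dilation_limit n f : 0 <= n -> in_sobolev n f -> ~ eqD f (fun=> 0) ->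
  fine (LnormD 2%:E (dilateD l f)) / fine (sobolev_norm n (dilateD l f))
    @[l --> 0^'+] --> (1 : R).
Proof.
move=> n0 /in_sobolev_repr[v [mv sjv fv]] f0.
have [sv _] := csq_jw n0 sjv; have v0 := csqnorm_gt0 sv fv f0.
have [sjr sji] := sjv; have [mr mi] := mv.
have sjr' : sq_intg mu (fun k => jweight n k * Refun v k).
  by move: sjr; congr sq_intg; apply/funext => k; rewrite Refun_jw.
have sji' : sq_intg mu (fun k => jweight n k * Imfun v k).
  by move: sji; congr sq_intg; apply/funext => k; rewrite Imfun_jw.
have Er l : Refun (jwd l n v) = fun k => jweight n (l *: k) * Refun v k.
  by apply/funext => k; rewrite /Refun /jwd Re_realM.
have Ei l : Imfun (jwd l n v) = fun k => jweight n (l *: k) * Imfun v k.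
  by apply/funext => k; rewrite /Imfun /jwd Im_realM.
have sjd l : 0 < l <= 1 -> csq_intg (jwd l n v).
  by move=> l01; split; rewrite ?Er ?Ei; exact: sq_intg_jwd.
have tv := csq_test_integrable sv.
have E l : 0 < l <= 1 ->
    fine (LnormD 2%:E (dilateD l f)) / fine (sobolev_norm n (dilateD l f)) =
    Num.sqrt (csqnorm v) / Num.sqrt (csqnorm (jwd l n v)).
  move=> l01; have /andP[l0 l1] := l01.
  have ld : 0 < (l ^+ d)^-1 by rewrite invr_gt0 exprn_gt0.
  have fl := dilate_repr l0 tv fv.
  have [s1 e1] := csq_dilate l0 (sjd _ l01).
  (* The L^2 norm is treated as the weighted norm of exponent 0, so that one scaling lemma serves
     for numerator and denominator. *)
  have jw0 u k : jwd l 0 u k = u k by rewrite /jwd /jweight mul0r powRr0 mul1r.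
  have jw0' u k : jw 0 u k = u k by rewrite /jw /jweight mul0r powRr0 mul1r.
  have : csq_intg (jwd l 0 v) by rewrite (_ : jwd l 0 v = v)//; apply/funext.
  move=> /(csq_dilate l0); rewrite (_ : jw 0 _ = dilate_fun l v); last exact/funext.
  rewrite (_ : jwd l 0 v = v); last exact/funext.
  move=> [s2 e2].
  rewrite (Lnorm2_repr fl s2) (sobolev_normE fl s1)/= e1 e2.
  rewrite !sqrtrM ?(ltW ld)// -mulf_div divff ?mul1r//.
  by rewrite gt_eqF// sqrtr_gt0.
apply/cvg_at_rightP => u [u0 cu].
(* Domination needs l <= 1. Truncating at 1 makes this hold at every index and changes only finitely
   many terms. *)
pose u' m := Num.min (u m) 1.
have u01 m : 0 < u' m <= 1 by rewrite /u' lt_min u0 ltr01 ge_min lexx orbT.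
have ule1 : \forall m \near \oo, u m <= 1.
  by near=> m; apply: ltW; near: m; apply: (cvgr_lt (0 : R)) => //; exact: ltr01.
have cu' : u' @ \oo --> (0 : R).
  apply: cvg_trans cu; apply: near_eq_cvg; near=> m.
  by rewrite /u' min_l//; near: m.
have cY : (fun m => csqnorm (jwd (u' m) n v)) @ \oo --> csqnorm v.
  rewrite /csqnorm; under eq_fun do rewrite Er Ei.
  by apply: cvgD; exact: cvg_sqnorm_jwd.
have cG : (fun m => Num.sqrt (csqnorm v) / Num.sqrt (csqnorm (jwd (u' m) n v))) @ \oo --> (1 : R).
  have s0 : Num.sqrt (csqnorm v) != 0 by rewrite gt_eqF// sqrtr_gt0.
  rewrite -[X in _ --> X](divff s0); apply: cvgMr; apply: cvgV => //.
  by apply: continuous_cvg cY; exact: sqrt_continuous.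
apply: cvg_trans cG; apply: near_eq_cvg; near=> m.
have um1 : u m <= 1 by near: m.
have um : 0 < u m <= 1 by rewrite u0 um1.
by rewrite (E _ um) /u' (min_l um1).
Unshelve. all: by end_near. Qed.

End dilations.

(** * Sharp constants *)

Section imbedding.
Context {R : realType} {d : nat}.
Notation mu := (@lebesgue_rV R d).
Notation V := 'rV[R]_d.
Notation c0 := (@hartley_cst R d).
Implicit Types (a b p q h A B : V -> R) (u v w phi psi : V -> R[i]) (T U f : functional R d).

Lemma in_sobolev_of_repr n f v : tempered f -> fourier_repr f v -> csq_intg (jw n v) ->
  in_sobolev n f.
Proof.
move=> tf fv sv; split => //; exists (jw n v); split; first exact/in_Lp2P.
exact: sobolev_eqD.
Qed.

Lemma csq_schwartz phi : schwartz phi -> csq_intg phi.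
Proof. by move=> /schwartzP[s1 s2]; split; exact: sq_intg_rschwartz. Qed.

Lemma schwartz_fourier_repr v : schwartz v -> fourier_repr (distr_of (ifourier v)) v.
Proof.
move=> sv psi sp; have si := schwartz_ifourier sv.
have [s1 s2] := (schwartzP _).1 si.
rewrite -{1}(ifourierK sp) (@distr_of_fourier _ _ _ (hartley (Refun (ifourier v)))
  (hartley (Imfun (ifourier v)))).
- by rewrite -fourierE// ifourierK.
- exact/csq_test_integrable/csq_schwartz.
- exact/rschwartz_test_integrable/rschwartz_hartley.
- exact/rschwartz_test_integrable/rschwartz_hartley.
- exact/hartley_pair_intg/intg_rschwartz.
- exact/hartley_pair_intg/intg_rschwartz.
- exact: schwartz_ifourier.
Qed.

Lemma cmeasurable_schwartz phi : schwartz phi -> cmeasurable phi.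
Proof. by move=> /schwartzP[/rschwartz_measurable ? /rschwartz_measurable ?]. Qed.

Lemma schwartz_in_sobolev n v : schwartz v -> in_sobolev n (distr_of (ifourier v)).
Proof.
move=> sv; have si := schwartz_ifourier sv.
apply: (in_sobolev_of_repr _ (schwartz_fourier_repr sv)).
  have [/rschwartz_bounded[C HC] /rschwartz_bounded[D HD]] := (schwartzP _).1 si.
  apply: (@tempered_bounded _ _ _ (C + D)); first exact: cmeasurable_schwartz.
  by move=> x; apply: le_trans (absfun_le _ _) _; exact: lerD.
exact/csq_schwartz/schwartz_jw.
Qed.

(** For the lower bound, any admissible S dominates the quotient for the dilates of a Gaussian,
    whose limit is 1. *)
Lemma imbedding_constant2 (n : R) : 0 <= n -> imbedding_constant 2%:E n d = 1%:E.
Proof.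
move=> n0; apply/le_anti/andP; split.
  apply: ereal_inf_lbound; exists 1 => //=; split => // f fn.
  by rewrite mul1e; exact: sobolev_Lnorm2_le.
apply: le_ereal_inf_tmp => _ [S [S0 HS] <-]; rewrite lee_fin.
pose v (k : V) : R[i] := (gauss_rV 1 k)%:C.
have sv : schwartz v := schwartz_real (rschwartz_gauss ltr01).
pose f : functional R d := distr_of (ifourier v).
have fv : fourier_repr f v := schwartz_fourier_repr sv.
have fn : in_sobolev n f := schwartz_in_sobolev n sv.
have f0 : ~ eqD f (fun=> 0).
  move=> f0; have := f0 _ (schwartz_fourier sv).
  rewrite fv; last exact: schwartz_fourier.
  rewrite fourierK// distr_ofE//; last exact/csq_test_integrable/csq_schwartz.
  move=> /(congr1 (@complex.Re R))/=.
  rewrite [X in _ - X](_ : _ = 0); last by rewrite /Rintegral integral0_eq// => x _; rewrite mulr0.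
  have -> : \int[mu]_x (Refun v x * Refun v x) = \int[mu]_x gauss_rV 2 x.
    by apply: eq_Rintegral => x _; rewrite /Refun/= -expRD; congr expR; ring.
  by rewrite subr0 Rintegral_gauss// => /eqP; rewrite gt_eqF// powR_gt0// divr_gt0// pi_gt0.
have L := dilation_limit n0 fn f0.
rewrite -(cvg_lim (@Rhausdorff R) L); apply: limr_le; first exact: cvgP L.
near=> l; have l0 : 0 < l by near: l; exact: nbhs_right_gt.
have l' : l^-1 != 0 by rewrite invr_eq0 gt_eqF.
(* The dilate is replaced by the functional of an explicit Schwartz function with the same Fourier
   transform: it has the same norms, and its membership in the Sobolev space is already known. *)
have svl : schwartz (dilate_fun l v).
  have := schwartz_lin ((l ^+ d)^-1)%:C (schwartz_dilate l' sv) (schwartz_real rschwartz0).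
  by congr schwartz; apply/funext => x; rewrite addr0.
have fl := dilate_repr l0 (csq_test_integrable (csq_schwartz sv)) fv.
have gl := schwartz_fourier_repr svl.
have s1 := csq_schwartz svl; have s2 := csq_schwartz (schwartz_jw n svl).
have := HS _ (schwartz_in_sobolev n svl).
rewrite (Lnorm2_repr gl s1) (sobolev_normE gl s2) (Lnorm2_repr fl s1) (sobolev_normE fl s2).
rewrite -EFinM lee_fin /=; move: (Num.sqrt _) (sqrtr_ge0 (csqnorm (jw n (dilate_fun l v)))).
move: (Num.sqrt _) => A B.
(* Division by zero returns 0, so this case only needs 0 <= S. *)
have [->|B0 + AB] := eqVneq B 0; first by move=> _ _; rewrite invr0 mulr0.
by rewrite le_eqVlt eq_sym (negbTE B0)/= => Bp; rewrite ler_pdivrMr.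
Unshelve. all: by end_near. Qed.

(** The triangle inequality for a complex integral, without the loss that separate bounds on the two
    parts would cause. If the integral is (X, Y) with modulus N, then N^2 is the integral of the
    inner product of (X, Y) with the integrand, at most N |v| by Cauchy-Schwarz in the plane. *)
Lemma absfun_fourier_of_le v x : intg mu (Refun v) -> intg mu (Imfun v) ->
  absfun (fourier_of (hartley (Refun v)) (hartley (Imfun v))) x <=
  c0 * \int[mu]_k absfun v k.
Proof.
move=> ir ii.
have cM := conj (intg_measurable ir) (intg_measurable ii).
have iv : intg mu (absfun v).
  apply: (le_intg (measurable_absfun cM) _ (intgD (intg_norm ir) (intg_norm ii))).
  by move=> k; rewrite ger0_norm ?absfun_ge0// absfun_le.
set w := fourier_of _ _.
pose X := \int[mu]_k (cos (dotrV x k) * Refun v k + sin (dotrV x k) * Imfun v k).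
pose Y := \int[mu]_k (cos (dotrV x k) * Imfun v k - sin (dotrV x k) * Refun v k).
have icr := intg_cos x ir; have ici := intg_cos x ii.
have isr := intg_sin x ir; have isi := intg_sin x ii.
have Xi := intgD icr isi; have Yi := intgB ici isr.
have wX : Refun w x = c0 * X.
  rewrite /w /Refun/= mulrDl hartley_even// hartley_odd// /X RintegralD//.
  by rewrite mulrDr.
have wY : Imfun w x = c0 * Y.
  rewrite /w /Imfun/= mulrBl hartley_even// hartley_odd// /Y RintegralB//.
  by rewrite mulrBr.
pose N := Num.sqrt (X ^+ 2 + Y ^+ 2).
have N2 : N ^+ 2 = X ^+ 2 + Y ^+ 2 by rewrite sqr_sqrtr// addr_ge0 ?sqr_ge0.
have -> : absfun w x = c0 * N.
  rewrite absfunE wX wY !exprMn -mulrDr sqrtrM ?sqr_ge0// sqrtr_sqr ger0_norm//.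
  exact/ltW/hartley_cst_gt0.
apply: ler_wpM2l; first exact/ltW/hartley_cst_gt0.
have [N0|N0] := eqVneq N 0.
  by rewrite N0; apply: Rintegral_ge0 => k _; exact: absfun_ge0.
have Np : 0 < N by rewrite lt_neqAle eq_sym N0 sqrtr_ge0.
rewrite -(ler_pM2l Np) -expr2 N2 -RintegralZl//.
have -> : X ^+ 2 + Y ^+ 2 = \int[mu]_k (X * (cos (dotrV x k) * Refun v k + sin (dotrV x k) * Imfun v k) +
    Y * (cos (dotrV x k) * Imfun v k - sin (dotrV x k) * Refun v k)).
  by rewrite RintegralD ?RintegralZl//; exact: intgZ.
apply: le_Rintegral => //; [by apply: intgD; exact: intgZ|exact: intgZ|].
move=> k _; rewrite absfunE /N -sqrtrM ?addr_ge0 ?sqr_ge0//.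
apply: le_trans (ler_norm _) _; rewrite -sqrtr_sqr ler_wsqrtr//.
have cs := cos2Dsin2 (dotrV x k).
move: (cos _) (sin _) (Refun v k) (Imfun v k) cs => c s a b cs.
have -> : (X ^+ 2 + Y ^+ 2) * (a ^+ 2 + b ^+ 2) =
    (X ^+ 2 + Y ^+ 2) * ((c * a + s * b) ^+ 2 + (c * b - s * a) ^+ 2).
  congr (_ * _); rewrite -[LHS]mul1r -cs; ring.
move: (c * a + s * b) (c * b - s * a) => e g.
have := sqr_ge0 (X * g - Y * e); rewrite -subr_ge0 => h.
rewrite -subr_ge0; apply: le_trans h _.
by rewrite le_eqVlt; apply/orP; left; apply/eqP; ring.
Qed.

Definition japint (n : R) : R := \int[mu]_k ((1 + enorm k ^+ 2) `^ (- n)).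

Lemma jweightN_sqr (n : R) (k : V) : jweight (- n) k ^+ 2 = (1 + enorm k ^+ 2) `^ (- n).
Proof.
by rewrite /jweight -powR_mulrn ?powR_ge0// -powRrM; congr (_ `^ _); field.
Qed.

Lemma sq_intg_jweightN (n : R) : d%:R / 2 < n ->
  sq_intg mu (jweight (- n)) /\ sqnorm mu (jweight (- n)) = japint n.
Proof.
move=> dn; split; last by apply: eq_Rintegral => k _; exact: jweightN_sqr.
split; first exact: measurable_jweight.
have := @intg_jap R d n dn; congr (intg mu _).
by apply/funext => k; rewrite jweightN_sqr.
Qed.

Lemma absfun_jw s v k : absfun (jw s v) k = jweight s k * absfun v k.
Proof.
rewrite !absfunE Refun_jw Imfun_jw !exprMn -mulrDr sqrtrM ?sqr_ge0//.
by rewrite sqrtr_sqr gtr0_norm// jweight_gt0.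
Qed.

Lemma sq_intg_absfun v : csq_intg v ->
  sq_intg mu (absfun v) /\ sqnorm mu (absfun v) = csqnorm v.
Proof.
move=> [[mr ir] [mi ii]].
have E : (fun k => absfun v k ^+ 2) = fun k => Refun v k ^+ 2 + Imfun v k ^+ 2.
  by apply/funext => k; exact: absfun_sqr.
split; last by rewrite /sqnorm E RintegralD.
by split; [exact: measurable_absfun|rewrite E; exact: intgD].
Qed.

Lemma sobolev_intg n v : d%:R / 2 < n -> cmeasurable v -> csq_intg (jw n v) ->
  [/\ intg mu (Refun v), intg mu (Imfun v) &
   \int[mu]_k absfun v k <= Num.sqrt (japint n) * Num.sqrt (csqnorm (jw n v))].
Proof.
move=> dn mv sv; have [sj nj] := sq_intg_jweightN dn.
have [sa na] := sq_intg_absfun sv.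
have E : absfun v = fun k => jweight (- n) k * absfun (jw n v) k.
  by apply/funext => k; rewrite -absfun_jw jwKN.
have iv : intg mu (absfun v) by rewrite E; exact: sq_intgM.
split.
- by apply: le_intg iv; [exact: mv.1|move=> k; exact: Re_le_absfun].
- by apply: le_intg iv; [exact: mv.2|move=> k; exact: Im_le_absfun].
rewrite -sqrtrM; last by rewrite -nj sqnorm_ge0.
rewrite -nj -na; apply: le_trans (ler_wsqrtr (cauchy_schwarz sj sa)).
by rewrite sqrtr_sqr E ler_norm.
Qed.

Lemma sobolev_sup n f v : d%:R / 2 < n -> cmeasurable v -> csq_intg (jw n v) ->
  fourier_repr f v ->
  let w := fun x => fourier_of (hartley (Refun v)) (hartley (Imfun v)) (- x) in
  LnormD +oo%E f = cLnorm +oo%E w /\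
  (LnormD +oo%E f <= (c0 * Num.sqrt (japint n) * Num.sqrt (csqnorm (jw n v)))%:E)%E.
Proof.
move=> dn mv sv fv w; have [ir ii le] := sobolev_intg dn mv sv.
have wle x : absfun w x <= c0 * Num.sqrt (japint n) * Num.sqrt (csqnorm (jw n v)).
  apply: le_trans (absfun_fourier_of_le (- x) ir ii) _.
  by rewrite -mulrA ler_wpM2l// ltW// hartley_cst_gt0.
have bH a : intg mu a -> test_integrable (hartley a).
  move=> ai; apply: bounded_test_integrable (fun x => hartley_le x ai).
  by apply: measurable_hartley; exact: (intg_measurable ai).
have [tw1 tw2] := test_integrable_fourier_of (bH _ ir) (bH _ ii).
have woo : in_Lp +oo%E w.
  split; last exact: le_lt_trans (cLnormoo_le wle) (ltry _).
  by split; [exact: (measurable_opp_rV tw1.1)|exact: (measurable_opp_rV tw2.1)].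
have fw : eqD f (distr_of w).
  move=> psi sp; rewrite fv// (@distr_of_ifourier _ _ _ (hartley (Refun v)) (hartley (Imfun v)))//.
  - by split; exact: intg_test_integrable.
  - exact: bH.
  - exact: bH.
  - exact: hartley_pair_intg.
  - exact: hartley_pair_intg.
have E : LnormD +oo%E f = cLnorm +oo%E w by apply: LnormDE => //; right.
by split => //; rewrite E; exact: cLnormoo_le.
Qed.

(** Besides the value of J, this is (2 pi)^(-d/2) pi^(d/4) = (4 pi)^(-d/4). *)
Lemma SplusooE n : d%:R / 2 < n -> Splusoo n d = c0 * Num.sqrt (japint n).
Proof.
move=> dn.
have n0 : 0 < n by apply: le_lt_trans dn; rewrite divr_ge0.
have G1 : 0 < Gamma (n - d%:R / 2) by apply: Gamma_gt0; rewrite subr_gt0.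
have G2 : 0 < Gamma n by exact: Gamma_gt0.
have J : japint n = pi `^ (d%:R / 2) * (Gamma (n - d%:R / 2) / Gamma n).
  by apply/EFin_inj; rewrite EFin_Rintegral; [exact: integral_jap|exact: intg_jap].
have G0 : 0 <= Gamma (n - d%:R / 2) / Gamma n by apply: divr_ge0; exact: ltW.
rewrite J sqrtrM ?powR_ge0// /Splusoo /hartley_cst mul1r mulrA; congr (_ * _).
  have pip : 0 < pi :> R by exact: pi_gt0.
  set e := d%:R / 4; have -> : d%:R / 2 = e + e :> R by rewrite /e; field.
  rewrite -powR12_sqrt ?powR_ge0// -powRrM (_ : (e + e) / 2 = e); last by field.
  rewrite powRN powRM ?ltW// powRM ?ltW//.
  rewrite !powRD ?(gt_eqF pip) ?implybT// ?pnatr_eq0 ?implybT//.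
  rewrite (_ : 4 = 2 * 2)//; last by ring.
  rewrite (@powRM _ 2 2)//; field.
  by rewrite !gt_eqF// powR_gt0.
by rewrite -powR12_sqrt// mul1r.
Qed.

Definition japV (n : R) : V -> R[i] := fun k => (1 / (1 + enorm k ^+ 2) `^ n)%:C.

Lemma Refun_japV n : Refun (japV n) = fun k => (1 + enorm k ^+ 2) `^ (- n).
Proof. by apply/funext => k; rewrite /Refun /= mul1r powRN. Qed.

(** The weighted function equals the weight <k>^(-n) it is multiplied with in Cauchy-Schwarz, which
    is the case of equality. *)
Lemma jw_japV n : jw n (japV n) = fun k => (jweight (- n) k)%:C.
Proof.
apply/funext => k; rewrite /jw /japV -(rmorphM (real_complex R)); congr (_ %:C).
have jp : 0 < 1 + enorm k ^+ 2 :> R := jap_gt0 k.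
have -> : (1 + enorm k ^+ 2) `^ n = jweight n k * jweight n k.
  by rewrite /jweight -powRD ?(gt_eqF jp) ?implybT//; congr (_ `^ _); field.
rewrite -[LHS]mul1r -{1}(jweightN n k); have := jweight_gt0 n k.
by move: (jweight n k) => y y0; field; rewrite gt_eqF.
Qed.

Lemma csq_jw_japV n : d%:R / 2 < n ->
  csq_intg (jw n (japV n)) /\ csqnorm (jw n (japV n)) = japint n.
Proof.
move=> dn; have [sj nj] := sq_intg_jweightN dn; rewrite jw_japV.
have s0 : sq_intg mu (fun _ : V => 0 : R) := sq_intg_rschwartz rschwartz0.
split; first by split.
rewrite /csqnorm -[RHS]nj -[RHS]addr0; congr (_ + _).
by rewrite /sqnorm /Rintegral integral0_eq// => x _; rewrite expr0n.
Qed.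

Lemma cmeasurable_japV n : cmeasurable (japV n).
Proof.
split; last exact: measurable_cst.
by rewrite Refun_japV; exact: measurable_jap.
Qed.

Lemma hartley0 (k : V) : hartley (fun=> 0) k = 0.
Proof. by rewrite /hartley /Rintegral integral0_eq ?mulr0// => x _; rewrite mulr0. Qed.

Lemma enormN (k : V) : enorm (- k) = enorm k.
Proof. by rewrite /enorm dotrVNl dotrVC dotrVNl opprK. Qed.

Lemma hartley_even_fun a x : intg mu a -> (forall k, a (- k) = a k) ->
  hartley a (- x) = hartley a x.
Proof.
move=> ai aN; rewrite (hartley_opp _ ai).
by rewrite (_ : (fun k => a (- k)) = a)//; apply/funext.
Qed.

Lemma fourier_of_japV n x : d%:R / 2 < n ->
  fourier_of (hartley (Refun (japV n))) (hartley (Imfun (japV n))) x =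
  (hartley (fun k => (1 + enorm k ^+ 2) `^ (- n)) x)%:C.
Proof.
move=> dn; rewrite Refun_japV (_ : Imfun (japV n) = fun=> 0)//.
rewrite /fourier_of (@hartley_even_fun _ x (@intg_jap R d n dn)).
  rewrite !hartley0 !subrr !addr0 sub0r oppr0 mul0r; congr (_ +i* _).
  by field.
by move=> k; rewrite enormN.
Qed.

(* Test [hartley a <= M] against narrow Gaussians at the origin, whose transforms
   become constant. *)
Lemma hartley_ae_le a M : intg mu a -> {ae mu, forall x, hartley a x <= M} ->
  c0 * \int[mu]_k a k <= M.
Proof.
move=> ai aM.
pose c m : R := m.+1%:R^-1.
have c_gt0 m : 0 < c m by rewrite invr_gt0 ltr0Sn.
have mg (e : R) : measurable_fun setT (fun x : V => gauss_rV e x) by exact: measurable_gauss_rV.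
have H e : 0 < e -> c0 * \int[mu]_k (a k * gauss_rV e k) <= M.
  (* Chosen so that the transform of [gauss_rV s] is a multiple of [gauss_rV e]. *)
  move=> e0; pose s := (4 * e)^-1.
  have s0 : 0 < s by rewrite invr_gt0 mulr_gt0.
  have K0 : 0 < (pi / s) `^ (d%:R / 2) :> R by rewrite powR_gt0// divr_gt0// pi_gt0.
  have gi := @intg_gauss R d s s0.
  have mH : measurable_fun setT (hartley a) by apply: measurable_hartley; exact: (intg_measurable ai).
  have hgi : intg mu (fun x => gauss_rV s x * hartley a x).
    have := intgMb mH (fun x => hartley_le x ai) gi.
    by congr (intg mu _); apply/funext => x; rewrite mulrC.
  have E : \int[mu]_x (gauss_rV s x * hartley a x) =
      (pi / s) `^ (d%:R / 2) * (c0 * \int[mu]_k (a k * gauss_rV e k)).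
    rewrite (hartley_adjoint gi ai) mulrA [_ * c0]mulrC.
    have ie : intg mu (fun k => a k * gauss_rV e k).
      have := intgMb (mg e) _ ai => /(_ 1) h.
      have := h (fun x => _); move=> {}h.
      have : intg mu (fun x => gauss_rV e x * a x).
        by apply: h => x; rewrite ger0_norm ?expR_ge0// gauss_rV_le1.
      by congr (intg mu _); apply/funext => k; rewrite mulrC.
    rewrite -RintegralZl//; apply: eq_Rintegral => k _.
    rewrite hartley_gauss// /s (_ : (4 * (4 * e)^-1)^-1 = e); first by rewrite mulrCA.
    by field; rewrite gt_eqF.
  rewrite -(ler_pM2l K0) -E -Rintegral_gauss// mulrC -RintegralZl//.
  (* The integrand is nonnegative only almost everywhere, so it is compared with its maximum with
     0. *)
  have D0 : 0 <= \int[mu]_x (M * gauss_rV s x - gauss_rV s x * hartley a x).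
    rewrite /Rintegral fine_ge0//; apply: (@le_trans _ _ (\int[mu]_x (Num.max 0 (M * gauss_rV s x - gauss_rV s x * hartley a x))%:E)%E).
      by apply: integral_ge0 => x _; rewrite lee_fin le_max lexx.
    rewrite le_eqVlt; apply/orP; left; apply/eqP; apply: ae_eq_integral => //.
    - apply/measurable_EFinP; apply: measurable_maxr => //.
      by apply: measurable_funB; [apply: measurable_funM|exact: (intg_measurable hgi)].
    - apply/measurable_EFinP.
      by apply: measurable_funB; [apply: measurable_funM|exact: (intg_measurable hgi)].
    apply: filterS aM => x xM _ /=; rewrite max_r// subr_ge0 mulrC.
    by rewrite ler_wpM2r ?expR_ge0.
  by move: D0; rewrite RintegralB ?subr_ge0//; exact: intgZ.
have L : (fun m => c0 * \int[mu]_k (a k * gauss_rV (c m) k)) @ \oo --> (c0 * \int[mu]_k a k : R).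
  apply: cvgMr.
  apply: (proj2 (@dominated_cvg_Rintegral _ V R mu (fun m k => a k * gauss_rV (c m) k)
    a (fun k => `|a k|) _ _ _ _ (intg_norm ai))).
  - by move=> m; apply: measurable_funM => //; exact: (intg_measurable ai).
  - exact: (intg_measurable ai).
  - move=> x; rewrite -[X in _ --> X]mulr1; apply: cvgMr.
    exact: cvg_gauss_rV_harmonic.
  - move=> m x; rewrite normrM -[leRHS]mulr1 ler_wpM2l//.
    by rewrite ger0_norm ?expR_ge0// gauss_rV_le1.
rewrite -(cvg_lim (@Rhausdorff R) L); apply: limr_le; first exact: cvgP L.
by apply: nearW => m; exact: H.
Qed.

(** The general bound is c0 sqrt(J) sqrt(J) here. Conversely, an essential bound for the transform
    bounds its value c0 J at the origin. *)
Lemma cLnormoo_japV n f : d%:R / 2 < n -> fourier_repr f (japV n) ->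
  LnormD +oo%E f = (c0 * japint n)%:E.
Proof.
move=> dn fv; have [sj nj] := csq_jw_japV dn.
have [E le] := sobolev_sup dn (cmeasurable_japV n) sj fv.
have J0 : 0 <= japint n by rewrite -nj addr_ge0 ?sqnorm_ge0.
rewrite nj -mulrA -expr2 sqr_sqrtr// in le.
apply/le_anti; rewrite le/=; rewrite {}E in le *; move: le.
set w := fun x => _ => le.
have ji := @intg_jap R d n dn.
have wE x : absfun w x = `|hartley (fun k => (1 + enorm k ^+ 2) `^ (- n)) x|.
  rewrite absfunE /w /Refun /Imfun fourier_of_japV//= expr0n addr0 sqrtr_sqr.
  by rewrite hartley_even_fun// => k; rewrite enormN.
have := ess_sup_ge mu (abse \o (EFin \o absfun w)).
have -> : ess_sup mu (abse \o (EFin \o absfun w)) = cLnorm +oo%E w.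
  by rewrite /cLnorm unlock lebesgue_rV_gt0.
have : (0 <= cLnorm +oo%E w)%E by exact: Lnorm_ge0.
case: (cLnorm +oo%E w) le => [M| |]// _ M0 wM.
rewrite lee_fin; apply: (hartley_ae_le ji).
apply: filterS wM => x /=; rewrite lee_fin wE normr_id.
by apply: le_trans; exact: ler_norm.
Qed.

End imbedding.

(** * The Bessel potential as extremal function *)

Section bessel.
Context {R : realType} {d : nat}.
Notation mu := (@lebesgue_rV R d).
Notation V := 'rV[R]_d.
Implicit Types (a b p q h A B : V -> R) (u v w phi psi : V -> R[i]) (T U f : functional R d).

(** [inv_fourierD] is a choice with a default value, so an inverse transform must be exhibited. As
    <k>^(-2n) is even, its Hartley transform serves; applying F twice to a test function reflects
    it, which an even function does not see. *)
Lemma japV_inverse_exists (n : R) : d%:R / 2 < n -> exists U : functional R d,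
  tempered U /\ eqD (fourierD U) (distr_of (japV n)).
Proof.
move=> dn; have ji := @intg_jap R d n dn.
pose H (x : V) : R := hartley (fun k => (1 + enorm k ^+ 2) `^ (- n)) x.
pose u (x : V) : R[i] := (H x)%:C.
have mH : measurable_fun setT H by apply: measurable_hartley; exact: (intg_measurable ji).
have bH x := hartley_le x ji.
have i0 : intg mu (fun=> 0) := intg_rschwartz rschwartz0.
have tj : test_integrableC (@japV R d n).
  split; first by rewrite Refun_japV; exact: intg_test_integrable.
  by rewrite (_ : Imfun _ = fun=> 0)//; exact: intg_test_integrable.
have tH : test_integrable H := bounded_test_integrable mH bH.
have F psi : schwartz psi -> distr_of (japV n) (fourier psi) = distr_of u psi.
  move=> sp; rewrite (@distr_of_fourier _ _ _ (hartley (Refun (japV n)))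
    (hartley (Imfun (japV n))))//.
  - by congr distr_of; apply/funext => x; rewrite fourier_of_japV.
  - by rewrite Refun_japV.
  - rewrite (_ : hartley _ = fun=> 0); first exact: intg_test_integrable.
    by apply/funext => x; rewrite (_ : Imfun _ = fun=> 0)// hartley0.
  - by rewrite Refun_japV; exact: hartley_pair_intg.
  - by rewrite (_ : Imfun _ = fun=> 0)//; exact: hartley_pair_intg.
exists (distr_of u); split.
  apply: tempered_bounded => [|x]; first by split; [exact: mH|exact: measurable_cst].
  by rewrite absfunE /Refun /Imfun/= expr0n addr0 sqrtr_sqr; exact: bH.
move=> phi sp; have sF := schwartz_fourier sp.
rewrite /fourierD -F// -[fourier (fourier phi)](_ : (fun x => phi (- x)) = _).
  have jN : (fun x : V => @japV R d n (- x)) = japV n.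
    by apply/funext => x; rewrite /japV enormN.
  by rewrite (distr_of_opp tj sp) jN.
by rewrite -{1}(fourierK sp); apply/funext => x; rewrite /ifourier opprK.
Qed.

Lemma inv_fourierD_japV (n : R) : d%:R / 2 < n ->
  let f : functional R d := inv_fourierD (distr_of (japV n)) in
  tempered f /\ fourier_repr f (japV n).
Proof.
move=> dn f; have [tf Ff] : [set U | tempered U /\ eqD (fourierD U) (distr_of (japV n))] f.
  by apply: xgetPex; exact: japV_inverse_exists.
split => // psi sp; rewrite -Ff; last exact: schwartz_ifourier.
by rewrite /fourierD ifourierK.
Qed.

Lemma bessel_attains (n : R) : d%:R / 2 < n ->
  let f : functional R d := inv_fourierD (distr_of (japV n)) in
  [/\ in_sobolev n f, sobolev_norm n f = (Num.sqrt (@japint R d n))%:E &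
    LnormD +oo%E f = ((Splusoo n d)%:E * sobolev_norm n f)%E].
Proof.
move=> dn f; have [tf ff] := inv_fourierD_japV dn.
have [sj nj] := @csq_jw_japV R d n dn.
have E : sobolev_norm n f = (Num.sqrt (@japint R d n))%:E.
  by rewrite (sobolev_normE ff sj) nj.
split => //; first exact: in_sobolev_of_repr tf ff sj.
rewrite (cLnormoo_japV dn ff) E SplusooE// -EFinM -mulrA -expr2 sqr_sqrtr//.
by rewrite -nj addr_ge0// sqnorm_ge0.
Qed.

Lemma imbedding_constantoo (n : R) : d%:R / 2 < n ->
  imbedding_constant +oo%E n d = (Splusoo n d)%:E.
Proof.
move=> dn.
have S0 : 0 < Splusoo n d :> R.
  have n0 : 0 < n by apply: le_lt_trans dn; rewrite divr_ge0.
  rewrite mulr_gt0// ?powR_gt0// ?divr_gt0// ?powR_gt0 ?mulr_gt0 ?pi_gt0//.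
    by apply: Gamma_gt0; rewrite subr_gt0.
  exact: Gamma_gt0.
(* J cannot vanish, since [Splusoo], positive by positivity of Gamma, is a multiple of its square
   root. This allows the norm of the extremal function to be cancelled. *)
have J0 : 0 < Num.sqrt (@japint R d n).
  rewrite lt_neqAle sqrtr_ge0 andbT; apply/eqP => J0.
  by move: S0; rewrite SplusooE// -J0 mulr0 ltxx.
apply/le_anti/andP; split.
  apply: ereal_inf_lbound; exists (Splusoo n d) => //=; split; first exact: ltW.
  move=> f fn; have [v [mv sv fv]] := in_sobolev_repr fn.
  have [_] := sobolev_sup dn mv sv fv.
  by rewrite (sobolev_normE fv sv) -EFinM SplusooE.
apply: le_ereal_inf_tmp => _ [S [_ HS] <-]; rewrite lee_fin.
have [fn E /esym Eoo] := bessel_attains dn.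
have := HS _ fn; rewrite -Eoo E -!EFinM lee_fin => h.
by rewrite -(ler_pM2r J0).
Qed.

End bessel.

Theorem proposition3p1 (R : realType) (d : nat) (d_ge1 : (1 <= d)%N) :
  (forall n : R, 0 <= n ->
    imbedding_constant 2%:E n d = (Splus2 n d)%:E) /\
  (forall n : R, d%:R / 2 < n ->
    imbedding_constant +oo%E n d = (Splusoo n d)%:E) /\
  (forall (n : R) (f : functional R d), 0 <= n -> in_sobolev n f ->
    ~ eqD f (fun _ => 0) ->
    (fine (LnormD 2%:E (dilateD l f)) / fine (sobolev_norm n (dilateD l f))
       @[l --> 0^'+] --> (1 : R)) /\
    1 = Splus2 n d) /\
  (forall n : R, d%:R / 2 < n ->
    let f : functional R d :=
      inv_fourierD (distr_of (fun k => (1 / (1 + enorm k ^+ 2) `^ n)%:C)) in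
    f = besselG (2 * n) /\
    in_sobolev n f /\
    LnormD +oo%E f = ((Splusoo n d)%:E * sobolev_norm n f)%E).
Proof.
split; first exact: imbedding_constant2.
split; first exact: imbedding_constantoo.
split.
  by move=> n f n0 fn f0; split => //; exact: dilation_limit.
move=> n dn f; have [fn _ Eoo] := @bessel_attains R d n dn.
split; last by split.
rewrite /f /besselG; congr (inv_fourierD (distr_of _)); apply/funext => k.
by rewrite /jweight (_ : 2 * n / 2 = n)//; field.
Qed.
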